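(* Let $\xi\in L^2(\mathcal F_T)$. Let $f:\Omega\times[0,T]\times\mathbb R\times\mathbb R^N\to\mathbb R$ be $\mathcal P\times\mathcal B(\mathbb R^{1+N})$-measurable, and suppose that there are constants $c',c''>0$ such that for all $t\in[0,T]$, $v_1,v_2\in\mathbb R$, $z_1,z_2\in\mathbb R^N$, $$|f(t,v_1,z_1)-f(t,v_2,z_2)|\le c'|v_1-v_2|+c''\|z_1-z_2\|_{X_t},$$ and that $E\big[\int_0^T|f^2(t,0,0)|\,dt\big]<\infty$. Let $(Y,Z)$ be the solution of the BSDE $$Y_t=\xi+\int_t^Tf(s,Y_s,Z_s)\,ds-\int_t^TZ_s'\,dM_s,\qquad 0\le t\le T.$$ Then there exists a constant $C'>0$, depending on the Lipschitz constants $c',c''$ of $f$ and on $T$ only, such that $$E\Big[\sup_{0\le t\le T}|Y_t|^2\Big]+E\Big[\int_0^T\|Z_t\|_{X_t}^2\,dt\Big]\le C'\,E\Big[|\xi|^2+\Big(\int_0^T|f(s,0,0)|\,ds\Big)^2\Big].$$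
   Context: Fix $T>0$. $X=\{X_t,t\ge0\}$ is a right-continuous, left-limited (RCLL) finite-state Markov chain on a probability space $(\Omega,\mathcal F,P)$ with state space the set of unit column vectors $\{e_1,\dots,e_N\}$ of $\mathbb R^N$; $\{\mathcal F_t\}$ is the completed natural filtration of $X$. $X$ has the semimartingale representation $X_t=X_0+\int_0^tA_sX_s\,ds+M_t$, where $A=\{A_t\}$ is the rate matrix of the chain, with bounded entries, and $M$ is an $\mathbb R^N$-valued (square-integrable) martingale. Prime on vectors and matrices denotes transpose. Put $\Psi_t=\mathrm{diag}(A_tX_{t-})-\mathrm{diag}(X_{t-})A_t'-A_t\,\mathrm{diag}(X_{t-})$, so that $d\langle X,X\rangle_t=\Psi_t\,dt$ for the predictable quadratic variation. For $C\in\mathbb R^N$ define the semi-norm $\|C\|_{X_t}$ by $\|C\|_{X_t}^2=C'\Psi_tC$ (where $C'$ here is the transpose of $C$). $\mathcal P$ is the predictable $\sigma$-field. $L^2(\mathcal F_t)$ is the set of real-valued $\mathcal F_t$-measurable $\xi$ with $E[|\xi|^2]<\infty$; $L^2_{\mathcal F}(0,T;\mathbb R)$ is the set of real-valued adapted RCLL processes $\phi$ with $E[\int_0^T|\phi(s)|^2ds]<\infty$; $P^2_{\mathcal F}(0,T;\mathbb R^N)$ is the set of $\mathbb R^N$-valued predictable processes $\phi$ with $E[\int_0^T\|\phi(s)\|_{X_s}^2ds]<\infty$. A solution $(Y,Z)$ of the BSDE is understood with $Y\in L^2_{\mathcal F}(0,T;\mathbb R)$ and $Z\in P^2_{\mathcal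 F}(0,T;\mathbb R^N)$; uniqueness is up to indistinguishability for $Y$ and $d\langle X,X\rangle_t\times P$-a.s. equality for $Z$. *)

(* Defs.v *)
From HB Require Import structures.
From mathcomp Require Import all_boot all_order all_algebra.
From mathcomp Require Import all_classical all_reals all_analysis.

Set Implicit Arguments.
Unset Strict Implicit.
Unset Printing Implicit Defensive.

Import Order.TTheory GRing.Theory Num.Theory.
Import numFieldTopology.Exports numFieldNormedType.Exports.

Local Open Scope classical_set_scope.
Local Open Scope ring_scope.

(* A process with values in V is a function X : R -> Omega -> V; only its
   values at times t >= 0 (or t in [0, T]) are ever constrained. *)

Local Notation leb := (@lebesgue_measure _).

(* R^N with its Borel sigma-algebra *)
Definition borel_vec (R : realType) (N : nat) :=
  g_sigma_algebraType (@open 'cV[R]_N).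

Definition measurable_wrt (U : pointedType) (F : set (set U))
    d (V : measurableType d) (D : set U) (h : U -> V) : Prop :=
  @measurable_fun _ _ (g_sigma_algebraType F) V D h.

Definition rcll (R : realType) (V : ptopologicalType) (b : \bar R) (x : R -> V)
    : Prop :=
  (forall t, 0 <= t -> (t%:E < b)%E -> x s @[s --> t^'+] --> x t) /\
  (forall t, 0 < t -> (t%:E <= b)%E -> cvg (x s @[s --> t^'-])).

(* x_{t-}, with the usual convention x_{0-} = x_0 *)
Definition left_lim (R : realType) (V : ptopologicalType) (x : R -> V) (t : R)
    : V :=
  if t <= 0 then x 0 else lim (x s @[s --> t^'-]).

Section filtration.
Context {R : realType} {d : measure_display} {Omega : measurableType d}.
Variable P : probability Omega R.

(* No completeness of (Omega, measurable, P) is required: the null sets added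
   are the measurable ones, which are all the P-null sets if P is complete. *)
Definition completed_natural_filtration N (X : R -> Omega -> 'cV[R]_N) (t : R)
    : set (set Omega) :=
  <<s [set G | (exists u (B : set (borel_vec R N)),
                 [/\ 0 <= u, u <= t, measurable B & G = X u @^-1` B]) \/
               (measurable G /\ P G = 0%E)] >>.

Variable F : R -> set (set Omega).

(* The generated sigma-algebra is the predictable sigma-field on
   Omega x [0, +oo); its trace on Omega x [0, T] is that of [0, T]. *)
Definition predictable_gen : set (set (Omega * R)) :=
  [set E | (exists2 G, F 0 G & E = G `*` [set 0]) \/
           (exists s t G, [/\ 0 <= s, s < t, F s G & E = G `*` `]s, t]])].

Definition martingale (M : R -> Omega -> R) : Prop :=
  [/\ forall t, 0 <= t -> measurable_wrt (F t) setT (M t),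
      forall t, 0 <= t -> P.-integrable setT (EFin \o M t) &
      forall s t G, 0 <= s -> s <= t -> F s G ->
        (\int[P]_(w in G) (M t w)%:E = \int[P]_(w in G) (M s w)%:E)%E].

Definition square_integrable (M : R -> Omega -> R) : Prop :=
  forall t, 0 <= t -> (\int[P]_w (`|M t w| ^+ 2)%:E < +oo)%E.

(* X takes its values in the unit vectors; the Markov property is conditional
   independence of X_t and F_s given X_s = e_i, for s <= t. *)
Definition markov_property N (X : R -> Omega -> 'cV[R]_N) : Prop :=
  forall s t (i j : 'I_N) G, 0 <= s -> s <= t -> F s G ->
    let at_s := [set w | X s w = delta_mx i 0] in
    let at_t := [set w | X t w = delta_mx j 0] in
    (P (G `&` at_s `&` at_t) * P at_s = P (G `&` at_s) * P (at_s `&` at_t))%E.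

End filtration.

(* A i j is the rate of jumping from e_j to e_i: columns sum to zero. *)
Definition rate_matrix (R : realType) N (A : R -> 'M[R]_N) : Prop :=
  [/\ forall i j,
        measurable_fun (`[0, +oo[ : set R) (fun t : R => A t i j),
      forall t i j, 0 <= t -> i != j -> 0 <= A t i j,
      forall t j, 0 <= t -> \sum_i A t i j = 0 &
      exists K, forall t i j, 0 <= t -> `|A t i j| <= K].

Section chain.
Context {R : realType} {d : measure_display} {Omega : measurableType d}.
Variables (P : probability Omega R) (N : nat).
Variables (X : R -> Omega -> 'cV[R]_N) (A : R -> 'M[R]_N).

Definition chain_martingale (t : R) (w : Omega) : 'cV[R]_N :=
  X t w - X 0 w - \col_i (\int[leb]_(s in `[0, t]) (A s *m X s w) i 0).

Record markov_chain : Prop := MarkovChain {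
  chain_measurable : forall t, 0 <= t ->
    measurable_fun setT (X t : Omega -> borel_vec R N);
  chain_unit_vectors : forall t w, 0 <= t -> exists i, X t w = delta_mx i 0;
  chain_rcll : forall w, rcll +oo%E (fun t => X t w);
  chain_markov : markov_property P (completed_natural_filtration P X) X;
  chain_rates : rate_matrix A;
  chain_semimartingale : forall i,
    martingale P (completed_natural_filtration P X)
      (fun t w => chain_martingale t w i 0) /\
    square_integrable P (fun t w => chain_martingale t w i 0)
}.

Definition Psi (t : R) (w : Omega) : 'M[R]_N :=
  let Xt := left_lim (fun s => X s w) t in
  diag_mx (A t *m Xt)^T - diag_mx Xt^T *m (A t)^T - A t *m diag_mx Xt^T.

Definition seminorm (t : R) (w : Omega) (C : 'cV[R]_N) : R :=
  Num.sqrt ((C^T *m Psi t w *m C) 0 0).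

Variable T : R.

Local Notation Ft := (completed_natural_filtration P X).

Definition L2_var (xi : Omega -> R) : Prop :=
  measurable_wrt (Ft T) setT xi /\ (\int[P]_w (`|xi w| ^+ 2)%:E < +oo)%E.

Definition L2_proc (phi : R -> Omega -> R) : Prop :=
  [/\ forall t, 0 <= t -> t <= T -> measurable_wrt (Ft t) setT (phi t),
      forall w, rcll T%:E (fun t => phi t w : R) &
      (\int[P]_w \int[leb]_(s in `[0%R, T]) (`|phi s w| ^+ 2)%:E < +oo)%E].

Definition P2_proc (phi : R -> Omega -> 'cV[R]_N) : Prop :=
  measurable_wrt (predictable_gen Ft) (setT `*` `[0, T])
    (fun x => phi x.2 x.1 : borel_vec R N) /\
  (\int[P]_w \int[leb]_(s in `[0%R, T]) (seminorm s w (phi s w) ^+ 2)%:E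
     < +oo)%E.

(* the integrand \sum_(k < size) coef_k 1_{]time_k, time_{k+1}]} *)
Record simple_integrand := SimpleIntegrand {
  si_size : nat;
  si_time : nat -> R;
  si_coef : nat -> Omega -> 'cV[R]_N
}.

Definition si_valid (H : simple_integrand) : Prop :=
  [/\ forall k, (k <= si_size H)%N -> 0 <= si_time H k /\ si_time H k <= T,
      forall k, (k < si_size H)%N -> si_time H k <= si_time H k.+1,
      forall k, (k < si_size H)%N ->
        measurable_wrt (Ft (si_time H k)) setT
          (si_coef H k : Omega -> borel_vec R N) &
      exists K, forall k w i, (k < si_size H)%N -> `|si_coef H k w i 0| <= K].

Definition si_process (H : simple_integrand) (t : R) (w : Omega) : 'cV[R]_N :=
  \sum_(k < si_size H | si_time H k < t <= si_time H k.+1) si_coef H k w.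

Definition si_integral (H : simple_integrand) (t : R) (w : Omega) : R :=
  \sum_(k < si_size H)
    ((si_coef H k w)^T *m
       (chain_martingale (Num.min (si_time H k.+1) t) w -
        chain_martingale (Num.min (si_time H k) t) w)) 0 0.

(* I is (a version of) the Ito integral \int_0^. Z' dM on [0, T], the
   L^2-isometric extension of the integral of simple predictable processes;
   d<X, X> = Psi dt, so the integrand space carries the norm of P2_proc. *)
Definition ito_integral (Z : R -> Omega -> 'cV[R]_N) (I : R -> Omega -> R)
    : Prop :=
  [/\ forall t, 0 <= t -> t <= T -> measurable_wrt (Ft t) setT (I t),
      forall w, rcll T%:E (fun t => I t w : R) &
      exists H : nat -> simple_integrand,
        [/\ forall n, si_valid (H n),
            (\int[P]_w \int[leb]_(s in `[0%R, T])
               (seminorm s w (Z s w - si_process (H n) s w) ^+ 2)%:E)%E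
              @[n --> \oo] --> 0%E &
            forall t, 0 <= t -> t <= T ->
              (\int[P]_w (`|I t w - si_integral (H n) t w| ^+ 2)%:E)%E
                @[n --> \oo] --> 0%E]].

(* measurability of f for (predictable sets of Omega x [0, T]) x B(R^{1+N}),
   the latter being B(R) x B(R^N) *)
Definition driver_measurable (f : Omega -> R -> R -> 'cV[R]_N -> R) : Prop :=
  @measurable_fun _ _
    ((g_sigma_algebraType (predictable_gen Ft) * R) * borel_vec R N)%type R
    [set x | 0 <= x.1.1.2 <= T]
    (fun x => f x.1.1.1 x.1.1.2 x.1.2 x.2).

Definition bsde_solution (xi : Omega -> R) (f : Omega -> R -> R -> 'cV[R]_N -> R)
    (Y : R -> Omega -> R) (Z : R -> Omega -> 'cV[R]_N) : Prop :=
  [/\ L2_proc Y, P2_proc Z &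
      exists2 I, ito_integral Z I &
        {ae P, forall w, forall t, 0 <= t -> t <= T ->
           Y t w = xi w + \int[leb]_(s in `[t, T]) f w s (Y s w) (Z s w)
                   - (I T w - I t w)}].

End chain.

(* Main.v *)
Require Import Defs.
From mathcomp Require Import all_boot all_order all_algebra.
From mathcomp Require Import all_classical all_reals all_analysis.
From mathcomp Require Import finmap measurable_realfun ring lra.

Set Implicit Arguments.
Unset Strict Implicit.
Unset Printing Implicit Defensive.

Import Order.TTheory GRing.Theory Num.Theory.
Import numFieldTopology.Exports numFieldNormedType.Exports.

Local Open Scope classical_set_scope.
Local Open Scope ring_scope.

(** The estimate is proved over short time intervals, where the driver can be
    absorbed, and then iterated backwards from T.

    Over an interval [a, b] with c' (b - a) and c''^2 (b - a) at most 1/128, the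
    equation reads Y_a + (I_b - I_a) = Y_b + (integral of the driver), where I is
    the stochastic integral of Z. The two terms on the left are orthogonal, so
    the variance v of I_b - I_a is at most the second moment of the right-hand
    side. By the Lipschitz condition and the Cauchy-Schwarz inequality that
    moment is controlled by Y_b, by the integral of |f(s, 0, 0)|, and by small
    multiples of the energy of Z and of the supremum of |Y|. The energy of Z is
    at most 4 v (ito_energy), and Doob's inequality (ito_maximal) bounds the
    supremum of |I - I_a| by v, hence that of |Y| by v and the data. The
    multiples of v are absorbed on the left (bsde_step). Since Y_b is itself
    controlled by the previous step, T / h steps of length h give the theorem
    (controls_grid); the number of steps and the constants involve only T, c'
    and c''.

    The properties of the stochastic integral come from its definition as a limit
    of integrals of simple integrands. The point is to see that the semi-norm is
    the density of the variance of the martingale of the chain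
    (one_step_isometry). For c known at time s, the process y = c' X and its
    square both have explicit drifts, because X is a unit vector; a direct
    computation with these drifts (drift_isometry) gives the variance of c' M.
    Orthogonality of the increments extends this to simple integrands
    (si_integral_energy), and approximation in L^2 to I.

    Suprema over uncountably many times are never integrated as such: each is
    replaced by a measurable function that dominates it, and only at the end is
    the integral of the supremum compared with that of this function
    (ae_le_lower_integral). *)

(** * Integrals and square-integrable functions *)

Section lower_integral.
Context {R : realType} {d : measure_display} {T : measurableType d}.
Variable mu : {measure set T -> \bar R}.

(** The integral of a nonnegative function is a supremum over the simple
    functions below it, so it is monotone even on functions that are not
    measurable. *)
Lemma ge0_le_lower_integral (D : set T) (f g : T -> \bar R) :
  (forall x, D x -> 0 <= f x)%E -> (forall x, D x -> f x <= g x)%E ->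
  (\int[mu]_(x in D) f x <= \int[mu]_(x in D) g x)%E.
Proof.
move=> f0 fg.
have g0 x : D x -> (0 <= g x)%E by move=> Dx; exact: le_trans (f0 _ Dx) (fg _ Dx).
rewrite !ge0_integralE//; apply: le_ereal_sup => _ [h hf <-].
exists h => // x; apply: le_trans (hf x) _; rewrite /patch.
by case: ifPn => // /set_mem; exact: fg.
Qed.

End lower_integral.

(** Adding the value +oo on a measurable null set that carries the exceptional
    points leaves the integral of Th unchanged and makes the bound hold
    everywhere. *)
Lemma ae_le_lower_integral {R : realType} {d : measure_display}
    {T : measurableType d} (mu : {measure set T -> \bar R})
    (S Th : T -> \bar R) : measurable_fun setT Th ->
  (forall w, 0 <= S w)%E -> (forall w, 0 <= Th w)%E ->
  {ae mu, forall w, (S w <= Th w)%E} ->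
  (\int[mu]_w S w <= \int[mu]_w Th w)%E.
Proof.
move=> mTh S0 Th0 [E [mE E0 sE]].
pose Th1 w := (Th w + (if w \in E then +oo else 0))%E.
have ind0 w : (0 <= if w \in E then +oo else 0 :> \bar R)%E by case: ifP.
have mind : measurable_fun setT (fun w => if w \in E then +oo else 0 : \bar R)%E.
  apply: measurable_fun_if => //.
  by apply: (measurable_fun_bool true); rewrite setTI (_ : _ @^-1` _ = E)//;
    apply/seteqP; split => w; [exact: set_mem|exact: mem_set].
have <- : (\int[mu]_w Th1 w = \int[mu]_w Th w)%E.
  apply: ge0_ae_eq_integral => //.
  - exact: emeasurable_funD.
  - by move=> w _; exact: adde_ge0.
  - exists E; split => // w; apply: contra_notP => nEw _.
    by rewrite /Th1 memNset// adde0.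
apply: ge0_le_lower_integral => // w _; rewrite /Th1.
have [Ew|nEw] := pselect (E w); last by rewrite memNset// adde0; apply: contra_notP nEw => h; exact: sE.
by rewrite mem_set// addey ?leey// gt_eqF// (lt_le_trans _ (Th0 w)) ?ltNye.
Qed.

Lemma ae_and {R : realType} {d : measure_display} {T : measurableType d}
    (mu : {measure set T -> \bar R}) (A B : T -> Prop) :
  {ae mu, forall w, A w} -> {ae mu, forall w, B w} ->
  {ae mu, forall w, A w /\ B w}.
Proof.
move=> [E [mE E0 sE]] [F [mF F0 sF]]; exists (E `|` F); split.
- exact: measurableU.
- exact: null_set_setU.
- move=> w nAB; have [Aw|nA] := pselect (A w); last by left; exact: sE.
  by right; apply: sF => Bw; apply: nAB.
Qed.

Lemma ae_impl {R : realType} {d : measure_display} {T : measurableType d}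
    (mu : {measure set T -> \bar R}) (A B : T -> Prop) :
  (forall w, A w -> B w) -> {ae mu, forall w, A w} -> {ae mu, forall w, B w}.
Proof.
move=> AB [E [mE E0 sE]]; exists E; split => // w nB; apply: sE => Aw.
exact/nB/AB.
Qed.

Section integrable_real_functions.
Context {R : realType} {d : measure_display} {T : measurableType d}.
Variable mu : {measure set T -> \bar R}.

Lemma integrable_EFinZ (k : R) (f : T -> R) : mu.-integrable setT (EFin \o f) ->
  mu.-integrable setT (EFin \o (fun w => k * f w)).
Proof. by move=> fi; exact: (integrableZl measurableT k fi). Qed.

Lemma integrable_EFinD (f g : T -> R) : mu.-integrable setT (EFin \o f) ->
  mu.-integrable setT (EFin \o g) ->
  mu.-integrable setT (EFin \o (fun w => f w + g w)).
Proof. by move=> fi gi; exact: (integrableD measurableT fi gi). Qed.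

End integrable_real_functions.

Lemma Rintegral_sum {R : realType} {d : measure_display} {T : measurableType d}
    (mu : {measure set T -> \bar R}) (D : set T) (I : Type) (r : seq I)
    (Q : pred I) (f : I -> T -> R) : measurable D ->
  (forall i, mu.-integrable D (EFin \o f i)) ->
  \int[mu]_(x in D) (\sum_(i <- r | Q i) f i x) =
  \sum_(i <- r | Q i) \int[mu]_(x in D) f i x.
Proof.
move=> mD fi; rewrite /Rintegral; under eq_integral do rewrite -sumEFin.
rewrite (integral_sum mD fi) sum_fine//.
by move=> i _; exact: (integrable_fin_num mD (fi i)).
Qed.

Section square_integrable_functions.
Context {R : realType} {d : measure_display} {T : measurableType d}.
Variable P : probability T R.

Definition L2_fun (f : T -> R) : Prop :=
  measurable_fun setT f /\ (\int[P]_w (f w ^+ 2)%:E < +oo)%E.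

Lemma L2_fun_integrable_sqr f :
  L2_fun f -> P.-integrable setT (fun w => (f w ^+ 2)%:E).
Proof.
case=> mf foo; apply/integrableP; split.
  by apply/measurable_EFinP; exact: measurable_funX.
by under eq_integral do rewrite /= ger0_norm ?sqr_ge0//.
Qed.

Lemma L2_fun_le (f : T -> R) (g : T -> \bar R) : measurable_fun setT f ->
  (forall w, (f w ^+ 2)%:E <= g w)%E -> (\int[P]_w g w < +oo)%E -> L2_fun f.
Proof.
move=> mf fg goo; split => //; apply: le_lt_trans goo.
by apply: ge0_le_lower_integral => // x _; rewrite lee_fin sqr_ge0.
Qed.

Lemma L2_fun_mul f g : L2_fun f -> L2_fun g ->
  P.-integrable setT (EFin \o (fun w => f w * g w)).
Proof.
move=> hf hg.
have i : P.-integrable setT (fun w => (f w ^+ 2)%:E + (g w ^+ 2)%:E)%E.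
  by apply: integrableD => //; exact: L2_fun_integrable_sqr.
apply: le_integrable i => //.
  by apply/measurable_EFinP; apply: measurable_funM; [case: hf|case: hg].
move=> w _ /=; rewrite lee_fin [leRHS]ger0_norm ?addr_ge0 ?sqr_ge0// ler_norml.
by apply/andP; split; nra.
Qed.

Lemma L2_funD f g : L2_fun f -> L2_fun g -> L2_fun (fun w => f w + g w).
Proof.
move=> [mf fo] [mg go].
apply: (L2_fun_le (g := fun w => 2%:E * ((f w ^+ 2)%:E + (g w ^+ 2)%:E))%E).
- exact: measurable_funD.
- by move=> w; rewrite -EFinD -EFinM lee_fin; have := sqr_ge0 (f w - g w); nra.
have m2 (h : T -> R) : measurable_fun setT h ->
    measurable_fun setT (fun w : T => (h w ^+ 2)%:E : \bar R).
  by move=> mh; apply/measurable_EFinP; exact: measurable_funX.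
have p2 (h : T -> R) : forall x : T, setT x -> (0 <= (h x ^+ 2 : R)%:E)%E.
  by move=> x _; rewrite lee_fin sqr_ge0.
rewrite ge0_integralZl//.
- by rewrite ge0_integralD//; do ?[exact: m2|exact: p2]; rewrite lte_mul_pinfty// lte_add_pinfty.
- by apply: emeasurable_funD; exact: m2.
by move=> x _; rewrite adde_ge0// lee_fin sqr_ge0.
Qed.

Lemma L2_fun_bounded (f : T -> R) (K : R) : measurable_fun setT f ->
  (forall w, `|f w| <= K) -> L2_fun f.
Proof.
move=> mf fK; apply: (L2_fun_le (g := cst (K ^+ 2)%:E)) => //.
  by move=> w; rewrite lee_fin -real_normK ?num_real// lerXn2r ?nnegrE// (le_trans _ (fK w)).
rewrite integral_cst// [X in (_ * X)%E](_ : _ = 1%E) ?mule1 ?ltry//.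
exact: probability_setT.
Qed.

Lemma L2_funM_bounded (f g : T -> R) (K : R) : L2_fun f -> measurable_fun setT g ->
  (forall w, `|g w| <= K) -> L2_fun (fun w => g w * f w).
Proof.
move=> [mf fo] mg gK.
apply: (L2_fun_le (g := fun w => (K ^+ 2)%:E * (f w ^+ 2)%:E)%E).
- exact: measurable_funM.
- move=> w; rewrite -EFinM lee_fin exprMn ler_wpM2r ?sqr_ge0//.
  by rewrite -real_normK ?num_real// lerXn2r ?nnegrE// (le_trans _ (gK w)).
rewrite ge0_integralZl//; first by rewrite lte_mul_pinfty// lee_fin sqr_ge0.
- by apply/measurable_EFinP; exact: measurable_funX.
- by move=> x _; rewrite lee_fin sqr_ge0.
by rewrite lee_fin sqr_ge0.
Qed.

Lemma L2_funN f : L2_fun f -> L2_fun (fun w => - f w).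
Proof.
move=> [mf fo]; apply: (L2_fun_le (g := fun w => (f w ^+ 2)%:E)) => //.
  exact: measurable_funN.
by move=> w; rewrite sqrrN.
Qed.

Lemma L2_funB f g : L2_fun f -> L2_fun g -> L2_fun (fun w => f w - g w).
Proof. by move=> hf hg; apply: L2_funD => //; exact: L2_funN. Qed.

Lemma L2_fun_cst c : L2_fun (cst c).
Proof. by apply: (L2_fun_bounded (K := `|c|)). Qed.

Lemma L2_fun_sum (I : Type) (r : seq I) (Q : pred I) (f : I -> T -> R) :
  (forall i, Q i -> L2_fun (f i)) -> L2_fun (fun w => \sum_(i <- r | Q i) f i w).
Proof.
move=> hf.
suff -> : (fun w => \sum_(i <- r | Q i) f i w) = \sum_(i <- r | Q i) f i.
  elim/big_ind : _ => //; [exact: (L2_fun_cst 0)|move=> ? ?; exact: L2_funD].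
by apply/funext => w; rewrite fct_sumE.
Qed.

Lemma L2_fun_integrable f : L2_fun f -> P.-integrable setT (EFin \o f).
Proof.
move=> hf; have := L2_fun_mul hf (L2_fun_cst 1).
by congr (_.-integrable _ _); apply/funext => w /=; rewrite mulr1.
Qed.

Lemma L2_fun_sqrE f : L2_fun f ->
  (\int[P]_w (f w ^+ 2)%:E = (\int[P]_w (f w ^+ 2))%:E)%E.
Proof.
move=> hf; rewrite /Rintegral fineK// integrable_fin_num//.
exact: L2_fun_integrable_sqr.
Qed.

Lemma L2_fun_sqr_le (f g h : T -> R) : L2_fun f -> L2_fun g -> L2_fun h ->
  (forall w, h w ^+ 2 <= 2 * f w ^+ 2 + 2 * g w ^+ 2) ->
  \int[P]_w (h w ^+ 2) <= 2 * \int[P]_w (f w ^+ 2) + 2 * \int[P]_w (g w ^+ 2).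
Proof.
move=> hf hg hh hle.
have fi := integrable_EFinZ 2 (L2_fun_integrable_sqr hf).
have gi := integrable_EFinZ 2 (L2_fun_integrable_sqr hg).
rewrite -(RintegralZl _ measurableT (L2_fun_integrable_sqr hf)).
rewrite -(RintegralZl _ measurableT (L2_fun_integrable_sqr hg)).
rewrite -(RintegralD measurableT fi gi); apply: le_Rintegral => //.
- exact: L2_fun_integrable_sqr.
- exact: integrable_EFinD.
Qed.

Lemma L2_fun_young (f g : T -> R) (k : R) : L2_fun f -> L2_fun g -> 0 < k ->
  2 * `|\int[P]_w (f w * g w)| <=
  k * \int[P]_w (f w ^+ 2) + k^-1 * \int[P]_w (g w ^+ 2).
Proof.
move=> hf hg k0.
have fgi := L2_fun_mul hf hg.
have fi := integrable_EFinZ k (L2_fun_integrable_sqr hf).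
have gi := integrable_EFinZ k^-1 (L2_fun_integrable_sqr hg).
rewrite -(RintegralZl _ measurableT (L2_fun_integrable_sqr hf)).
rewrite -(RintegralZl _ measurableT (L2_fun_integrable_sqr hg)).
rewrite -(RintegralD measurableT fi gi).
rewrite -[2]ger0_norm// -normrM -(RintegralZl _ measurableT fgi).
have fg2 := integrable_EFinZ 2 fgi.
apply: (le_trans (le_normr_Rintegral measurableT fg2)); apply: le_Rintegral => //.
- exact: integrable_norm.
- exact: integrable_EFinD.
move=> w _; rewrite ler_norml; set p := f w; set q := g w.
have kV : 0 <= k^-1 by rewrite invr_ge0 ltW.
have P1 : 0 <= k^-1 * (k * p + q) ^+ 2 by rewrite mulr_ge0// sqr_ge0.
have P2 : 0 <= k^-1 * (k * p - q) ^+ 2 by rewrite mulr_ge0// sqr_ge0.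
have eq1 : k^-1 * (k * p + q) ^+ 2 = k * p ^+ 2 + 2 * (p * q) + k^-1 * q ^+ 2.
  by field; rewrite gt_eqF.
have eq2 : k^-1 * (k * p - q) ^+ 2 = k * p ^+ 2 - 2 * (p * q) + k^-1 * q ^+ 2.
  by field; rewrite gt_eqF.
by rewrite eq1 in P1; rewrite eq2 in P2; apply/andP; split; lra.
Qed.

End square_integrable_functions.

(** * Orthogonality to a sub-sigma-algebra *)

Section conditional_orthogonality.
Context {R : realType} {d : measure_display} {T : measurableType d}.
Variables (P : probability T R) (G : set (set T)).
Hypothesis Gm : <<s G>> `<=` measurable.

Lemma measurable_wrt_fun d' (V : measurableType d') (h : T -> V) :
  measurable_wrt G setT h -> measurable_fun setT h.
Proof. by move=> mh _ B mB; apply: Gm; exact: mh. Qed.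

Let int0 (h : T -> R) := (\int[P]_w (h w)%:E = 0)%E.

Variable D : T -> R.
Hypothesis iD : P.-integrable setT (EFin \o D).
Hypothesis D0 : forall A, <<s G>> A -> (\int[P]_(w in A) (D w)%:E = 0)%E.

Import HBNNSimple.

Let orth_simple (h : {nnsfun g_sigma_algebraType G >-> R}) :
  int0 (fun w => h w * D w).
Proof.
have mA r : <<s G>> (h @^-1` [set r]).
  by have := @measurable_funPTI _ _ _ _ h [set r] (measurable_set1 r).
have E w : ((h w * D w)%:E = \sum_(r <- fset_set (range h))
    r%:E * ((EFin \o D) \_ (h @^-1` [set r])) w)%E.
  rewrite {1}fimfunE fsbig_finite//= mulr_suml -sumEFin.
  apply: eq_bigr => r _; rewrite patchE indicE; case: ifPn => _.
    by rewrite mulr1 EFinM.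
  by rewrite mulr0 mul0r mule0.
rewrite /int0; under eq_integral do rewrite E.
have iA r : P.-integrable setT ((EFin \o D) \_ (h @^-1` [set r])).
  have mr : d.-measurable (h @^-1` [set r]) by exact: Gm.
  by rewrite -integrable_mkcond//; apply: integrableS iD.
rewrite integral_sum//; last by move=> r; exact: integrableZl.
apply: big1 => r _.
by rewrite integralZl// -integral_mkcond D0// mule0.
Qed.

Let orth_ge0 (V : T -> R) : measurable_wrt G setT V -> (forall w, 0 <= V w) ->
  P.-integrable setT (EFin \o (fun w => V w * D w)) ->
  int0 (fun w => V w * D w).
Proof.
move=> mV V0 iVD.
have mVe : @measurable_fun _ _ (g_sigma_algebraType G) _ setT (EFin \o V).
  by apply/measurable_EFinP.
have [g [ndg cg]] := @approximation _ (g_sigma_algebraType G) R setT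
   measurableT _ mVe (fun w _ => V0 w).
have cgV w : g m w @[m --> \oo] --> V w.
  by have /fine_cvgP[_ +] : (g m w)%:E @[m --> \oo] --> (V w)%:E := cg w I.
have gV n w : g n w <= V w.
  rewrite -(cvg_lim _ (cgV w))//; apply: nondecreasing_cvgn_le; last by apply/cvg_ex; exists (V w).
  by move=> p q pq; have /lefP := ndg _ _ pq; exact.
have mD : measurable_fun setT D by apply/measurable_EFinP; exact: measurable_int iD.
have mg n : measurable_fun setT (g n : T -> R).
  by apply: measurable_wrt_fun; exact: measurable_funPT.
have m1 n : measurable_fun setT (fun w : T => (g n w * D w)%:E).
  by apply/measurable_EFinP; exact: measurable_funM.
have m2 : measurable_fun setT (fun w : T => (V w * D w)%:E).
  by apply/measurable_EFinP; apply: measurable_funM => //; exact: measurable_wrt_fun.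
have cgD : {ae P, forall w : T, setT w ->
    (g n w * D w)%:E @[n --> \oo] --> (V w * D w)%:E}.
  apply: aeW => w _; apply: cvg_EFin; first by apply: nearW.
  exact: cvgM (cgV w) (cvg_cst _).
have bgD : {ae P, forall (w : T) (n : nat), setT w ->
    (`|(g n w * D w)%:E| <= `|(V w * D w)%:E|)%E}.
  apply: aeW => w n _; rewrite lee_fin !normrM ler_wpM2r//.
  by rewrite [leLHS]ger0_norm ?[leRHS]ger0_norm.
have [_ _] := dominated_convergence measurableT m1 m2 cgD (integrable_abse iVD) bgD.
under [in X in X --> _]eq_fun do rewrite orth_simple.
by move/cvg_lim; rewrite lim_cst// /int0 => <-.
Qed.

(** The positive and negative parts of V are increasing limits of simple
    functions over G, for which the claim is the hypothesis on D; dominated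
    convergence passes to V. *)
Lemma conditional_orthogonality (V : T -> R) : measurable_wrt G setT V ->
  P.-integrable setT (EFin \o (fun w => V w * D w)) ->
  \int[P]_w (V w * D w) = 0.
Proof.
move=> mV iVD.
have mD : measurable_fun setT D by apply/measurable_EFinP; exact: measurable_int iD.
have mVT : measurable_fun setT V := measurable_wrt_fun mV.
have i1 (U : T -> R) : measurable_wrt G setT U -> (forall w, `|U w| <= `|V w|) ->
    P.-integrable setT (EFin \o (fun w => U w * D w)).
  move=> mU UV; apply: le_integrable iVD => //.
    by apply/measurable_EFinP; apply: measurable_funM => //; exact: measurable_wrt_fun.
  by move=> w _; rewrite lee_fin !normrM ler_wpM2r.
have mp : measurable_wrt G setT (V^\+) by exact: measurable_funrpos.
have mn : measurable_wrt G setT (V^\-) by exact: measurable_funrneg.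
have [Vp Vn] : (forall w, `|V^\+ w| <= `|V w|) /\ (forall w, `|V^\- w| <= `|V w|).
  have E w : V^\+ w + V^\- w = `|V w| by rewrite -[RHS](congr1 (@^~ w) (funrposDneg V)).
  by split => w; rewrite ger0_norm// -E ?lerDl ?lerDr.
have ip := i1 _ mp Vp.
have inn := i1 _ mn Vn.
have -> : (fun w => V w * D w) = (fun w => V^\+ w * D w - V^\- w * D w).
  by apply/funext => w; rewrite -mulrBl -[in LHS](funrposBneg V).
rewrite RintegralB// /Rintegral !orth_ge0 ?subrr//.
Qed.

End conditional_orthogonality.

(** * Joint measurability and time integrals of processes *)

Section process_measurability.
Context {R : realType} {d : measure_display} {Om : measurableType d}.

Lemma measurable_fun_natchoice d' (Z : measurableType d') d''
    (V : measurableType d'') (D : set Z) (k : Z -> nat) (phi : nat -> Z -> V) :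
  measurable D -> (forall m, measurable (D `&` k @^-1` [set m])) ->
  (forall m, measurable_fun D (phi m)) ->
  measurable_fun D (fun z => phi (k z) z).
Proof.
move=> mD mk mphi _ B mB.
rewrite (_ : _ `&` _ =
    \bigcup_m ((D `&` k @^-1` [set m]) `&` (D `&` phi m @^-1` B))); last first.
  apply/seteqP; split => [z [Dz Bz]|z [m _ [[Dz /= <-] [_ Bz]]]//].
  by exists (k z).
by apply: bigcup_measurable => m _; apply: measurableI => //; exact: mphi.
Qed.

Definition strip (a b : R) : set (Om * R) := setT `*` `[a, b].

Lemma measurable_strip a b : measurable (strip a b).
Proof. by apply: measurableX. Qed.

(** By right-continuity the process is the limit of its values at the next grid
    point to the right, for finer and finer grids, and each of these
    approximations takes one measurable value per grid cell. *)
Lemma measurable_right_process (X : R -> Om -> R) (a b : R) :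
  0 <= a -> a <= b ->
  (forall t, a <= t -> t <= b -> measurable_fun setT (X t)) ->
  (forall w t, a <= t -> t < b -> X s w @[s --> t^'+] --> X t w) ->
  measurable_fun (strip a b) (fun z => X z.2 z.1).
Proof.
move=> a0 ab mX rX.
pose k n (z : Om * R) := Num.truncn (z.2 * n.+1%:R).
pose q n m : R := Num.max a (Num.min b (m.+1%:R / n.+1%:R)).
have q0 n m : a <= q n m by rewrite le_max lexx.
have qb n m : q n m <= b by rewrite ge_max ab ge_min lexx.
apply: (@measurable_fun_cvg _ _ _ _ (fun n z => X (q n (k n z)) z.1)).
  move=> n; apply: (@measurable_fun_natchoice _ _ _ _ _ (k n) (fun m z => X (q n m) z.1)).
  - exact: measurable_strip.
  - move=> m; rewrite (_ : _ `&` _ = setT `*` (`[a, b] `&` `[m%:R / n.+1%:R, m.+1%:R / n.+1%:R[)).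
      by apply: measurableX => //; apply: measurableI.
    apply/seteqP; split => [[w t] [[_ /= tb] /= /eqP]|[w t] [_ [/= tb tm]]].
      move: (tb); rewrite in_itv/= => /andP[/(le_trans a0) t0 _].
      rewrite truncn_eq ?mulr_ge0// => km; split => //; split => //=.
      by rewrite in_itv/= ler_pdivrMr// ltr_pdivlMr.
    split => //=; apply/eqP; move: (tb); rewrite in_itv/= => /andP[/(le_trans a0) t0 _].
    rewrite /k truncn_eq/= ?mulr_ge0//.
    by move: tm; rewrite in_itv/= ler_pdivrMr// ltr_pdivlMr.
  - move=> m; apply: (measurableT_comp (mX _ (q0 n m) (qb n m))).
    by apply: measurable_funTS; exact: measurable_fst.
move=> [w t] [_ /=]; rewrite in_itv/= => /andP[at0 tb].
have t0 := le_trans a0 at0.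
have qE n : t < (k n (w, t)).+1%:R / n.+1%:R <= t + n.+1%:R^-1.
  have /andP[k1 k2] := truncn_itv (mulr_ge0 t0 (ler0n R n.+1)).
  by rewrite ltr_pdivlMr// k2/= ler_pdivrMr// mulrDl mulVf// -natr1 lerD2r.
have [tb'|] := ltP t b; last first.
  move=> bt; have {bt tb} E : t = b by apply/eqP; rewrite eq_le tb.
  move: qE; rewrite {t0 at0}E => qE.
  rewrite (_ : (fun n => _) = cst (X b w)); first exact: cvg_cst.
  apply/funext => n /=; congr (X _ _); rewrite /q.
  rewrite (min_idPl _); first by apply/max_idPr.
  by apply/ltW; case/andP: (qE n).
have ltq n : t < q n (k n (w, t)).
  by rewrite lt_max lt_min tb'/=; case/andP: (qE n) => ->; rewrite orbT.
move: (rX w t at0 tb') => /cvg_at_rightP; apply; split => //.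
apply: (@squeeze_cvgr _ _ _ _ (cst t) (fun n => t + n.+1%:R^-1)).
- apply: nearW => n; rewrite /= ltW//= ge_max ge_min.
  by case/andP: (qE n) => _ ->; rewrite orbT andbT (le_trans at0)// lerDl.
- exact: cvg_cst.
- rewrite -[X in _ --> X]addr0; apply: cvgD; first exact: cvg_cst.
  exact: cvg_harmonic.
Qed.

(** The left limit at t is the limit of the values at the times t - 1/n, cut off
    at 0. *)
Lemma measurable_left_process (X : R -> Om -> R) (L : R -> Om -> R) (b : R) :
  0 <= b -> measurable_fun (strip 0 b) (fun z => X z.2 z.1) ->
  (forall w, L 0 w = X 0 w) ->
  (forall w t, 0 < t -> t <= b -> X s w @[s --> t^'-] --> L t w) ->
  measurable_fun (strip 0 b) (fun z => L z.2 z.1).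
Proof.
move=> b0 mX L0 XL.
apply: (@measurable_fun_cvg _ _ _ _
  (fun n (z : Om * R) => X (Num.max 0 (z.2 - n.+1%:R^-1)) z.1)).
  move=> n.
  apply: (@measurable_comp _ _ _ _ _ _ (strip 0 b) (fun z => X z.2 z.1) _
    (fun z : Om * R => (z.1, Num.max 0 (z.2 - n.+1%:R^-1)))) => //.
  - exact: measurable_strip.
  - move=> _ [[w t] /= [_ tb'] <-]; move: tb'; rewrite /= in_itv/= => /andP[t0 tb]; split => //=.
    rewrite in_itv/= le_max lexx/= ge_max b0/= (le_trans _ tb)// gerBl//.
  - apply: measurable_funTS; apply: measurable_fun_pair; first exact: measurable_fst.
    apply: (@measurable_maxr _ _ _ _ (cst 0) (fun z : Om * R => z.2 - n.+1%:R^-1)) => //.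
    apply: (@measurable_funB _ _ _ _ snd (cst n.+1%:R^-1)) => //.
move=> [w t] [_ /=]; rewrite in_itv/= => /andP[t0 tb].
have [->|/eqP tn0] := eqVneq t 0.
  rewrite L0 (_ : (fun n => _) = cst (X 0 w)); first exact: cvg_cst.
  by apply/funext => n /=; congr (X _ _); apply/max_idPl; rewrite sub0r oppr_le0.
have {tn0}t0 : 0 < t by rewrite lt_neqAle t0 andbT eq_sym; apply/eqP.
move: (XL w t t0 tb) => /cvg_at_leftP; apply; split.
  by move=> n; rewrite gt_max t0/= gtrBl.
apply: (@squeeze_cvgr _ _ _ _ (fun n => t - n.+1%:R^-1) (cst t)).
- apply: nearW => n; rewrite /= le_max lexx orbT/= ge_max ltW//=.
  by rewrite gerBl.
- rewrite -[X in _ --> X]subr0; apply: cvgB; first exact: cvg_cst.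
  exact: cvg_harmonic.
- exact: cvg_cst.
Qed.

End process_measurability.

Section time_integrals.
Context {R : realType} {d : measure_display} {Om : measurableType d}.
Local Notation leb := (@lebesgue_measure R).

Lemma measurable_strip_section (g : R -> Om -> R) a b w :
  measurable_fun (strip a b) (fun z => g z.2 z.1) ->
  measurable_fun `[a, b] (g^~ w).
Proof.
move=> mg; apply: (@measurable_comp _ _ _ _ _ _ (strip a b) (fun z => g z.2 z.1) _ (pair w)) => //.
- exact: measurable_strip.
- by move=> _ [t tab <-].
- by apply: measurable_funTS; exact: pair1_measurable.
Qed.

Lemma measurable_stripS (g : Om * R -> R) a b a' b' : a <= a' -> b' <= b ->
  measurable_fun (strip a b) g -> measurable_fun (strip a' b') g.
Proof.
move=> aa bb; apply: measurable_funS; first exact: measurable_strip.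
move=> [w t] [_ /=]; rewrite in_itv/= => /andP[? ?]; split => //=.
by rewrite in_itv/= (le_trans aa)//= (le_trans _ bb).
Qed.

Let patchE (g : R -> Om -> \bar R) a b w :
  ((g^~ w) \_ `[a, b]) = fun t => ((fun z => g z.2 z.1) \_ (strip a b)) (w, t).
Proof.
apply/funext => t; rewrite /patch/=; congr (if _ then _ else _).
by apply/idP/idP => /set_mem h; apply/mem_set => //; case: h.
Qed.

Lemma measurable_time_integral (g : R -> Om -> \bar R) a b :
  measurable_fun (strip a b) (fun z => g z.2 z.1) -> (forall t w, 0 <= g t w)%E ->
  measurable_fun setT (fun w => \int[leb]_(t in `[a, b]) g t w)%E.
Proof.
move=> mg g0.
under eq_fun do rewrite integral_mkcond patchE.
apply: (@measurable_fun_fubini_tonelli_F _ _ _ _ _ leb).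
  by have [+ _] := measurable_restrictT (fun z : Om * R => g z.2 z.1) (measurable_strip a b); exact.
by move=> z; rewrite /patch; case: ifP.
Qed.

End time_integrals.

Section bounded_time_integrals.
Context {R : realType} {d : measure_display} {Om : measurableType d}.
Variable P : probability Om R.
Local Notation leb := (@lebesgue_measure R).

Lemma lebesgue_itv_cc (a b : R) : a <= b -> leb `[a, b] = (b - a)%:E.
Proof.
rewrite le_eqVlt => /predU1P[->|ab].
  by rewrite set_itv1 lebesgue_measure_set1 subrr.
by rewrite lebesgue_measure_itv/= lte_fin ab EFinB.
Qed.

Lemma integrable_itv_bounded (h : R -> R) (a b K : R) : measurable_fun `[a, b] h ->
  (forall t, a <= t -> t <= b -> `|h t| <= K) ->
  leb.-integrable `[a, b] (EFin \o h).
Proof.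
move=> mh hK; apply: measurable_bounded_integrable => //.
  have [ab|ba] := leP a b; last first.
    by rewrite set_itv_ge// ?measure0// bnd_simp -ltNge.
  rewrite [ltLHS](_ : _ = (b - a)%:E) ?ltry//; exact: lebesgue_itv_cc.
exists K; split => [|M KM t]; first exact: num_real.
by rewrite /= in_itv/= => /andP[? ?]; rewrite (le_trans (hK _ _ _))// ltW.
Qed.

Lemma Rintegral_itv_bound (h : R -> R) (a b K : R) : a <= b ->
  measurable_fun `[a, b] h ->
  (forall t, a <= t -> t <= b -> `|h t| <= K) ->
  `|\int[leb]_(t in `[a, b]) h t| <= K * (b - a).
Proof.
move=> ab mh hK; have ih := integrable_itv_bounded mh hK.
apply: (le_trans (le_normr_Rintegral _ ih)) => //.
have -> : K * (b - a) = \int[leb]_(t in `[a, b]) (cst K t).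
  rewrite Rintegral_cst//; congr (_ * _).
  by rewrite -[LHS]/(fine (b - a)%:E); congr fine; exact/esym/lebesgue_itv_cc.
apply: le_Rintegral => //.
- exact: integrable_norm.
- apply: (@integrable_itv_bounded _ _ _ `|K|) => //.
- by move=> t; rewrite /= in_itv/= => /andP[? ?]; exact: hK.
Qed.

Lemma Rintegral_itv_add (h : R -> R) (a b c : R) : a <= b -> b <= c ->
  leb.-integrable `[a, c] (EFin \o h) ->
  \int[leb]_(t in `[a, c]) h t =
  \int[leb]_(t in `[a, b]) h t + \int[leb]_(t in `[b, c]) h t.
Proof.
move=> ab bc ih.
have := @Rintegral_itvB _ h (BLeft a) (BRight c) b ih.
rewrite !bnd_simp => /(_ ab bc) E.
rewrite -[X in _ + X](@Rintegral_itv_obnd_cbnd _ b (BRight c)); last first.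
  apply: integrableS ih => // t; rewrite /= !in_itv/= => /andP[bt ->].
  by rewrite (le_trans ab)// ltW.
by rewrite -E addrC subrK.
Qed.

Lemma Rintegral_itv_split (h : R -> R) (a b c K : R) : a <= b -> b <= c ->
  measurable_fun `[a, c] h ->
  (forall t, a <= t -> t <= c -> `|h t| <= K) ->
  \int[leb]_(t in `[a, c]) h t =
  \int[leb]_(t in `[a, b]) h t + \int[leb]_(t in `[b, c]) h t.
Proof.
by move=> ab bc mh hK; apply: Rintegral_itv_add => //; exact: integrable_itv_bounded mh hK.
Qed.

Section fubini.
Variables (g : R -> Om -> R) (a b K : R).
Hypotheses (mg : measurable_fun (strip a b) (fun z => g z.2 z.1))
  (gK : forall t w, a <= t -> t <= b -> `|g t w| <= K).

Let G (z : Om * R) : \bar R := ((EFin \o (fun z : Om * R => g z.2 z.1)) \_ (strip a b)) z.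

Let GE w : ((EFin \o g^~ w) \_ `[a, b]) = fun t => G (w, t).
Proof.
apply/funext => t; rewrite /G /patch/=; congr (if _ then _ else _).
by apply/idP/idP => /set_mem h; apply/mem_set => //; case: h.
Qed.

Let mG : measurable_fun setT G.
Proof.
have [+ _] := measurable_restrictT (EFin \o (fun z : Om * R => g z.2 z.1))
  (measurable_strip a b).
by apply; apply/measurable_EFinP.
Qed.

Let iG : (P \x leb)%E.-integrable setT G.
Proof.
apply/integrable12ltyP => //.
apply: (@le_lt_trans _ _ (\int[P]_w (cst (`|K| * `|b - a|)%:E) w)%E); last first.
  rewrite integral_cst// [X in (_ * X)%E](_ : _ = 1%E) ?mule1 ?ltry//.
  exact: probability_setT.
apply: ge0_le_lower_integral => w _; first exact: integral_ge0.
have [ab|ba] := leP a b; last first.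
  rewrite integral0_eq ?lee_fin ?mulr_ge0// => t _; rewrite /G /patch ifF ?abse0//.
  apply/negP => /set_mem [_] /=; rewrite in_itv/= => /andP[at1 tb].
  by have := le_lt_trans (le_trans at1 tb) ba; rewrite ltxx.
apply: (@le_trans _ _ (\int[leb]_(t in `[a, b]) (cst `|K|%:E) t)%E).
  rewrite [leRHS]integral_mkcond; apply: ge0_le_lower_integral => // t _.
  rewrite /G /patch; case: ifPn => [/set_mem[_ /= tab]|_].
    rewrite ifT; last exact/mem_set.
    move: tab; rewrite /= in_itv/= lee_fin => /andP[at1 tb].
    by rewrite (le_trans (gK _ at1 tb))// ler_norm.
  by rewrite abse0; case: ifP => _ //=; rewrite lee_fin.
rewrite integral_cst// [X in (_ * X)%E](_ : _ = (b - a)%:E).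
  by rewrite -EFinM lee_fin ler_wpM2l// ler_norm.
exact: lebesgue_itv_cc.
Qed.

Let inner w : (\int[leb]_t G (w, t) = (\int[leb]_(t in `[a, b]) g t w)%:E)%E.
Proof.
have -> : (\int[leb]_t G (w, t) = \int[leb]_(t in `[a, b]) (g t w)%:E)%E.
  by rewrite [RHS]integral_mkcond; congr (integral _ _ _); rewrite -GE.
rewrite /Rintegral fineK// integrable_fin_num//.
by apply: integrable_itv_bounded (gK ^~ w); exact: measurable_strip_section.
Qed.

Lemma measurable_time_Rintegral :
  measurable_fun setT (fun w => \int[leb]_(t in `[a, b]) g t w).
Proof.
apply/measurable_EFinP; have := measurable_fubini_F iG; rewrite /fubini_F.
by under eq_fun do rewrite inner.
Qed.

Lemma time_Rintegral_fubini :
  \int[P]_w \int[leb]_(t in `[a, b]) g t w =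
  \int[leb]_(t in `[a, b]) \int[P]_w g t w.
Proof.
rewrite /Rintegral; congr fine.
under eq_integral do rewrite -/(Rintegral _ _ _) -inner.
rewrite (Fubini iG) [RHS]integral_mkcond; apply: eq_integral => t _.
rewrite /G /patch /=; case: ifPn => tab.
  rewrite fineK.
    apply: eq_integral => w _ /=; rewrite ifT//; apply/mem_set; split => //=.
    exact: set_mem tab.
  apply: integrable_fin_num => //; apply: L2_fun_integrable.
  move/set_mem : tab; rewrite /= in_itv/= => /andP[at1 tb].
  apply: (@L2_fun_bounded _ _ _ _ _ K) => [|w]; last exact: gK.
  apply: (@measurable_comp _ _ _ _ _ _ (strip a b) (fun z => g z.2 z.1) _ (fun w => (w, t))) => //.
  - exact: measurable_strip.
  - by move=> _ [w _ <-]; split => //=; rewrite in_itv/= at1.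
rewrite integral0_eq// => w _ /=; rewrite ifF//; apply/negP => /set_mem [_ /= tab'].
by move/negP: tab; apply; apply/mem_set.
Qed.

End fubini.

Section lipschitz_primitive.
Variables (h : R -> R) (a b K : R).
Hypotheses (ab : a <= b) (mh : measurable_fun `[a, b] h)
  (hK : forall t, a <= t -> t <= b -> `|h t| <= K).

Let H t := \int[leb]_(u in `[a, t]) h u.

Lemma primitive_itv s t : a <= s -> s <= t -> t <= b ->
  H t = H s + \int[leb]_(u in `[s, t]) h u.
Proof.
move=> as_ st tb; apply: (@Rintegral_itv_split _ _ _ _ K) => //.
  apply: measurable_funS mh => // u; rewrite /= !in_itv/= => /andP[-> ut].
  by rewrite (le_trans ut).
by move=> u au ut; apply: hK => //; exact: le_trans tb.
Qed.

Lemma primitive_lipschitz s t : a <= s -> s <= t -> t <= b ->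
  `|H t - H s| <= K * (t - s).
Proof.
move=> as_ st tb; rewrite (primitive_itv as_ st tb) addrC addKr.
apply: Rintegral_itv_bound => //.
  apply: measurable_funS mh => // u; rewrite /= !in_itv/= => /andP[su ut].
  by rewrite (le_trans as_)//= (le_trans ut).
by move=> u su ut; apply: hK; [exact: le_trans su|exact: le_trans tb].
Qed.

Lemma primitive_cvg_right t : a <= t -> t < b -> H s @[s --> t^'+] --> H t.
Proof.
move=> at_ tb; apply/cvgrPdist_le => e e0.
have K0 : 0 <= K by exact: le_trans (hK at_ (ltW tb)).
near=> s.
have ts : t <= s by apply/ltW; near: s; exact: nbhs_right_gt.
have sb : s <= b by near: s; exact: nbhs_right_le.
rewrite distrC; apply: le_trans (primitive_lipschitz at_ ts sb) _.
have : s - t <= e / (K + 1).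
  by rewrite lerBlDl; near: s; apply: nbhs_right_le; rewrite ltrDl divr_gt0// ltr_wpDl.
move=> /(ler_wpM2l K0)/le_trans; apply.
by rewrite mulrCA ger_pMr// ler_pdivrMr ?ltr_wpDl// mul1r lerDl.
Unshelve. all: by end_near. Qed.

End lipschitz_primitive.

(** Over n equal steps the total change is at most n times a multiple of 1/n^2.
    This replaces differentiation where the derivative exists only almost
    everywhere. *)
Lemma quadratic_increments_cst (phi : R -> R) (a b C : R) : a <= b ->
  (forall s t, a <= s -> s <= t -> t <= b -> `|phi t - phi s| <= C * (t - s) ^+ 2) ->
  phi b = phi a.
Proof.
move=> ab phiC.
pose mesh n : R := (b - a) / n.+1%:R.
have step n k : (k <= n.+1)%N ->
    `|phi (a + k%:R * mesh n) - phi a| <= k%:R * (C * mesh n ^+ 2).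
  move=> kn; set h := mesh n; have h0 : 0 <= h by rewrite divr_ge0// subr_ge0.
  elim: k kn => [_|k IH kn]; first by rewrite !mul0r addr0 subrr normr0.
  have E : phi (a + k.+1%:R * h) - phi a = (phi (a + k.+1%:R * h) - phi (a + k%:R * h))
     + (phi (a + k%:R * h) - phi a) by ring.
  rewrite {}E (le_trans (ler_normD _ _))// -[in leRHS]natr1 mulrDl mul1r addrC.
  apply: lerD; first by apply: IH; exact: ltnW.
  apply: (le_trans (phiC _ _ _ _ _)).
  - by rewrite lerDl mulr_ge0.
  - by rewrite lerD2l ler_wpM2r// ler_nat.
  - have kn' : k.+1%:R <= n.+1%:R :> R by rewrite ler_nat.
    have := ler_wpM2r h0 kn'; rewrite [n.+1%:R * h]mulrC /h /mesh mulfVK//.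
    by rewrite lerBrDl.
  - by rewrite (_ : _ - _ = h)// -natr1; ring.
have lim0 : (C * (b - a) ^+ 2) * n.+1%:R^-1 @[n --> \oo] --> 0.
  by rewrite -[X in _ --> X](mulr0 (C * (b - a) ^+ 2)); apply: cvgM; [exact: cvg_cst|exact: cvg_harmonic].
apply/eqP; rewrite -subr_eq0 -normr_le0.
rewrite -(cvg_lim _ lim0)//; apply: limr_ge; first by apply/cvg_ex; exists 0.
apply: nearW => n; have := step n n.+1 (leqnn _).
have nz : n.+1%:R != 0 :> R by [].
rewrite (_ : a + n.+1%:R * mesh n = b); last by rewrite /mesh; field.
by move=> /le_trans; apply; rewrite le_eqVlt; apply/orP; left; apply/eqP; rewrite /mesh; field.
Qed.

End bounded_time_integrals.

(** * Primitives of bounded functions *)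

Section primitives.
Context {R : realType} {d : measure_display} {Om : measurableType d}.
Local Notation leb := (@lebesgue_measure R).

Lemma measurable_primitive (g : R -> Om -> R) (a b K : R) : 0 <= a -> a <= b ->
  measurable_fun (strip a b) (fun z : Om * R => g z.2 z.1) ->
  (forall t w, a <= t -> t <= b -> `|g t w| <= K) ->
  measurable_fun (strip a b) (fun z : Om * R => \int[leb]_(u in `[a, z.2]) g u z.1).
Proof.
move=> a0 ab mg gK.
apply: (@measurable_right_process _ _ _ (fun t w => \int[leb]_(u in `[a, t]) g u w)) => //.
  (* the measurability of a time integral does not involve the probability, so
     any probability on Om serves here *)
  move=> t at_ tb; apply: (@measurable_time_Rintegral _ _ _ (dirac point) _ _ _ K).
    exact: measurable_stripS mg.
  by move=> u w au ut; apply: gK => //; exact: le_trans tb.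
move=> w t at_ tb.
apply: (@primitive_cvg_right _ (fun u => g u w) a b K) => //.
  exact: measurable_strip_section.
by move=> u au ub; exact: gK.
Qed.

(** The chain rule for the square of a primitive of a bounded function that
    need not be continuous: the two sides differ by a function of t whose
    increments over [s, t] are quadratic in t - s. *)
Lemma primitive_sqr (h : R -> R) (a b K : R) :
  let H t := \int[leb]_(u in `[a, t]) h u in
  a <= b -> measurable_fun `[a, b] h -> measurable_fun `[a, b] H ->
  (forall t, a <= t -> t <= b -> `|h t| <= K) ->
  \int[leb]_(u in `[a, b]) (H u * h u) = H b ^+ 2 / 2.
Proof.
move=> H ab mh mH hK.
have K0 : 0 <= K by apply: le_trans (hK a _ ab).
have H0 : H a = 0 by rewrite /H set_itv1 Rintegral_set1.
have lipH s t : a <= s -> s <= t -> t <= b -> `|H t - H s| <= K * (t - s).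
  exact: (primitive_lipschitz mh hK).
have addH s t : a <= s -> s <= t -> t <= b ->
    H t = H s + \int[leb]_(u in `[s, t]) h u by exact: (primitive_itv mh hK).
clearbody H.
have mS s t (f : R -> R) : a <= s -> t <= b -> measurable_fun `[a, b] f ->
    measurable_fun `[s, t] f.
  move=> as_ tb; apply: measurable_funS => // u; rewrite /= !in_itv/= => /andP[su ut].
  by rewrite (le_trans as_)//= (le_trans ut).
have mHh : measurable_fun `[a, b] (fun u => H u * h u) by exact: measurable_funM.
have HK t : a <= t -> t <= b -> `|H t| <= K * (b - a).
  move=> at_ tb; have := lipH _ _ (lexx a) at_ tb.
  rewrite H0 subr0 => /le_trans; apply.
  by rewrite ler_wpM2l// lerD2r.
have HhK t : a <= t -> t <= b -> `|H t * h t| <= K * (b - a) * K.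
  by move=> at_ tb; rewrite normrM ler_pM ?HK ?hK.
pose J t := \int[leb]_(u in `[a, t]) (H u * h u).
pose phi t := H t ^+ 2 - 2 * J t.
suff : phi b = phi a.
  rewrite /phi /J H0 set_itv1 Rintegral_set1 expr0n/= mulr0 subr0 => /eqP.
  by rewrite subr_eq0 => /eqP ->; field.
apply: (@quadratic_increments_cst _ _ _ _ (3 * K ^+ 2)) => // s t as_ st tb.
have sb := le_trans st tb; have at_ := le_trans as_ st.
have iv (f : R -> R) (M : R) : measurable_fun `[a, b] f -> (forall u, a <= u -> u <= b -> `|f u| <= M) ->
    leb.-integrable `[s, t] (EFin \o f).
  move=> mf fM; apply: (@integrable_itv_bounded _ _ _ _ M); first exact: mS.
  by move=> u su ut; apply: fM; [exact: le_trans su|exact: le_trans tb].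
have dH : H t = H s + \int[leb]_(u in `[s, t]) h u.
  exact: addH.
have dJ : J t = J s + \int[leb]_(u in `[s, t]) (H u * h u).
  exact: (primitive_itv mHh HhK).
have dI : \int[leb]_(u in `[s, t]) (H u * h u) =
    \int[leb]_(u in `[s, t]) ((H u - H s) * h u) + H s * (H t - H s).
  have ih := iv _ _ mh hK.
  have iHs : leb.-integrable `[s, t] (EFin \o (fun u => H s * h u)).
    exact: (integrableZl _ (H s) ih).
  have iHd : leb.-integrable `[s, t] (EFin \o (fun u => (H u - H s) * h u)).
    apply: (iv _ (K * (b - a) * K + `|H s| * K)).
      by apply: measurable_funM => //; exact: measurable_funB.
    move=> u au ub; rewrite mulrBl (le_trans (ler_normB _ _))// lerD ?HhK//.
    by rewrite normrM ler_wpM2l ?hK.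
  rewrite dH (addrC (H s)) addrK -(RintegralZl _ _ ih)// -(RintegralD _ iHd iHs)//.
  by apply: eq_Rintegral => u _; rewrite mulrBl subrK.
have bI : `|\int[leb]_(u in `[s, t]) ((H u - H s) * h u)| <= K * (t - s) * K * (t - s).
  apply: Rintegral_itv_bound => //.
    apply: mS => //; apply: measurable_funM => //; exact: measurable_funB.
  move=> u su ut; have ub := le_trans ut tb; have au := le_trans as_ su.
  rewrite normrM ler_pM ?hK// (le_trans (lipH _ _ as_ su ub))//.
  by rewrite ler_wpM2l// lerD2r.
have bH : `|H t - H s| <= K * (t - s) := lipH _ _ as_ st tb.
have -> : phi t - phi s = (H t - H s) ^+ 2
    - 2 * \int[leb]_(u in `[s, t]) ((H u - H s) * h u).
  by rewrite /phi dJ dI; ring.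
rewrite (le_trans (ler_normB _ _))// normrX normrM (ger0_norm (ler0n R 2)).
have sH : `|H t - H s| ^+ 2 <= (K * (t - s)) ^+ 2.
  by rewrite lerXn2r ?nnegrE// mulr_ge0// subr_ge0.
rewrite (_ : 3 * K ^+ 2 * (t - s) ^+ 2 =
  (K * (t - s)) ^+ 2 + 2 * (K * (t - s) * K * (t - s))); last by ring.
by rewrite lerD// ler_wpM2l.
Qed.

End primitives.

(** * The variance of the martingale part of a process with drift *)

Section drift_isometry.
Context {R : realType} {d : measure_display} {Om : measurableType d}.
Variable P : probability Om R.
Local Notation leb := (@lebesgue_measure R).
Variables (y beta gamma : R -> Om -> R) (a b K : R).
Hypotheses (a0 : 0 <= a) (ab : a <= b).
Let bounded_process (g : R -> Om -> R) :=
  measurable_fun (strip a b) (fun z : Om * R => g z.2 z.1) /\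
  forall t w, a <= t -> t <= b -> `|g t w| <= K.
Hypotheses (y_bounded : bounded_process y) (beta_bounded : bounded_process beta)
  (gamma_bounded : bounded_process gamma).

Let B t w := \int[leb]_(u in `[a, t]) beta u w.
Let N t w := y t w - y a w - B t w.

Hypotheses
  (N_orth_beta : forall u, a <= u -> u <= b ->
     \int[P]_w (beta u w * (N b w - N u w)) = 0)
  (N_orth_y : \int[P]_w (y a w * N b w) = 0)
  (gamma_drift : \int[P]_w (y b w ^+ 2 - y a w ^+ 2
     - \int[leb]_(u in `[a, b]) gamma u w) = 0).

Let measurable_at (g : R -> Om -> R) t : bounded_process g -> a <= t -> t <= b ->
  measurable_fun setT (g t).
Proof.
move=> [mg _] at_ tb.
apply: (@measurable_comp _ _ _ _ _ _ (strip a b) (fun z : Om * R => g z.2 z.1) _ (fun w => (w, t))) => //.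
- exact: measurable_strip.
- by move=> _ [w _ <-]; split => //=; rewrite in_itv/= at_.
Qed.

(** Here beta is the drift of y, gamma is the drift of its square, and N is the
    martingale part of y. The cross terms cancel exactly: by orthogonality,
    E[N_b B_b] is the expectation of the integral of N beta, in which the
    integral of B beta is half of B_b squared. The result is what the
    product rule for N^2 would give. *)
Lemma drift_isometry : \int[P]_w (N b w ^+ 2) =
  \int[P]_w \int[leb]_(u in `[a, b]) (gamma u w - 2 * y u w * beta u w).
Proof.
have [my yK] := y_bounded; have [mb bK] := beta_bounded.
have [mg gK] := gamma_bounded.
have K0 (w : Om) : 0 <= K by apply: le_trans (yK a w _ ab).
have L2_at (g : R -> Om -> R) t : bounded_process g -> a <= t -> t <= b ->
    L2_fun P (g t).
  move=> hg at_ tb; apply: (@L2_fun_bounded _ _ _ _ _ K).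
    exact: measurable_at.
  by move=> w; case: hg => _; exact.
have L2_int (g : R -> Om -> R) t M : a <= t -> t <= b ->
    measurable_fun (strip a b) (fun z : Om * R => g z.2 z.1) ->
    (forall t w, a <= t -> t <= b -> `|g t w| <= M) ->
    L2_fun P (fun w => \int[leb]_(u in `[a, t]) g u w).
  move=> at_ tb mg' gM.
  have mgt : measurable_fun (strip a t) (fun z : Om * R => g z.2 z.1).
    exact: measurable_stripS mg'.
  have gMt u w : a <= u -> u <= t -> `|g u w| <= M.
    by move=> au ut; apply: gM => //; exact: le_trans tb.
  apply: (@L2_fun_bounded _ _ _ _ _ (M * (t - a))).
    exact: (measurable_time_Rintegral P mgt gMt).
  move=> w; apply: Rintegral_itv_bound => //.
    exact: measurable_strip_section.
  by move=> u au ut; exact: gMt.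
have BK t w : a <= t -> t <= b -> `|B t w| <= K * (b - a).
  move=> at_ tb; apply: le_trans (_ : K * (t - a) <= _); last first.
    by rewrite ler_wpM2l ?K0// lerD2r.
  apply: Rintegral_itv_bound => //.
    by apply: measurable_strip_section; exact: measurable_stripS mb.
  by move=> u au ut; apply: bK => //; exact: le_trans tb.
have NK t w : a <= t -> t <= b -> `|N t w| <= K + K + K * (b - a).
  move=> at_ tb; rewrite /N (le_trans (ler_normB _ _))// lerD ?BK//.
  by rewrite (le_trans (ler_normB _ _))// lerD ?yK.
have mB : measurable_fun (strip a b) (fun z : Om * R => B z.2 z.1).
  exact: measurable_primitive bK.
have mN : measurable_fun (strip a b) (fun z : Om * R => N z.2 z.1).
  apply: measurable_funB => //; apply: measurable_funB => //.
  apply: measurable_funTS; apply: (measurableT_comp _ measurable_fst).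
  exact: measurable_at.
have aa := lexx a; have bb := lexx b.
have L2B : L2_fun P (B b) by exact: L2_int bK.
have L2N t : a <= t -> t <= b -> L2_fun P (N t).
  move=> at_ tb; apply: L2_funB; last exact: L2_int bK.
  by apply: L2_funB; exact: L2_at.
have mya := measurable_at y_bounded aa ab.
have myb := measurable_at y_bounded ab bb.
have NB : \int[P]_w (N b w * B b w) =
    \int[P]_w \int[leb]_(u in `[a, b]) (N u w * beta u w).
  have mNb : measurable_fun (strip a b) (fun z : Om * R => N b z.1 * beta z.2 z.1).
    apply: measurable_funM => //; apply: measurable_funTS.
    by apply: (measurableT_comp _ measurable_fst); case: (L2N b ab bb).
  have mNu : measurable_fun (strip a b) (fun z : Om * R => N z.2 z.1 * beta z.2 z.1).
    exact: measurable_funM.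
  have Kb (f : Om -> R) u w : `|f w| <= K + K + K * (b - a) -> a <= u -> u <= b ->
      `|f w * beta u w| <= (K + K + K * (b - a)) * K.
    by move=> fK au ub; rewrite normrM ler_pM ?bK.
  rewrite (@time_Rintegral_fubini _ _ _ P _ _ _ _ mNu
      (fun u w au ub => Kb (N u) u w (NK u w au ub) au ub)).
  transitivity (\int[leb]_(u in `[a, b]) \int[P]_w (N b w * beta u w)); last first.
    apply: eq_Rintegral => u /set_mem; rewrite /= in_itv/= => /andP[au ub].
    apply/eqP; rewrite -subr_eq0 -RintegralB//.
    + rewrite -[X in _ == X](N_orth_beta au ub); apply/eqP.
      by apply: eq_Rintegral => w _; rewrite -mulrBl mulrC.
    + by apply: L2_fun_mul; [exact: L2N|exact: L2_at].
    + by apply: L2_fun_mul; [exact: L2N|exact: L2_at].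
  rewrite -(@time_Rintegral_fubini _ _ _ P _ _ _ _ mNb
      (fun u w au ub => Kb (N b) u w (NK b w ab bb) au ub)).
  apply: eq_Rintegral => w _; rewrite RintegralZl//.
  apply: (@integrable_itv_bounded _ _ _ _ K); first exact: measurable_strip_section.
  by move=> u au ub; exact: bK.
pose I (g : R -> Om -> R) w := \int[leb]_(u in `[a, b]) g u w.
pose J w := I gamma w - 2 * (y a w * B b w) - B b w ^+ 2.
pose G0 w := y b w ^+ 2 - y a w ^+ 2 - I gamma w.
pose NBi w := \int[leb]_(u in `[a, b]) (N u w * beta u w).
have i2 f : L2_fun P f -> P.-integrable setT (EFin \o f) := @L2_fun_integrable _ _ _ P f.
have L2M (f g : Om -> R) (M : R) : L2_fun P f -> measurable_fun setT g ->
  (forall w, `|g w| <= M) -> L2_fun P (fun w => g w * f w) := @L2_funM_bounded _ _ _ P f g M.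
have L2I : L2_fun P (I gamma) by exact: L2_int gK.
have L2yB : L2_fun P (fun w => y a w * B b w).
  by apply: (L2M _ _ K) => // w; exact: yK.
have L2B2 : L2_fun P (fun w => B b w ^+ 2).
  apply: (L2M _ _ (K * (b - a))) => //; first by case: L2B.
  by move=> w; exact: BK.
have L2J : L2_fun P J.
  apply: L2_funB => //; apply: L2_funB => //.
  by apply: (@L2_funM_bounded _ _ _ P _ (cst 2) 2) => // w; rewrite /= ger0_norm.
have L2G0 : L2_fun P G0.
  apply: L2_funB => //; apply: L2_funB.
    by apply: (L2M _ _ K) => // [|w]; [exact: L2_at|exact: yK].
  by apply: (L2M _ _ K) => // [|w]; [exact: L2_at|exact: yK].
have L2NBi : L2_fun P NBi.
  apply: (@L2_int (fun u w => N u w * beta u w) b ((K + K + K * (b - a)) * K)) => //.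
    exact: measurable_funM.
  by move=> u w au ub; rewrite normrM ler_pM ?bK ?NK.
have i2c c (f : Om -> R) : P.-integrable setT (EFin \o f) ->
    P.-integrable setT (EFin \o (fun w => c * f w)).
  by move=> fi; exact: (integrableZl measurableT c fi).
have iyN := L2_fun_mul (L2_at _ _ y_bounded aa ab) (L2N b ab bb).
have iNB := L2_fun_mul (L2N b ab bb) L2B.
have iE (f g : Om -> R) : P.-integrable setT (EFin \o f) ->
    P.-integrable setT (EFin \o g) -> P.-integrable setT (EFin \o (fun w => f w + g w)).
  by move=> fi gi; exact: (integrableD measurableT fi gi).
have decomp w : N b w ^+ 2 = (G0 w + J w) + ((-2) * (y a w * N b w) + (-2) * (N b w * B b w)).
  by rewrite /G0 /J /N; ring.
under eq_Rintegral do rewrite decomp.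
rewrite RintegralD//; [|by apply: iE; exact: i2|by apply: iE; exact: i2c].
rewrite RintegralD//; [|exact: i2|exact: i2].
rewrite (RintegralD measurableT (i2c (-2) _ iyN) (i2c (-2) _ iNB)).
rewrite (RintegralZl _ measurableT iyN) (RintegralZl _ measurableT iNB).
rewrite gamma_drift N_orth_y NB mulr0 !add0r.
rewrite -(RintegralZl _ measurableT (i2 _ L2NBi)) -RintegralD//; [|exact: i2|exact/i2c/i2].
apply: eq_Rintegral => w _.
have iI (f : R -> R) (M : R) : measurable_fun `[a, b] f -> (forall t, a <= t -> t <= b -> `|f t| <= M) ->
  leb.-integrable `[a, b] (EFin \o f) := @integrable_itv_bounded _ f a b M.
have mS (g : R -> Om -> R) := @measurable_strip_section _ _ _ g a b w.
have iyb : leb.-integrable `[a, b] (EFin \o (fun u => y u w * beta u w)).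
  apply: (iI _ (K * K)); first by apply: measurable_funM; exact: mS.
  by move=> t at_ tb; rewrite normrM ler_pM ?yK ?bK.
have iyab : leb.-integrable `[a, b] (EFin \o (fun u => y a w * beta u w)).
  apply: (iI _ (K * K)); first by apply: measurable_funM => //; exact: mS.
  by move=> t at_ tb; rewrite normrM ler_pM ?yK ?bK.
have iBb : leb.-integrable `[a, b] (EFin \o (fun u => B u w * beta u w)).
  apply: (iI _ (K * (b - a) * K)).
    by apply: measurable_funM; [exact: (mS B)|exact: mS].
  by move=> t at_ tb; rewrite normrM ler_pM ?BK ?bK.
have ib : leb.-integrable `[a, b] (EFin \o (beta ^~ w)).
  by apply: (iI _ K); [exact: mS|move=> t at_ tb; exact: bK].
have ig : leb.-integrable `[a, b] (EFin \o (gamma ^~ w)).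
  by apply: (iI _ K); [exact: mS|move=> t at_ tb; exact: gK].
have -> : NBi w = \int[leb]_(u in `[a, b]) (y u w * beta u w) - y a w * B b w - B b w ^+ 2 / 2.
  rewrite -(@primitive_sqr _ (beta ^~ w) a b K)//; last 3 first.
  - exact: mS.
  - exact: (mS B).
  - by move=> t at_ tb; exact: bK.
  have -> : y a w * B b w = \int[leb]_(u in `[a, b]) (y a w * beta u w).
    by rewrite RintegralZl.
  rewrite -(RintegralB _ iyb iyab)// -RintegralB//; last first.
    exact: (integrableB _ iyb iyab).
  by apply: eq_Rintegral => u _; rewrite /N /B /=; ring.
have -> : \int[leb]_(u in `[a, b]) (gamma u w - 2 * y u w * beta u w) =
    I gamma w - 2 * \int[leb]_(u in `[a, b]) (y u w * beta u w).
  rewrite -RintegralZl// -RintegralB//; last exact: (integrableZl _ 2 iyb).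
  by apply: eq_Rintegral => u _; rewrite mulrA.
by rewrite /J; field.
Qed.

End drift_isometry.

(** * Paths of the chain and their jumps *)

Section borel_vectors.
Context {R : realType} {N : nat}.

Lemma measurable_coord (i : 'I_N) :
  measurable_fun setT (fun v : borel_vec R N => (v : 'cV[R]_N) i 0).
Proof.
apply: (measurability _ (RGenOpens.measurableE R)).
move=> _ [_ [a [b ->] <-]]; rewrite setTI; apply: sub_sigma_algebra.
have /continuousP := @coord_continuous R N 1 i 0; apply; exact: interval_open.
Qed.

Lemma measurable_fun_coord d (T : measurableType d) (D : set T)
    (f : T -> borel_vec R N) (i : 'I_N) :
  measurable_fun D f -> measurable_fun D (fun x => (f x : 'cV[R]_N) i 0).
Proof. by move=> mf; exact: (measurableT_comp (measurable_coord i) mf). Qed.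

(** Distinct unit vectors differ by 1 in some coordinate, so all values within
    1/2 of the limit coincide. *)
Lemma unit_vector_cvg (F : set_system R) (f : R -> 'cV[R]_N) (l : 'cV[R]_N) :
  ProperFilter F -> (\forall s \near F, exists i, f s = delta_mx i 0) ->
  f s @[s --> F] --> l ->
  exists2 k, l = delta_mx k 0 & \forall s \near F, f s = delta_mx k 0.
Proof.
move=> FF fU fl.
have near_l e : 0 < e -> \forall s \near F, forall i, `|l i 0 - f s i 0| < e.
  move=> e0; have /cvg_ballP /(_ _ e0) := fl; apply: filterS => s.
  by move=> [_ h] i; exact: h i 0.
have half0 : 0 < 2^-1 :> R by [].
have [s0 [[k s0k] s0l]] := filter_ex (filterI fU (near_l _ half0)).
have fk : \forall s \near F, f s = delta_mx k 0.
  apply: filterS2 fU (near_l _ half0) => s [i ->] sl.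
  have [->//|ik] := eqVneq i k; exfalso.
  have := sl k; have := s0l k; rewrite s0k !mxE !eqxx/= eq_sym (negbTE ik)/=.
  by rewrite subr0 !ltr_norml => /andP[? ?] /andP[? ?]; lra.
exists k => //; apply/matrixP => i j; rewrite (ord1 j).
apply/eqP; rewrite -subr_eq0 -normr_eq0; apply/eqP/le_anti; rewrite normr_ge0 andbT.
apply/ler_addgt0Pl => e e0; rewrite addr0.
have [s [-> sl]] := filter_ex (filterI fk (near_l _ e0)).
exact/ltW/sl.
Qed.

End borel_vectors.

Section chain.
Context {R : realType} {d : measure_display} {Omega : measurableType d}.
Variables (P : probability Omega R) (N : nat).
Variables (X : R -> Omega -> 'cV[R]_N) (A : R -> 'M[R]_N).
Hypothesis chain : markov_chain P X A.
Local Notation leb := (@lebesgue_measure R).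
Local Notation Ft := (completed_natural_filtration P X).
Local Notation M i := (fun t w => chain_martingale X A t w i 0).
Local Notation X_ t w := (left_lim (fun s => X s w) t).

Lemma filtration_sigma t : <<s Ft t>> = Ft t.
Proof. by apply: sigma_algebra_id; exact: smallest_sigma_algebra. Qed.

Lemma filtration_measurable t : <<s Ft t>> `<=` measurable.
Proof.
rewrite filtration_sigma; apply: smallest_sub; first exact: sigma_algebra_measurable.
move=> G [[u [B [u0 ut mB ->]]]|[]//].
rewrite -[X in measurable X]setTI; exact: (chain_measurable chain u0).
Qed.

Lemma filtration_mono s t : s <= t -> Ft s `<=` Ft t.
Proof.
move=> st; apply: sub_smallest2r => // G [[u [B [u0 us mB ->]]]|?]; last by right.
by left; exists u, B; split => //; exact: le_trans st.
Qed.

Lemma measurable_wrt_mono s t d' (V : measurableType d') (h : Omega -> V) :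
  s <= t -> measurable_wrt (Ft s) setT h -> measurable_wrt (Ft t) setT h.
Proof.
move=> st mh mT B mB; have := mh measurableT B mB.
by rewrite /measurable/= !filtration_sigma; exact: filtration_mono.
Qed.

Lemma chain_adapted i s t : 0 <= s -> s <= t ->
  measurable_wrt (Ft t) setT (fun w => X s w i 0).
Proof.
move=> s0 st; apply: (@measurable_fun_coord _ _ _ (g_sigma_algebraType (Ft t)) setT (X s)).
move=> _ B mB; rewrite setTI; apply: sub_sigma_algebra.
by rewrite /completed_natural_filtration; apply: sub_sigma_algebra; left; exists s, B.
Qed.

Lemma chain_coord_bound i t w : 0 <= t -> `|X t w i 0| <= 1.
Proof.
move=> t0; have [k ->] := chain_unit_vectors chain w t0.
by rewrite !mxE; case: (_ && _); rewrite ?normr1 ?normr0.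
Qed.

Lemma chain_strip i b : 0 <= b -> measurable_fun (strip 0 b) (fun z : Omega * R => X z.2 z.1 i 0).
Proof.
move=> b0; apply: (@measurable_right_process _ _ _ (fun t w => X t w i 0)) => //.
  move=> t t0 tb; apply: measurable_wrt_fun (@chain_adapted i t t t0 (lexx t)).
  exact: filtration_measurable.
move=> w t t0 tb; have [+ _] := chain_rcll chain w => /(_ t t0 (ltry _)) Xt.
exact: (cvg_comp _ _ Xt (@coord_continuous R N 1 i 0 _)).
Qed.

Lemma left_lim_cvg w t : 0 < t -> X s w @[s --> t^'-] --> X_ t w.
Proof.
move=> t0; rewrite /left_lim leNgt t0/=.
by have [_ +] := chain_rcll chain w => /(_ t t0 (leey _)).
Qed.

Lemma left_lim_local w t : 0 < t -> exists2 k, X_ t w = delta_mx k 0 &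
  \forall s \near t^'-, X s w = delta_mx k 0.
Proof.
move=> t0; apply: unit_vector_cvg; last exact: left_lim_cvg.
near=> s; apply: (chain_unit_vectors chain); near: s.
by apply: nbhs_left_ge.
Unshelve. all: by end_near. Qed.

Lemma left_lim_unit w t : 0 <= t -> exists k, X_ t w = delta_mx k 0.
Proof.
rewrite le_eqVlt => /predU1P[<-|/left_lim_local-/(_ w)[k ? _]]; last by exists k.
by rewrite /left_lim lexx; exact: (chain_unit_vectors chain w (lexx 0)).
Qed.

Lemma left_lim_strip i b : 0 <= b ->
  measurable_fun (strip 0 b) (fun z : Omega * R => X_ z.2 z.1 i 0).
Proof.
move=> b0; apply: (@measurable_left_process _ _ _ (fun t w => X t w i 0) (fun t w => X_ t w i 0)) => //.
- exact: chain_strip.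
- by move=> w; rewrite /left_lim lexx.
move=> w t t0 tb.
exact: (cvg_comp _ _ (left_lim_cvg (w := w) t0) (@coord_continuous R N 1 i 0 _)).
Qed.

(** Just before a jump time t the path is constant, so t is the only jump time
    in some interval ]q, t] with q rational; the map from t to q is injective. *)
Lemma countable_jumps w : countable [set t | 0 < t /\ X_ t w <> X t w].
Proof.
set J := [set t | _].
have sep t : exists q : rat, J t -> ratr q < t /\ forall v, ratr q < v -> v < t -> ~ J v.
  have [Jt|] := pselect (J t); last by exists 0.
  have [t0 _] := Jt; have [k _ [e /= e0 Xk]] := left_lim_local w t0.
  have : Num.max 0 (t - e) < t by rewrite gt_max t0/= gtrBl.
  move=> /rat_in_itvoo[q]; rewrite in_itv/= gt_max => /andP[/andP[q0 qe] qt].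
  exists q => _; split => // v qv vt [v0].
  have Xs s : ratr q < s -> s < t -> X s w = delta_mx k 0.
    move=> qs st; apply: Xk => //=; rewrite /ball/= ger0_norm ?subr_ge0 ?ltW//.
    by rewrite ltrBlDr -ltrBlDl (lt_trans qe).
  rewrite (Xs v qv vt); have [j -> [e' /= e'0 Xj]] := left_lim_local w v0; apply.
  pose s := (v + Num.max (ratr q) (v - e')) / 2.
  have mv : Num.max (ratr q) (v - e') < v by rewrite gt_max qv/= gtrBl.
  have sv : s < v by rewrite /s; lra.
  have ms : Num.max (ratr q) (v - e') < s by rewrite /s; lra.
  move: ms; rewrite gt_max => /andP[qs es].
  rewrite -(Xj s)//=; first by apply: Xs => //; exact: lt_trans vt.
  by rewrite /ball/= ger0_norm ?subr_ge0 ?ltW//; lra.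
have [r rJ] := choice sep.
apply/countable_injP; exists (@choice.pickle rat \o r) => t u /set_mem Jt /set_mem Ju /= /(pcan_inj choice.pickleK) rtu.
have [tu|ut|//] := ltgtP t u.
  have [_ /(_ t)] := rJ u Ju; rewrite -rtu; have [rt _] := rJ t Jt.
  by move=> /(_ rt tu)/(_ Jt).
have [_ /(_ u)] := rJ t Jt; rewrite rtu; have [ru _] := rJ u Ju.
by move=> /(_ ru ut)/(_ Ju).
Qed.

Lemma ae_no_jump w : {ae leb, forall t, 0 < t -> X_ t w = X t w}.
Proof.
have cJ := countable_jumps w.
exists [set t | 0 < t /\ X_ t w <> X t w]; split.
- exact: countable_measurable.
- exact: countable_lebesgue_measure0.
- by move=> t /= /not_implyP[t0 ne]; split.
Qed.

End chain.

(** * The isometry over one time step *)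

Section chain_isometry.
Context {R : realType} {d : measure_display} {Omega : measurableType d}.
Variables (P : probability Omega R) (N : nat).
Variables (X : R -> Omega -> 'cV[R]_N) (A : R -> 'M[R]_N).
Hypothesis chain : markov_chain P X A.
Local Notation leb := (@lebesgue_measure R).
Local Notation Ft := (completed_natural_filtration P X).
Local Notation M i := (fun t w => chain_martingale X A t w i 0).
Local Notation X_ t w := (left_lim (fun s => X s w) t).

(** The right-hand side is the Dirichlet form of the chain at the state just
    before time t: jumps out of that state, weighted by their rates. It is
    nonnegative because off-diagonal rates are, so squaring undoes the square
    root in the semi-norm. *)
Lemma seminorm_sqrE t w (C : 'cV[R]_N) : 0 <= t ->
  seminorm X A t w C ^+ 2 =
  \sum_k X_ t w k 0 * \sum_i A t i k * (C i 0 - C k 0) ^+ 2.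
Proof.
move=> t0; have [_ A0 Asum _] := chain_rates chain.
have [k Xk] := left_lim_unit chain w t0.
have -> : \sum_j X_ t w j 0 * \sum_i A t i j * (C i 0 - C j 0) ^+ 2 =
    \sum_i A t i k * (C i 0 - C k 0) ^+ 2.
  rewrite (bigD1 k)//= Xk mxE !eqxx mul1r [X in _ + X]big1 ?addr0// => j jk.
  by rewrite mxE (negbTE jk) mul0r.
have form : (C^T *m Psi X A t w *m C) 0 0 = \sum_i A t i k * (C i 0 - C k 0) ^+ 2.
  have PsiE i j : Psi X A t w i j =
      A t i k * (i == j)%:R - (i == k)%:R * A t j k - A t i k * (j == k)%:R.
    rewrite /Psi Xk -colE mul_mx_diag mul_diag_mx !mxE.
    congr (_ - _ - _); first by rewrite mulr_natr.
      by case: eqP => [->|]; rewrite ?mul0r.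
    by case: eqP => [->|]; rewrite ?mulr0.
  have row j : (C^T *m Psi X A t w) 0 j = A t j k * C j 0 - C k 0 * A t j k
      - (j == k)%:R * \sum_i C i 0 * A t i k.
    rewrite mxE; under eq_bigr => i _ do rewrite PsiE mxE !mulrBr.
    rewrite !sumrB; congr (_ - _ - _).
    - rewrite (bigD1 j)//= eqxx mulr1 big1 ?addr0 1?mulrC// => i ij.
      by rewrite (negbTE ij) !mulr0.
    - rewrite (bigD1 k)//= eqxx mul1r big1 ?addr0// => i ik.
      by rewrite (negbTE ik) mul0r mulr0.
    - by rewrite mulr_sumr; apply: eq_bigr => i _; ring.
  rewrite mxE; under eq_bigr => j _ do rewrite row mulrBl.
  rewrite sumrB [X in _ - X](bigD1 k)//= eqxx mul1r [X in _ - (_ + X)]big1 ?addr0; last first.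
    by move=> j jk; rewrite (negbTE jk) !mul0r.
  transitivity (\sum_i A t i k * (C i 0 - C k 0) ^+ 2 - C k 0 ^+ 2 * \sum_i A t i k).
    rewrite mulr_suml mulr_sumr -!sumrB; apply: eq_bigr => i _; ring.
  by rewrite Asum// mulr0 subr0.
rewrite /seminorm form sqr_sqrtr//; apply: sumr_ge0 => i _.
have [->|ik] := eqVneq i k; first by rewrite subrr expr0n mulr0.
by rewrite mulr_ge0 ?sqr_ge0// A0.
Qed.

Lemma seminorm_sqr_le t w (C D : 'cV[R]_N) : 0 <= t ->
  seminorm X A t w C ^+ 2 <=
  2 * seminorm X A t w D ^+ 2 + 2 * seminorm X A t w (C - D) ^+ 2.
Proof.
move=> t0; rewrite !seminorm_sqrE//; have [k Xk] := left_lim_unit chain w t0.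
have [_ A0 _ _] := chain_rates chain.
rewrite !mulr_sumr -big_split/=; apply: ler_sum => j _.
rewrite !(mulrCA 2) -mulrDr; apply: ler_wpM2l.
  by rewrite Xk mxE; case: (_ && _).
rewrite !mulr_sumr -big_split/=; apply: ler_sum => i _.
have [->|ij] := eqVneq i j; first by rewrite !subrr expr0n !(mulr0, addr0).
rewrite !(mulrCA 2) -mulrDr; apply: ler_wpM2l; first exact: A0.
rewrite !mxE; set a := C i 0; set b := C j 0; set e := D i 0; set f := D j 0.
have := sqr_ge0 ((a - b) - 2 * (e - f)); lra.
Qed.

Definition drift i t w := (A t *m X t w) i 0.

Lemma driftE i t w : drift i t w = \sum_k A t i k * X t w k 0.
Proof. by rewrite /drift mxE. Qed.

Lemma drift_bounded : exists2 K, 0 <= K &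
  forall i t w, 0 <= t -> `|drift i t w| <= K.
Proof.
have [_ _ _ [K AK]] := chain_rates chain; exists `|K| => // i t w t0.
have [k Xk] := chain_unit_vectors chain w t0.
by rewrite /drift Xk -colE mxE (le_trans (AK _ _ _ t0))// ler_norm.
Qed.

Lemma measurable_rates i k a b : 0 <= a ->
  measurable_fun (strip a b) (fun z : Omega * R => A z.2 i k).
Proof.
move=> a0; have [mA _ _ _] := chain_rates chain.
apply: (@measurable_comp _ _ _ _ _ _ (`[0, +oo[ : set R) (fun t => A t i k) (strip a b) (fun z : Omega * R => z.2)) => //.
  move=> _ [[w t] [_ /=] + <-]; rewrite !in_itv/= andbT => /andP[+ _].
  exact: le_trans.
by apply: measurable_funTS; exact: measurable_snd.
Qed.

Lemma drift_strip i a b : 0 <= a ->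
  measurable_fun (strip a b) (fun z : Omega * R => drift i z.2 z.1).
Proof.
move=> a0; under eq_fun do rewrite driftE.
apply: measurable_sum => k; apply: measurable_funM; first exact: measurable_rates.
have [b0|b0] := leP 0 b.
  by apply: (measurable_stripS a0 (lexx b)); exact: (chain_strip chain).
rewrite (_ : strip a b = set0); first exact: measurable_fun_set0.
by rewrite /strip set_itv_ge ?setX0// bnd_simp -ltNge (lt_le_trans b0).
Qed.

Lemma drift_adapted i s t : 0 <= s -> s <= t -> measurable_wrt (Ft t) setT (drift i s).
Proof.
move=> s0 st; rewrite (_ : drift i s = fun w => \sum_k A s i k * X s w k 0); last first.
  by apply/funext => w; exact: driftE.
apply: (@measurable_sum _ (g_sigma_algebraType (Ft t)) R setT) => k.
by apply: measurable_funM => //; exact: chain_adapted.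
Qed.

Lemma L2_martingale i t : 0 <= t -> L2_fun P (M i t).
Proof.
move=> t0; have [[mM _ _] sM] := chain_semimartingale chain i; split.
  exact: (measurable_wrt_fun (filtration_measurable chain (t := t)) (mM t t0)).
have := sM t t0; congr (_ < _)%E.
by apply: eq_integral => w _; rewrite real_normK// num_real.
Qed.

Lemma martingale_adapted i s t : 0 <= s -> s <= t -> measurable_wrt (Ft t) setT (M i s).
Proof.
move=> s0 st; have [[mM _ _] _] := chain_semimartingale chain i.
exact: measurable_wrt_mono st (mM s s0).
Qed.

Lemma martingale_incr i s t w : 0 <= s -> s <= t ->
  M i t w - M i s w = X t w i 0 - X s w i 0 - \int[leb]_(u in `[s, t]) drift i u w.
Proof.
move=> s0 st; have [K _ dK] := drift_bounded.
have md : measurable_fun `[0, t] (fun u => drift i u w).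
  by apply: measurable_strip_section; exact: drift_strip.
have := Rintegral_itv_split s0 st md (fun u u0 _ => dK i u w u0).
by rewrite /chain_martingale/= !mxE /drift => ->; ring.
Qed.

(** Each weight c i is known at time s, so it can be moved to the factor V; the
    increment of M i that remains integrates to zero over the events of F_s. *)
Lemma martingale_orth (V : Omega -> R) (c : 'I_N -> Omega -> R) (K s t : R) :
  0 <= s -> s <= t -> measurable_wrt (Ft s) setT V -> L2_fun P V ->
  (forall i, measurable_wrt (Ft s) setT (c i)) -> (forall i w, `|c i w| <= K) ->
  \int[P]_w (V w * \sum_i c i w * (M i t w - M i s w)) = 0.
Proof.
move=> s0 st mV L2V mc cK; have t0 := le_trans s0 st.
have L2c i : L2_fun P (fun w => c i w * (M i t w - M i s w)).
  apply: (@L2_funM_bounded _ _ _ _ _ _ K) => //; last first.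
    exact: (measurable_wrt_fun (filtration_measurable chain (t := s)) (mc i)).
  by apply: L2_funB; exact: L2_martingale.
have iV i := L2_fun_mul L2V (L2c i).
under eq_Rintegral do rewrite mulr_sumr.
rewrite Rintegral_sum// big1// => i _.
rewrite (_ : (fun w => V w * _) = fun w => (V w * c i w) * (M i t w - M i s w)); last first.
  by apply/funext => w; rewrite mulrA.
have L2D : L2_fun P (fun w => M i t w - M i s w) by apply: L2_funB; exact: L2_martingale.
apply: (@conditional_orthogonality _ _ _ _ (Ft s)).
- exact: (filtration_measurable chain).
- exact: L2_fun_integrable L2D.
- move=> G; rewrite filtration_sigma => FG.
  have mG : measurable G by apply: (filtration_measurable chain (t := s)); rewrite filtration_sigma.
  have [[_ iM eM] _] := chain_semimartingale chain i.
  have iG u : 0 <= u -> P.-integrable G (EFin \o M i u).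
    by move=> u0; apply: integrableS (iM u u0).
  rewrite (integralB_EFin mG (iG t t0) (iG s s0)) (eM s t G s0 st FG) subee//.
  exact: (integrable_fin_num mG (iG s s0)).
- by apply: measurable_funM => //; exact: mc.
- have := iV i; congr (_.-integrable _ _); apply/funext => w /=.
  by rewrite mulrA.
Qed.

Lemma weighted_incr (e : 'I_N -> R) s t w : 0 <= s -> s <= t ->
  \sum_i e i * (M i t w - M i s w) =
  \sum_i e i * X t w i 0 - \sum_i e i * X s w i 0
  - \int[leb]_(u in `[s, t]) \sum_i e i * drift i u w.
Proof.
move=> s0 st; have [K _ dK] := drift_bounded.
have id i : leb.-integrable `[s, t] (EFin \o (fun u => drift i u w)).
  apply: (@integrable_itv_bounded _ _ _ _ K).
    by apply: measurable_strip_section; exact: drift_strip.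
  by move=> u su _; apply: dK; exact: le_trans su.
have ie i : leb.-integrable `[s, t] (EFin \o (fun u => e i * drift i u w)).
  exact: (integrableZl _ (e i) (id i)).
rewrite Rintegral_sum// -!sumrB; apply: eq_bigr => i _.
by rewrite RintegralZl// martingale_incr//; ring.
Qed.

Lemma seminorm_strip (z : R -> Omega -> 'cV[R]_N) a b : 0 <= a -> a <= b ->
  (forall i, measurable_fun (strip a b) (fun p : Omega * R => z p.2 p.1 i 0)) ->
  measurable_fun (strip a b)
    (fun p : Omega * R => seminorm X A p.2 p.1 (z p.2 p.1) ^+ 2).
Proof.
move=> a0 ab mz; apply: (@eq_measurable_fun _ _ _ _ (strip a b) (fun p : Omega * R =>
    \sum_k X_ p.2 p.1 k 0 * \sum_i A p.2 i k *
      (z p.2 p.1 i 0 - z p.2 p.1 k 0) ^+ 2)).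
  move=> [w t] /set_mem [_ /=]; rewrite in_itv/= => /andP[at_ _].
  by rewrite seminorm_sqrE// (le_trans a0).
apply: measurable_sum => k; apply: measurable_funM.
  by apply: (measurable_stripS a0 (lexx b)); apply: (left_lim_strip chain); exact: le_trans ab.
apply: measurable_sum => i; apply: measurable_funM; first exact: measurable_rates.
by apply: measurable_funX; exact: measurable_funB.
Qed.

(** The process y = c' X has the martingale part on the right. As X is a unit
    vector, the square of y is the same kind of process with c i ^+ 2 in place
    of c i, so both drifts are explicit and the variance is given by the drift
    isometry. Its density agrees with the squared semi-norm wherever the path
    does not jump, that is at almost every time. *)
Lemma one_step_isometry (c : Omega -> 'cV[R]_N) (L s t : R) :
  0 <= s -> s <= t -> (forall i, measurable_wrt (Ft s) setT (fun w => c w i 0)) ->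
  (forall w i, `|c w i 0| <= L) ->
  (\int[P]_w \int[leb]_(u in `[s, t]) (seminorm X A u w (c w) ^+ 2)%:E =
   \int[P]_w ((\sum_i c w i 0 * (M i t w - M i s w)) ^+ 2)%:E)%E.
Proof.
move=> s0 st mc cL; have t0 := le_trans s0 st.
have mcT i : measurable_fun setT (fun w => c w i 0).
  exact: (measurable_wrt_fun (filtration_measurable chain (t := s)) (mc i)).
pose y u w := \sum_i c w i 0 * X u w i 0.
pose beta u w := \sum_i c w i 0 * drift i u w.
pose gamma u w := \sum_i c w i 0 ^+ 2 * drift i u w.
have [K K0 dK] := drift_bounded.
have L0 (w : Omega) : 0 <= \sum_(i < N) L by apply: sumr_ge0 => i _; exact: le_trans (cL w i).
pose C := `|\sum_(i < N) L * 1| + `|\sum_(i < N) L * K| + `|\sum_(i < N) L ^+ 2 * K|.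
have sumK (f : 'I_N -> R) (B : R) : (forall i, `|f i| <= B) -> `|\sum_i f i| <= `|\sum_(i < N) B|.
  move=> fB; apply: le_trans (ler_norm_sum _ _ _) _.
  by apply: le_trans (ler_norm _); apply: ler_sum => i _; exact: fB.
have mcs i : measurable_fun (strip s t) (fun z : Omega * R => c z.1 i 0).
  by apply: measurable_funTS; apply: (measurableT_comp (mcT i) measurable_fst).
have Xs i : measurable_fun (strip s t) (fun z : Omega * R => X z.2 z.1 i 0).
  by apply: (measurable_stripS s0 (lexx t)); exact: (chain_strip chain).
have b_y : measurable_fun (strip s t) (fun z : Omega * R => y z.2 z.1) /\
    forall u w, s <= u -> u <= t -> `|y u w| <= C.
  split; first by apply: measurable_sum => i; exact: measurable_funM.
  move=> u w su ut; apply: le_trans (_ : `|\sum_(i < N) L * 1| <= _); last first.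
    by rewrite /C -addrA lerDl addr_ge0.
  apply: sumK => i; rewrite normrM ler_pM//.
  by apply: (chain_coord_bound chain); exact: le_trans su.
have b_beta : measurable_fun (strip s t) (fun z : Omega * R => beta z.2 z.1) /\
    forall u w, s <= u -> u <= t -> `|beta u w| <= C.
  split.
    by apply: measurable_sum => i; apply: measurable_funM => //; exact: drift_strip.
  move=> u w su ut; apply: le_trans (_ : `|\sum_(i < N) L * K| <= _); last first.
    by rewrite /C addrAC lerDr addr_ge0.
  apply: sumK => i; rewrite normrM ler_pM//.
  by apply: dK; exact: le_trans su.
have b_gamma : measurable_fun (strip s t) (fun z : Omega * R => gamma z.2 z.1) /\
    forall u w, s <= u -> u <= t -> `|gamma u w| <= C.
  split.
    apply: measurable_sum => i; apply: measurable_funM; last exact: drift_strip.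
    exact: measurable_funX.
  move=> u w su ut; apply: le_trans (_ : `|\sum_(i < N) L ^+ 2 * K| <= _); last first.
    by rewrite /C lerDr addr_ge0.
  apply: sumK => i; rewrite normrM normrX ler_pM//.
    by rewrite lerXn2r ?nnegrE// (le_trans _ (cL w i)).
  by apply: dK; exact: le_trans su.
pose N_ u w := y u w - y s w - \int[leb]_(v in `[s, u]) beta v w.
have NE u w : s <= u -> N_ u w = \sum_i c w i 0 * (M i u w - M i s w).
  by move=> su; rewrite (weighted_incr (fun i => c w i 0)).
have NdE u v w : s <= u -> u <= v -> N_ v w - N_ u w = \sum_i c w i 0 * (M i v w - M i u w).
  move=> su uv; rewrite !NE//; last exact: le_trans uv.
  have alg (e p q r : R) : e * (p - q) - e * (r - q) = e * (p - r) by ring.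
  by rewrite -sumrB; apply: eq_bigr => i _; exact: alg.
have adaptedM u i : s <= u -> measurable_wrt (Ft u) setT (fun w => c w i 0).
  by move=> su; exact: measurable_wrt_mono (mc i).
have orth_beta u : s <= u -> u <= t -> \int[P]_w (beta u w * (N_ t w - N_ u w)) = 0.
  move=> su ut; have u0 := le_trans s0 su.
  under eq_Rintegral do rewrite NdE//.
  apply: (@martingale_orth _ (fun i w => c w i 0) L) => //; last by move=> i; exact: adaptedM.
    apply: (@measurable_sum _ (g_sigma_algebraType (Ft u)) R setT) => i.
    by apply: measurable_funM; [exact: adaptedM|exact: drift_adapted].
  apply: (@L2_fun_bounded _ _ _ _ _ C); last by move=> w; exact: (b_beta.2).
  apply: measurable_sum => i; apply: measurable_funM => //.
  exact: (measurable_wrt_fun (filtration_measurable chain (t := u)) (drift_adapted i u0 (lexx u))).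
have orth_y : \int[P]_w (y s w * N_ t w) = 0.
  under eq_Rintegral do rewrite NE//.
  apply: (@martingale_orth _ (fun i w => c w i 0) L) => //.
    apply: (@measurable_sum _ (g_sigma_algebraType (Ft s)) R setT) => i.
    by apply: measurable_funM; [exact: mc|exact: chain_adapted].
  apply: (@L2_fun_bounded _ _ _ _ _ C); last by move=> w; exact: (b_y.2).
  apply: measurable_sum => i; apply: measurable_funM => //.
  exact: (measurable_wrt_fun (filtration_measurable chain (t := s)) (@chain_adapted _ _ _ P N X i s s s0 (lexx s))).
have ysqr u w : 0 <= u -> y u w ^+ 2 = \sum_i c w i 0 ^+ 2 * X u w i 0.
  move=> u0; have [k Xk] := chain_unit_vectors chain w u0.
  have E (e : 'I_N -> R) : \sum_i e i * X u w i 0 = e k.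
    rewrite (bigD1 k)//= Xk mxE !eqxx mulr1 big1 ?addr0// => i ik.
    by rewrite mxE (negbTE ik) mulr0.
  by rewrite /y !E.
have gamma_drift : \int[P]_w (y t w ^+ 2 - y s w ^+ 2
     - \int[leb]_(u in `[s, t]) gamma u w) = 0.
  rewrite (_ : (fun w => _) =
      fun w => cst 1 w * \sum_i c w i 0 ^+ 2 * (M i t w - M i s w)); last first.
    by apply/funext => w; rewrite !ysqr// (weighted_incr (fun i => c w i 0 ^+ 2))// mul1r.
  apply: (@martingale_orth (cst 1) (fun i w => c w i 0 ^+ 2) (L ^+ 2)) => //.
  - exact: measurable_cst.
  - exact: L2_fun_cst.
  - by move=> i; apply: measurable_funX; exact: mc.
  - by move=> i w; rewrite normrX lerXn2r ?nnegrE// (le_trans _ (cL w i)).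
pose q u w := gamma u w - 2 * y u w * beta u w.
have isom : \int[P]_w (N_ t w ^+ 2) = \int[P]_w \int[leb]_(u in `[s, t]) q u w.
  exact: (drift_isometry s0 st b_y b_beta b_gamma orth_beta orth_y gamma_drift).
have mq : measurable_fun (strip s t) (fun z : Omega * R => q z.2 z.1).
  apply: measurable_funB; first by case: b_gamma.
  by apply: measurable_funM; [apply: measurable_funM => //; case: b_y|case: b_beta].
have qK u w : s <= u -> u <= t -> `|q u w| <= C + 2 * C * C.
  move=> su ut; rewrite /q (le_trans (ler_normB _ _))// lerD ?(b_gamma.2)//.
  by rewrite !normrM !ler_pM ?mulr_ge0 ?(b_y.2) ?(b_beta.2)// ger0_norm.
have qE u w : 0 <= u -> X_ u w = X u w -> seminorm X A u w (c w) ^+ 2 = q u w.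
  move=> u0 XE; rewrite seminorm_sqrE// XE.
  have [k Xk] := chain_unit_vectors chain w u0; have [_ _ Asum _] := chain_rates chain.
  have E (e : 'I_N -> R) : \sum_i e i * X u w i 0 = e k.
    rewrite (bigD1 k)//= Xk mxE !eqxx mulr1 big1 ?addr0// => i ik.
    by rewrite mxE (negbTE ik) mulr0.
  under eq_bigr do rewrite mulrC.
  rewrite /q /gamma /beta /y !E; under [in RHS]eq_bigr do rewrite driftE E.
  under [X in _ = _ - _ * X]eq_bigr do rewrite driftE E.
  transitivity (\sum_i A u i k * (c w i 0 - c w k 0) ^+ 2 - c w k 0 ^+ 2 * \sum_i A u i k).
    by rewrite Asum// mulr0 subr0.
  by rewrite !mulr_sumr -!sumrB; apply: eq_bigr => i _; ring.
have mq_w w : measurable_fun `[s, t] (q ^~ w) by exact: measurable_strip_section.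
have inner w : (\int[leb]_(u in `[s, t]) (seminorm X A u w (c w) ^+ 2)%:E =
    (\int[leb]_(u in `[s, t]) q u w)%:E)%E.
  rewrite /Rintegral fineK; last first.
    apply: (@integrable_fin_num _ _ _ leb `[s, t] _ (EFin \o (q ^~ w))) => //.
    by apply: (@integrable_itv_bounded _ _ _ _ (C + 2 * C * C)) => // u; exact: qK.
  apply: ae_eq_integral => //.
  - apply/measurable_EFinP.
    by apply: (@measurable_strip_section _ _ _ (fun u w => seminorm X A u w (c w) ^+ 2)); exact: (@seminorm_strip (fun _ w => c w) s t s0 st mcs).
  - by apply/measurable_EFinP; exact: mq_w.
  have [J [mJ J0 subJ]] := ae_no_jump chain w; exists J; split => // u /= ne.
  apply: subJ => XE; apply: ne.
  rewrite /= in_itv/= => /andP[su _]; congr (_%:E); apply: qE; first exact: le_trans su.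
  have := le_trans s0 su; rewrite le_eqVlt => /predU1P[<-|]; last exact: XE.
  by rewrite /left_lim lexx.
under eq_integral do rewrite inner.
have L2N : L2_fun P (N_ t).
  rewrite (_ : N_ t = fun w => \sum_i c w i 0 * (M i t w - M i s w)); last first.
    by apply/funext => w; exact: NE.
  apply: L2_fun_sum => i _; apply: (@L2_funM_bounded _ _ _ _ _ _ L) => //.
  by apply: L2_funB; exact: L2_martingale.
have L2q : L2_fun P (fun w => \int[leb]_(u in `[s, t]) q u w).
  apply: (@L2_fun_bounded _ _ _ _ _ ((C + 2 * C * C) * (t - s))).
    exact: (measurable_time_Rintegral P mq qK).
  by move=> w; apply: Rintegral_itv_bound => // u su ut; exact: qK.
transitivity (\int[P]_w (N_ t w ^+ 2)%:E)%E; last first.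
  by apply: eq_integral => w _; rewrite NE.
rewrite (L2_fun_sqrE L2N) isom /Rintegral fineK//.
exact: (integrable_fin_num measurableT (L2_fun_integrable L2q)).
Qed.

End chain_isometry.

(** * Integrals of simple integrands *)

Section simple_integrals.
Context {R : realType} {d : measure_display} {Omega : measurableType d}.
Variables (P : probability Omega R) (N : nat).
Variables (X : R -> Omega -> 'cV[R]_N) (A : R -> 'M[R]_N).
Hypothesis chain : markov_chain P X A.
Local Notation leb := (@lebesgue_measure R).
Local Notation Ft := (completed_natural_filtration P X).
Local Notation M i := (fun t w => chain_martingale X A t w i 0).

Lemma dot_incrE (c u v : 'cV[R]_N) :
  (c^T *m (u - v)) 0 0 = \sum_i c i 0 * (u i 0 - v i 0).
Proof. by rewrite mxE; apply: eq_bigr => i _; rewrite !mxE. Qed.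

Section martingale_transform.
Variables (tau : nat -> R) (c : nat -> Omega -> 'cV[R]_N) (n : nat) (L : R).
Hypotheses (tau0 : forall k, 0 <= tau k)
  (tau_mono : forall k, (k < n)%N -> tau k <= tau k.+1)
  (c_adapted : forall k, (k < n)%N ->
     forall i, measurable_wrt (Ft (tau k)) setT (fun w => c k w i 0))
  (c_bounded : forall k, (k < n)%N -> forall w i, `|c k w i 0| <= L).

Definition transform_step k w :=
  \sum_i c k w i 0 * (M i (tau k.+1) w - M i (tau k) w).

Let L2_step k : (k < n)%N -> L2_fun P (transform_step k).
Proof.
move=> kn; apply: L2_fun_sum => i _; apply: (@L2_funM_bounded _ _ _ _ _ _ L).
- by apply: L2_funB; exact: (L2_martingale chain).
- exact: (measurable_wrt_fun (filtration_measurable chain (t := tau k)) (c_adapted kn i)).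
- by move=> w; exact: c_bounded.
Qed.

Let adapted_step k : (k < n)%N ->
  measurable_wrt (Ft (tau k.+1)) setT (transform_step k).
Proof.
move=> kn; apply: (@measurable_sum _ (g_sigma_algebraType (Ft (tau k.+1))) R setT) => i.
apply: measurable_funM.
  exact: (measurable_wrt_mono (tau_mono kn) (c_adapted kn i)).
by apply: measurable_funB; apply: (martingale_adapted chain) => //; exact: tau_mono.
Qed.

Lemma tau_le j k : (j <= k)%N -> (k <= n)%N -> tau j <= tau k.
Proof.
move=> /subnK <-; elim: (k - j)%N => [//|m IH] mn; rewrite addSn.
by apply: le_trans (tau_mono _) => //; apply: IH; exact: ltnW.
Qed.

Lemma L2_transform m : (m <= n)%N -> L2_fun P (fun w => \sum_(k < m) transform_step k w).
Proof.
by move=> mn; apply: L2_fun_sum => k _; apply: L2_step; exact: leq_trans mn.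
Qed.

Lemma transform_orth m a V : (m <= n)%N -> a <= tau 0 -> 0 <= a ->
  measurable_wrt (Ft a) setT V -> L2_fun P V ->
  \int[P]_w (V w * \sum_(k < m) transform_step k w) = 0.
Proof.
move=> mn a0 a_ge0 mV L2V; under eq_Rintegral do rewrite mulr_sumr.
rewrite Rintegral_sum//; last first.
  by move=> k; apply: (L2_fun_mul L2V (L2_step _)); exact: leq_trans mn.
apply: big1 => k _; have kn : (k < n)%N by exact: leq_trans mn.
apply: (martingale_orth chain (c := fun i w => c k w i 0) (K := L)) => //.
- exact: tau_mono.
- by apply: measurable_wrt_mono mV; rewrite (le_trans a0)// tau_le// ltnW.
- by move=> i; exact: c_adapted.
- by move=> i w; exact: c_bounded.
Qed.

(** Each step is orthogonal to the sum of the previous ones. *)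
Lemma transform_isometry m : (m <= n)%N ->
  (\int[P]_w ((\sum_(k < m) transform_step k w) ^+ 2)%:E =
   \sum_(k < m) \int[P]_w \int[leb]_(u in `[tau k, tau k.+1])
     (seminorm X A u w (c k w) ^+ 2)%:E)%E.
Proof.
elim: m => [_|m IH mn].
  rewrite big_ord0 integral0_eq// => w _; by rewrite big_ord0 expr0n.
have mn' := ltnW mn; rewrite big_ord_recr/= -IH//.
rewrite (one_step_isometry chain (L := L))//; [|exact: tau_mono|exact: c_adapted|exact: c_bounded].
set S := fun w => \sum_(k < m) transform_step k w; rewrite -/(transform_step m).
have L2S : L2_fun P S := L2_transform mn'.
have L2D := L2_step mn.
have L2SD := L2_funD L2S L2D.
have -> : (\int[P]_w ((\sum_(k < m.+1) transform_step k w) ^+ 2)%:E =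
    \int[P]_w ((S w + transform_step m w) ^+ 2)%:E)%E.
  by apply: eq_integral => w _; rewrite big_ord_recr.
rewrite (L2_fun_sqrE L2SD) (L2_fun_sqrE L2S) (L2_fun_sqrE L2D) -EFinD; congr EFin.
have sqD w : (S w + transform_step m w) ^+ 2 =
  (S w ^+ 2 + transform_step m w ^+ 2) + 2 * (S w * transform_step m w) by ring.
under eq_Rintegral do rewrite sqD.
have iS := L2_fun_integrable_sqr L2S; have iD := L2_fun_integrable_sqr L2D.
have iSD := L2_fun_mul L2S L2D.
rewrite RintegralD//; [|exact: (integrableD _ iS iD)|exact: (integrableZl _ 2 iSD)].
rewrite RintegralD// RintegralZl//.
rewrite (martingale_orth chain (V := S) (c := fun i w => c m w i 0) (K := L)) ?mulr0 ?addr0//.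
- exact: tau_mono.
- apply: (@measurable_sum _ (g_sigma_algebraType (Ft (tau m))) R setT _ _ (fun k : 'I_m => transform_step k)) => k.
  by apply: (measurable_wrt_mono _ (adapted_step _)); [rewrite tau_le|exact: leq_trans mn'].
- by move=> i; exact: c_adapted.
- by move=> i w; exact: c_bounded.
Qed.

End martingale_transform.

Variable T : R.
Variable H : @simple_integrand R d Omega N.
Hypothesis Hvalid : si_valid P X T H.

Lemma si_time_le j k : (j <= k)%N -> (k <= si_size H)%N -> si_time H j <= si_time H k.
Proof.
case: Hvalid => _ mono _ _ /subnK <-; elim: (k - j)%N => [//|m IH] mn.
by rewrite addSn; apply: le_trans (mono _ mn); apply: IH; exact: ltnW.
Qed.

Lemma L2_si_integral t : 0 <= t -> L2_fun P (si_integral X A H t).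
Proof.
move=> t0; have [times _ mc [K cK]] := Hvalid.
apply: L2_fun_sum => -[k kn] _ /=.
rewrite (_ : (fun w => _) = fun w => \sum_i si_coef H k w i 0 *
  (M i (Num.min (si_time H k.+1) t) w - M i (Num.min (si_time H k) t) w)); last first.
  by apply/funext => w; rewrite dot_incrE.
have [tk0 _] := times k (ltnW kn); have [tk1 _] := times k.+1 kn.
apply: L2_fun_sum => i _; apply: (@L2_funM_bounded _ _ _ _ _ _ K).
- by apply: L2_funB; apply: (L2_martingale chain); rewrite le_min t0 andbT.
- apply: (@measurable_fun_coord _ _ _ Omega setT (si_coef H k)).
  exact: (measurable_wrt_fun (filtration_measurable chain (t := si_time H k)) (mc k kn)).
- by move=> w; exact: cK.
Qed.

Lemma si_process_strip i b : measurable_fun (strip 0 b)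
  (fun z : Omega * R => si_process H z.2 z.1 i 0).
Proof.
have [_ _ mc _] := Hvalid.
rewrite (_ : (fun z => _) = fun z : Omega * R => \sum_(k < si_size H)
    si_coef H k z.1 i 0 * \1_(`]si_time H k, si_time H k.+1]) z.2); last first.
  apply/funext => z; rewrite /si_process summxE big_mkcond/=; apply: eq_bigr => k _.
  by rewrite indicE mem_setE in_itv/=; case: (_ && _); rewrite ?mulr1 ?mulr0.
apply: measurable_funTS; apply: measurable_sum => -[k kn] /=; apply: measurable_funM.
  have mck : measurable_fun setT (fun w => si_coef H k w i 0).
    apply: (@measurable_fun_coord _ _ _ Omega setT (si_coef H k)).
    exact: (measurable_wrt_fun (filtration_measurable chain (t := si_time H k)) (mc k kn)).
  exact: (measurableT_comp mck measurable_fst).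
have mi : measurable_fun setT (\1_(`]si_time H k, si_time H k.+1]) : R -> R).
  exact: measurable_indic.
exact: (measurableT_comp mi measurable_snd).
Qed.

Section window.
Variables (a b : R).
Hypotheses (a0 : 0 <= a) (ab : a <= b).

(* Clipping the times to [a, b] turns the increment of the integral over the
   window into a martingale transform; coefficients known only after b are
   replaced by 0, which keeps the clipped steps adapted. *)
Let tau k := Num.max a (Num.min b (si_time H k)).
Let c k w : 'cV[R]_N := if si_time H k <= b then si_coef H k w else 0.

Let tau_ge0 k : 0 <= tau k. Proof. by rewrite le_max a0. Qed.

Let tau_mono k : (k < si_size H)%N -> tau k <= tau k.+1.
Proof.
move=> kn; have tk : si_time H k <= si_time H k.+1 by exact: si_time_le.
rewrite /tau ge_max le_max lexx/= le_max; apply/orP; right.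
by rewrite le_min !ge_min lexx tk orbT.
Qed.

Let c_adapted k : (k < si_size H)%N ->
  forall i, measurable_wrt (Ft (tau k)) setT (fun w => c k w i 0).
Proof.
move=> kn i; rewrite /c; have [tb|tb] := boolP (si_time H k <= b); last first.
  by under eq_fun do rewrite mxE; exact: measurable_cst.
have [_ _ mc _] := Hvalid; apply: (@measurable_wrt_mono _ _ _ P N X (si_time H k)).
  by rewrite /tau (min_idPr tb) le_max lexx orbT.
apply: (@measurable_fun_coord _ _ _ (g_sigma_algebraType (Ft (si_time H k))) setT (si_coef H k)).
exact: mc.
Qed.

Let c_bounded : exists2 L, 0 <= L &
  forall k, (k < si_size H)%N -> forall w i, `|c k w i 0| <= L.
Proof.
have [_ _ _ [K cK]] := Hvalid; exists `|K| => // k kn w i; rewrite /c.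
case: ifP => _; last by rewrite mxE normr0.
by rewrite (le_trans (cK _ _ _ kn))// ler_norm.
Qed.

Let window_incr w : si_integral X A H b w - si_integral X A H a w =
  \sum_(k < si_size H) transform_step tau c k w.
Proof.
have cl (f : R -> R) x : f (Num.min x b) - f (Num.min x a) =
    f (Num.max a (Num.min b x)) - f a.
  have [xa|ax] := leP x a.
    by rewrite (min_idPl (le_trans xa ab)) (min_idPr (le_trans xa ab)) (max_idPl xa) !subrr.
  rewrite (max_idPr _) 1?minC// le_min ab ltW//.
have alg (e p q r s u v z : R) : p - q = u - z -> r - s = v - z ->
    e * (p - r) - e * (q - s) = e * (u - v).
  by move=> h1 h2; rewrite -mulrBr; congr (_ * _); lra.
have alg0 (e e' p q r : R) : e * (p - p) - e * (q - q) = e' * (r - r).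
  by rewrite (subrr p) (subrr q) (subrr r) !mulr0 subr0.
rewrite /si_integral -sumrB; apply: eq_bigr => -[k kn] _.
pose m t := chain_martingale X A t w.
transitivity (\sum_i si_coef H k w i 0 * (m (Num.min (si_time H k.+1) b) i 0 - m (Num.min (si_time H k) b) i 0)
  - \sum_i si_coef H k w i 0 * (m (Num.min (si_time H k.+1) a) i 0 - m (Num.min (si_time H k) a) i 0)).
  by congr (_ - _); exact: dot_incrE.
rewrite -sumrB; apply: eq_bigr => i _; rewrite /c; case: ifPn => tb.
  exact: alg (cl (fun t => chain_martingale X A t w i 0) (si_time H k.+1))
    (cl (fun t => chain_martingale X A t w i 0) (si_time H k)).
have tkb : b < si_time H k by rewrite ltNge.
have tk1b : b < si_time H k.+1 by apply: lt_le_trans tkb _; exact: si_time_le.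
rewrite (min_idPr (ltW tkb)) (min_idPr (ltW tk1b)).
rewrite (min_idPr (le_trans ab (ltW tkb))) (min_idPr (le_trans ab (ltW tk1b))).
have -> : tau k = tau k.+1 by rewrite /tau (min_idPl (ltW tkb)) (min_idPl (ltW tk1b)).
exact: alg0.
Qed.

Lemma si_integral_orth V : measurable_wrt (Ft a) setT V -> L2_fun P V ->
  \int[P]_w (V w * (si_integral X A H b w - si_integral X A H a w)) = 0.
Proof.
move=> mV L2V; under eq_Rintegral do rewrite window_incr.
have [L _ cL] := c_bounded.
apply: (transform_orth (a := a) tau_ge0 tau_mono c_adapted cL) => //.
by rewrite /tau le_max lexx.
Qed.

(** On the window the process of H agrees with the truncated coefficients, so
    the isometry bounds the energy of H by the variance of the increment. *)
Lemma si_integral_energy :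
  (\int[P]_w \int[leb]_(u in `[a, b]) (seminorm X A u w (si_process H u w) ^+ 2)%:E
   <= \int[P]_w ((si_integral X A H b w - si_integral X A H a w) ^+ 2)%:E)%E.
Proof.
have [L L0 cL] := c_bounded.
under [leRHS]eq_integral do rewrite window_incr.
rewrite (transform_isometry tau_ge0 tau_mono c_adapted cL (leqnn _)).
have mphi k : (k < si_size H)%N ->
    measurable_fun (strip (tau k) (tau k.+1))
      (fun z : Omega * R => seminorm X A z.2 z.1 (c k z.1) ^+ 2).
  move=> kn; apply: (@seminorm_strip _ _ _ _ _ _ _ chain (fun _ w => c k w)) => //.
    exact: tau_mono.
  move=> i; apply: measurable_funTS.
  have mc : measurable_fun setT (fun w => c k w i 0).
    exact: (measurable_wrt_fun (filtration_measurable chain (t := tau k)) (c_adapted kn i)).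
  exact: (measurableT_comp mc measurable_fst).
rewrite -ge0_integral_sum//; last 2 first.
- move=> [k kn]; apply: measurable_time_integral => [|t w]; last by rewrite lee_fin sqr_ge0.
  by apply/measurable_EFinP; exact: mphi.
- by move=> k w _; apply: integral_ge0 => t _; rewrite lee_fin sqr_ge0.
apply: ge0_le_lower_integral => w _.
  by apply: integral_ge0 => t _; rewrite lee_fin sqr_ge0.
have mS : measurable_fun `[a, b] (fun u => (seminorm X A u w (si_process H u w) ^+ 2)%:E).
  apply/measurable_EFinP.
  apply: (@measurable_strip_section _ _ _ (fun u w => seminorm X A u w (si_process H u w) ^+ 2)).
  apply: (seminorm_strip chain) => // i.
  by apply: (measurable_stripS a0 (lexx b)); exact: si_process_strip.
rewrite -(integral_itv_obnd_cbnd (b := BRight b)); last first.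
  by apply: measurable_funS mS => // u; rewrite /= !in_itv/= => /andP[/ltW -> ->].
pose phi k u : \bar R := ((fun u => (seminorm X A u w (c k w) ^+ 2)%:E) \_ `[tau k, tau k.+1]) u.
have phi0 k u : (0 <= phi k u)%E.
  by rewrite /phi /patch; case: ifP => // _; rewrite lee_fin sqr_ge0.
apply: (@le_trans _ _ (\int[leb]_(u in `]a, b]) \sum_(k < si_size H) phi k u)%E).
  apply: ge0_le_lower_integral => u; first by rewrite lee_fin sqr_ge0.
  rewrite /= in_itv/= => /andP[au ub].
  have [[k [kn ku]]|none] := pselect (exists k, (k < si_size H)%N /\ si_time H k < u <= si_time H k.+1).
    have -> : si_process H u w = si_coef H k w.
      rewrite /si_process (big_pred1 (Ordinal kn))// => -[j jn]; rewrite /= -val_eqE/=.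
      apply/idP/eqP => [/andP[ju uj]|-> //]; case/andP: ku => ku uk.
      have [jk|kj|//] := ltngtP j k.
        by have := lt_le_trans ku (le_trans uj (si_time_le jk (ltnW kn))); rewrite ltxx.
      by have := lt_le_trans ju (le_trans uk (si_time_le kj (ltnW jn))); rewrite ltxx.
    apply: le_trans (_ : phi k u <= _)%E; last first.
      by rewrite (bigD1 (Ordinal kn))//= leeDl// sume_ge0.
    case/andP: ku => ku uk; have kb : si_time H k <= b by apply/ltW/(lt_le_trans ku).
    rewrite /phi /patch ifT /c ?kb//; apply/mem_set; rewrite /= in_itv/=.
    by rewrite /tau ge_max ltW//= ge_min (ltW ku) orbT/= le_max le_min ub uk orbT.
  have -> : si_process H u w = 0.
    rewrite /si_process big_pred0// => -[j jn].
    by apply/negbTE/negP => /= ju; apply: none; exists j.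
  rewrite (_ : seminorm X A u w 0 ^+ 2 = 0) ?sume_ge0//.
  rewrite (seminorm_sqrE chain) ?(le_trans a0 (ltW au))// big1// => k _.
  by rewrite big1 ?mulr0// => i _; rewrite !mxE subrr expr0n mulr0.
have mphi_ k : (k < si_size H)%N -> measurable_fun setT (phi k).
  move=> kn; have [+ _] := measurable_restrictT (fun u => (seminorm X A u w (c k w) ^+ 2)%:E)
    (measurable_itv `[tau k, tau k.+1]); apply.
  apply/measurable_EFinP.
  apply: (@measurable_strip_section _ _ _ (fun u w => seminorm X A u w (c k w) ^+ 2)).
  exact: mphi.
rewrite ge0_integral_sum//; last first.
  by move=> [k kn]; apply: measurable_funTS; exact: mphi_.
apply: lee_sum => k _; rewrite integral_mkcond [leRHS]integral_mkcond.
apply: ge0_le_lower_integral => u _; rewrite -/(phi k u) /patch.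
  by case: ifP.
by case: ifP => // _; exact: phi0.
Qed.

End window.

End simple_integrals.

(** * The Ito integral *)

Lemma cvge0_lt (R : realType) (u : (\bar R)^nat) (e : R) : u n @[n --> \oo] --> 0%E ->
  0 < e -> \forall n \near \oo, (u n < e%:E)%E.
Proof.
move=> /fine_cvgP[uf /cvgrPdist_lt u0] e0; near=> n.
have un : u n \is a fin_num by near: n.
have : `|0 - fine (u n)| < e by near: n; exact: u0.
by rewrite sub0r normrN ltr_norml => /andP[_]; rewrite -lte_fin fineK.
Unshelve. all: by end_near. Qed.

Section ito_integrals.
Context {R : realType} {d : measure_display} {Omega : measurableType d}.
Variables (P : probability Omega R) (N : nat).
Variables (X : R -> Omega -> 'cV[R]_N) (A : R -> 'M[R]_N).
Hypothesis chain : markov_chain P X A.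
Local Notation leb := (@lebesgue_measure R).
Local Notation Ft := (completed_natural_filtration P X).
Variables (T : R) (Z : R -> Omega -> 'cV[R]_N) (I : R -> Omega -> R).
Hypothesis mZ : forall i, measurable_fun (strip 0 T)
  (fun z : Omega * R => Z z.2 z.1 i 0).
Hypothesis ito : ito_integral P X A T Z I.

Lemma ito_measurable t : 0 <= t -> t <= T -> measurable_fun setT (I t).
Proof.
case: ito => mI _ _ t0 tT.
exact: (measurable_wrt_fun (filtration_measurable chain (t := t)) (mI t t0 tT)).
Qed.

(** The three convergences hold along the same sequence, so one simple integrand
    serves for the integrand and for the values at both end points. *)
Lemma ito_approx a b e : 0 <= a -> a <= b -> b <= T -> 0 < e ->
  exists2 H, si_valid P X T H & [/\
    (\int[P]_w \int[leb]_(s in `[0%R, T])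
       (seminorm X A s w (Z s w - si_process H s w) ^+ 2)%:E < e%:E)%E,
    (\int[P]_w ((I a w - si_integral X A H a w) ^+ 2)%:E < e%:E)%E &
    (\int[P]_w ((I b w - si_integral X A H b w) ^+ 2)%:E < e%:E)%E].
Proof.
move=> a0 ab bT e0; have [_ _ [H [Hv HZ HI]]] := ito.
have aT := le_trans ab bT; have b0 := le_trans a0 ab.
have sqE t n : (\int[P]_w ((I t w - si_integral X A (H n) t w) ^+ 2)%:E =
    \int[P]_w (`|I t w - si_integral X A (H n) t w| ^+ 2)%:E)%E.
  by apply: eq_integral => w _; rewrite real_normK// num_real.
have [n [nZ [na nb]]] := filter_ex (filterI (cvge0_lt HZ e0)
  (filterI (cvge0_lt (HI a a0 aT) e0) (cvge0_lt (HI b b0 bT) e0))).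
exists (H n); first exact: Hv.
by split; [exact: nZ|rewrite sqE; exact: na|rewrite sqE; exact: nb].
Qed.

Lemma L2_ito t : 0 <= t -> t <= T -> L2_fun P (I t).
Proof.
move=> t0 tT; have [H Hv [_ _ It]] := ito_approx t0 (lexx t) tT ltr01.
have L2S := L2_si_integral chain Hv t0.
have L2E : L2_fun P (fun w => I t w - si_integral X A H t w).
  split; last exact: lt_trans It (ltry _).
  by apply: measurable_funB; [exact: ito_measurable|case: L2S].
rewrite (_ : I t = fun w => (I t w - si_integral X A H t w) + si_integral X A H t w).
  exact: L2_funD.
by apply/funext => w; rewrite subrK.
Qed.

Let incr_error a b e H : 0 <= a -> a <= b -> b <= T -> si_valid P X T H ->
  (\int[P]_w ((I a w - si_integral X A H a w) ^+ 2)%:E < e%:E)%E ->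
  (\int[P]_w ((I b w - si_integral X A H b w) ^+ 2)%:E < e%:E)%E ->
  let E w := (I b w - I a w) - (si_integral X A H b w - si_integral X A H a w) in
  L2_fun P E /\ \int[P]_w (E w ^+ 2) <= 4 * e.
Proof.
move=> a0 ab bT Hv ea eb E; have aT := le_trans ab bT; have b0 := le_trans a0 ab.
pose D t w := I t w - si_integral X A H t w.
have L2D t : 0 <= t -> t <= T -> L2_fun P (D t).
  by move=> t0 tT; apply: L2_funB; [exact: L2_ito|exact: (L2_si_integral chain Hv)].
have alg (p q r s : R) : p - q - (r - s) = (p - r) - (q - s) by ring.
have EE w : E w = D b w - D a w by exact: alg.
have L2E : L2_fun P E.
  by rewrite (_ : E = fun w => D b w - D a w); [apply: L2_funB; exact: L2D|exact/funext].
split => //.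
have Da : (\int[P]_w (D a w ^+ 2)%:E < e%:E)%E := ea.
have Db : (\int[P]_w (D b w ^+ 2)%:E < e%:E)%E := eb.
clear ea eb; clearbody D E.
move: Da Db; rewrite (L2_fun_sqrE (L2D a a0 aT)) (L2_fun_sqrE (L2D b b0 bT)) !lte_fin.
have := L2_fun_sqr_le (L2D b b0 bT) (L2D a a0 aT) L2E.
move: (\int[P]_w (D b w ^+ 2)) (\int[P]_w (D a w ^+ 2)) (\int[P]_w (E w ^+ 2)) => p q r.
move=> pqr pe qe; suff : r <= 2 * p + 2 * q by lra.
apply: pqr => w; rewrite EE; move: (D b w) (D a w) => x y.
by have := sqr_ge0 (x + y); lra.
Qed.

(** The expectation x is unchanged when the increment is replaced by its error E
    against a simple integral. If x were not 0, Young's inequality with weight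
    lam would bound 2 |x| by |x| + |x| / 2. *)
Lemma ito_orth a b V : 0 <= a -> a <= b -> b <= T ->
  measurable_wrt (Ft a) setT V -> L2_fun P V ->
  \int[P]_w (V w * (I b w - I a w)) = 0.
Proof.
move=> a0 ab bT mV L2V; have aT := le_trans ab bT; have b0 := le_trans a0 ab.
set x := Rintegral _ _ _; apply/eqP/negPn/negP => x0.
set v := \int[P]_w (V w ^+ 2).
have v0 : 0 <= v by apply: Rintegral_ge0 => w _; exact: sqr_ge0.
pose lam := `|x| / (v + 1).
have x_gt0 : 0 < `|x| by rewrite normr_gt0.
have lam0 : 0 < lam by rewrite divr_gt0// ltr_wpDl.
have e0 : 0 < lam * `|x| / 8 by rewrite divr_gt0// mulr_gt0.
have [H Hv [_ ea eb]] := ito_approx a0 ab bT e0.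
have [] := incr_error a0 ab bT Hv ea eb.
set E := fun w => _ => L2E Ee.
have L2S : L2_fun P (fun w => si_integral X A H b w - si_integral X A H a w).
  by apply: L2_funB; exact: (L2_si_integral chain Hv).
have xE : x = \int[P]_w (V w * E w).
  rewrite -[RHS]addr0 -(si_integral_orth chain Hv a0 ab mV L2V).
  rewrite -RintegralD//; [|exact: L2_fun_mul|exact: L2_fun_mul].
  have alg (v' p q r : R) : v' * (p - q) = v' * ((p - q) - r) + v' * r by ring.
  by apply: eq_Rintegral => w _; exact: alg.
have := L2_fun_young L2V L2E lam0; rewrite -xE -/v => young.
have l1 : lam * v <= `|x|.
  rewrite /lam mulrAC ler_pdivrMr ?ltr_wpDl// ler_wpM2l//.
  by rewrite lerDl.
have l2 : lam^-1 * \int[P]_w (E w ^+ 2) <= `|x| / 2.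
  rewrite mulrC ler_pdivrMr// (le_trans Ee)//.
  by rewrite le_eqVlt; apply/orP; left; apply/eqP; field.
move: young l1 l2 x_gt0; move: (lam * v) (lam^-1 * _) `|x| => p q r; lra.
Qed.

(** One factor 2 of the constant comes from replacing Z by a simple integrand,
    the other from replacing the integral of that integrand by I. *)
Lemma ito_energy a b : 0 <= a -> a <= b -> b <= T ->
  (\int[P]_w \int[leb]_(s in `[a, b]) (seminorm X A s w (Z s w) ^+ 2)%:E <=
   4%:E * \int[P]_w ((I b w - I a w) ^+ 2)%:E)%E.
Proof.
move=> a0 ab bT; have aT := le_trans ab bT; have b0 := le_trans a0 ab.
have T0 := le_trans a0 aT.
have L2I : L2_fun P (fun w => I b w - I a w) by apply: L2_funB; exact: L2_ito.
rewrite (L2_fun_sqrE L2I); set v := \int[P]_w _.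
apply/lee_addgt0Pr => e e0.
have e'0 : 0 < e / 32 by rewrite divr_gt0.
have [H Hv [eZ ea eb]] := ito_approx a0 ab bT e'0.
have [] := incr_error a0 ab bT Hv ea eb; set E := fun w => _ => L2E Ee.
have L2S : L2_fun P (fun w => si_integral X A H b w - si_integral X A H a w).
  by apply: L2_funB; exact: (L2_si_integral chain Hv).
have mZi i : measurable_fun (strip a b) (fun z : Omega * R => Z z.2 z.1 i 0).
  exact: (measurable_stripS a0 bT).
have mHi i : measurable_fun (strip a b) (fun z : Omega * R => si_process H z.2 z.1 i 0).
  by apply: (measurable_stripS a0 (lexx b)); exact: (si_process_strip chain Hv).
pose f1 s w := 2 * seminorm X A s w (si_process H s w) ^+ 2.
pose f2 s w := 2 * seminorm X A s w (Z s w - si_process H s w) ^+ 2.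
have f10 s w : (0 <= (f1 s w)%:E)%E by rewrite lee_fin mulr_ge0// sqr_ge0.
have f20 s w : (0 <= (f2 s w)%:E)%E by rewrite lee_fin mulr_ge0// sqr_ge0.
have mf1 : measurable_fun (strip a b) (fun z : Omega * R => (f1 z.2 z.1)%:E).
  apply/measurable_EFinP; apply: measurable_funM => //.
  exact: (seminorm_strip chain).
have mf2 : measurable_fun (strip a b) (fun z : Omega * R => (f2 z.2 z.1)%:E).
  apply/measurable_EFinP; apply: measurable_funM => //.
  apply: (seminorm_strip chain (z := fun s w => Z s w - si_process H s w)) => // i.
  by under eq_fun do rewrite mxE mxE; exact: measurable_funB.
have int0 (f : R -> Omega -> \bar R) w : (forall s w, 0 <= f s w)%E ->
    (0 <= \int[leb]_(s in `[a, b]) f s w)%E by move=> f0; exact: integral_ge0.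
have sec (f : R -> Omega -> \bar R) w : measurable_fun (strip a b) (fun z : Omega * R => f z.2 z.1) ->
    measurable_fun `[a, b] (f ^~ w).
  move=> mf; apply: (@measurable_comp _ _ _ _ _ _ (strip a b) (fun z : Omega * R => f z.2 z.1) _ (pair w)) => //.
  - exact: measurable_strip.
  - by move=> _ [t tab <-].
  - by apply: measurable_funTS; exact: pair1_measurable.
apply: (@le_trans _ _ (\int[P]_w (\int[leb]_(s in `[a, b]) (f1 s w)%:E +
   \int[leb]_(s in `[a, b]) (f2 s w)%:E))%E).
  apply: ge0_le_lower_integral => w _.
    by apply: integral_ge0 => s _; rewrite lee_fin sqr_ge0.
  rewrite -ge0_integralD//; [|exact: (sec (fun s w => (f1 s w)%:E))|exact: (sec (fun s w => (f2 s w)%:E))].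
  apply: ge0_le_lower_integral => s; first by rewrite lee_fin sqr_ge0.
  rewrite /= in_itv/= => /andP[as_ _]; rewrite -EFinD lee_fin.
  by apply: (seminorm_sqr_le chain); exact: le_trans as_.
rewrite ge0_integralD//; last 4 first.
- by move=> w _; exact: (int0 (fun s w => (f1 s w)%:E)).
- exact: (measurable_time_integral mf1).
- by move=> w _; exact: (int0 (fun s w => (f2 s w)%:E)).
- exact: (measurable_time_integral mf2).
have two (g : R -> Omega -> R) : measurable_fun (strip a b) (fun z : Omega * R => (2 * g z.2 z.1 ^+ 2)%:E) ->
   (\int[P]_w \int[leb]_(s in `[a, b]) (2 * g s w ^+ 2)%:E =
    2%:E * \int[P]_w \int[leb]_(s in `[a, b]) (g s w ^+ 2)%:E)%E.
  move=> mg; have mg' : measurable_fun (strip a b) (fun z : Omega * R => (g z.2 z.1 ^+ 2)%:E).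
    apply/measurable_EFinP; move/measurable_EFinP : mg => mg.
    rewrite (_ : (fun z => _) = fun z : Omega * R => 2^-1 * (2 * g z.2 z.1 ^+ 2)).
      exact: measurable_funM.
    by apply/funext => z; rewrite mulKf.
  have g0 s w : (0 <= (g s w ^+ 2)%:E)%E by rewrite lee_fin sqr_ge0.
  rewrite -ge0_integralZl//; last 2 first.
  - exact: (measurable_time_integral mg').
  - by move=> w _; exact: (int0 (fun s w => (g s w ^+ 2)%:E)).
  apply: eq_integral => w _; rewrite -ge0_integralZl//.
  exact: (sec (fun s w => (g s w ^+ 2)%:E)).
rewrite (two (fun s w => seminorm X A s w (si_process H s w)))//.
rewrite (two (fun s w => seminorm X A s w (Z s w - si_process H s w)))//.
have b1 : (\int[P]_w \int[leb]_(s in `[a, b]) (seminorm X A s w (si_process H s w) ^+ 2)%:E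
    <= (2 * v + e / 4)%:E)%E.
  apply: (le_trans (si_integral_energy chain Hv a0 ab)).
  rewrite (L2_fun_sqrE L2S) lee_fin.
  have := L2_fun_sqr_le L2I L2E L2S; rewrite -/v.
  move: Ee; move: (\int[P]_w (E w ^+ 2)) => q qe h.
  apply: le_trans (h _) _; last by lra.
  move=> w; have alg (x y : R) : x ^+ 2 <= 2 * y ^+ 2 + 2 * (y - x) ^+ 2.
    by have := sqr_ge0 (x - 2 * y); lra.
  exact: alg.
have b2 : (\int[P]_w \int[leb]_(s in `[a, b])
    (seminorm X A s w (Z s w - si_process H s w) ^+ 2)%:E <= (e / 32)%:E)%E.
  apply: le_trans (ltW eZ); apply: ge0_le_lower_integral => w _.
    by apply: integral_ge0 => s _; rewrite lee_fin sqr_ge0.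
  rewrite integral_mkcond [leRHS]integral_mkcond; apply: ge0_le_lower_integral => s _.
    by rewrite /patch; case: ifP => // _; rewrite lee_fin sqr_ge0.
  rewrite /patch; case: ifPn => [/set_mem|_]; last by case: ifP => // _; rewrite lee_fin sqr_ge0.
  rewrite /= in_itv/= => /andP[as_ sb]; rewrite ifT//; apply/mem_set.
  by rewrite /= in_itv/= (le_trans a0 as_) (le_trans sb).
apply: (@le_trans _ _ (2%:E * (2 * v + e / 4)%:E + 2%:E * (e / 32)%:E)%E).
  by apply: leeD; apply: lee_wpmul2l.
rewrite -!EFinM -!EFinD lee_fin; lra.
Qed.

End ito_integrals.

(** * The maximal inequality *)

Lemma limn_einf_le (R : realType) (u : (\bar R)^nat) (c : \bar R) :
  (forall n, u n <= c)%E -> (limn_einf u <= c)%E.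
Proof.
move=> uc; rewrite limn_einf_lim; apply: lime_le; first exact: is_cvg_einfs.
by apply: nearW => n; apply: le_trans (uc n); apply: ereal_inf_lbound; exists n => /=.
Qed.

Lemma cvg_le_limn_einf (R : realType) (u v : (\bar R)^nat) (l : \bar R) :
  v n @[n --> \oo] --> l -> (forall n, v n <= u n)%E -> (l <= limn_einf u)%E.
Proof.
move=> vl vu; rewrite -(cvg_limn_einf_sup vl).1 !limn_einf_lim.
apply: lee_lim; [exact: is_cvg_einfs|exact: is_cvg_einfs|apply: nearW => n].
apply: le_ereal_inf_tmp => _ [k nk <-]; apply: le_trans (vu k).
by apply: ereal_inf_lbound; exists k.
Qed.

Section discrete_doob.
Context {R : realType} {d : measure_display} {Om : measurableType d}.
Variable P : probability Om R.

Fixpoint running_max (s : nat -> R) (k : nat) : R :=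
  if k is k'.+1 then Num.max (running_max s k') (s k) else 0.

Lemma running_max_ge0 s k : 0 <= running_max s k.
Proof. by elim: k => //= k IH; rewrite le_max IH. Qed.

Lemma running_max_ge s j k : s 0%N = 0 -> (j <= k)%N -> s j <= running_max s k.
Proof.
move=> s0; elim: k => [|k IH]; first by rewrite leqn0 => /eqP->; rewrite s0.
rewrite leq_eqVlt => /predU1P[->|jk]; first by rewrite /= le_max lexx orbT.
by rewrite /= le_max IH.
Qed.

(** The pathwise form of Doob's inequality: the sum on the right has mean zero
    for a martingale. It is summation by parts, since the running maximum only
    grows at the times when the path attains it. *)
Lemma running_max_sqr s n : s 0%N = 0 ->
  running_max s n ^+ 2 <=
  4 * s n ^+ 2 + (-4) * \sum_(k < n) running_max s k * (s k.+1 - s k).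
Proof.
move=> s0; set m := running_max s.
suff : m n ^+ 2 / 2 - m n * s n + \sum_(k < n) m k * (s k.+1 - s k) <= 0.
  move: (\sum_(k < n) _) (m n) (s n) => x y z.
  by have := sqr_ge0 (y / 2 - z); lra.
elim: n => [|n IH].
  by rewrite big_ord0 /m/= expr0n/= !mul0r subrr addr0.
rewrite big_ord_recr/=; move: IH; set x := \sum_(k < n) _.
rewrite -[m n.+1]/(Num.max (m n) (s n.+1)); move: (m n) (s n) (s n.+1) => p q r IH.
have [rp|pr] := leP r p; first by rewrite /=; lra.
by rewrite /=; have := sqr_ge0 (p - r); lra.
Qed.

Lemma doob_L2 (s : nat -> Om -> R) n : (forall w, s 0%N w = 0) ->
  (forall k, (k <= n)%N -> L2_fun P (s k)) ->
  (forall k, (k < n)%N ->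
    \int[P]_w (running_max (s ^~ w) k * (s k.+1 w - s k w)) = 0) ->
  L2_fun P (fun w => running_max (s ^~ w) n) /\
  \int[P]_w (running_max (s ^~ w) n ^+ 2) <= 4 * \int[P]_w (s n w ^+ 2).
Proof.
move=> s0 L2s orth.
have L2m k : (k <= n)%N -> L2_fun P (fun w => running_max (s ^~ w) k).
  elim: k => [_|k IH kn]; first exact: (@L2_fun_cst _ _ _ P 0).
  have [m1 i1] := IH (ltnW kn); have [m2 i2] := L2s _ kn.
  have mx : measurable_fun setT (fun w => running_max (s ^~ w) k.+1).
    exact: measurable_maxr.
  apply: (@L2_fun_le _ _ _ _ _ (fun w => (running_max (s ^~ w) k ^+ 2)%:E + (s k.+1 w ^+ 2)%:E)%E) => //.
    move=> w; rewrite -EFinD lee_fin /=; move: (running_max _ _) (s _ _) => p q.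
    by case: (leP p q) => _; rewrite ?lerDl ?lerDr sqr_ge0.
  have me (f : Om -> R) : measurable_fun setT f ->
      measurable_fun setT (fun w => (f w ^+ 2)%:E).
    by move=> mf; apply/measurable_EFinP; exact: measurable_funX.
  rewrite ge0_integralD//; first exact: lte_add_pinfty.
  - by move=> w _; rewrite lee_fin sqr_ge0.
  - exact: me.
  - by move=> w _; rewrite lee_fin sqr_ge0.
  - exact: me.
have L2n := L2m n (leqnn n); split => //.
have ik (k : 'I_n) : P.-integrable setT
    (EFin \o (fun w => running_max (s ^~ w) k * (s k.+1 w - s k w))).
  have kn := ltn_ord k; apply: L2_fun_mul; first by apply: L2m; exact: ltnW.
  by apply: L2_funB; apply: L2s => //; exact: ltnW.
have isum : P.-integrable setT
    (EFin \o (fun w => \sum_(k < n) running_max (s ^~ w) k * (s k.+1 w - s k w))).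
  rewrite (_ : EFin \o _ = fun w => (\sum_(k < n) (running_max (s ^~ w) k * (s k.+1 w - s k w))%:E)%E).
    by apply: integrable_sum => // k _; exact: ik.
  by apply/funext => w /=; rewrite sumEFin.
have isq := L2_fun_integrable_sqr (L2s n (leqnn n)).
have i1 := integrable_EFinZ 4 isq; have i2 := integrable_EFinZ (-4) isum.
apply: (@le_trans _ _ (\int[P]_w (4 * s n w ^+ 2 +
    (-4) * \sum_(k < n) running_max (s ^~ w) k * (s k.+1 w - s k w)))).
  apply: le_Rintegral => //.
  - exact: L2_fun_integrable_sqr.
  - exact: integrable_EFinD.
  - by move=> w _; exact: running_max_sqr.
rewrite (RintegralD measurableT i1 i2) (RintegralZl _ measurableT isq) (RintegralZl _ measurableT isum).
rewrite (Rintegral_sum _ _ measurableT ik) big1 ?mulr0 ?addr0// => k _.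
exact: orth.
Qed.

End discrete_doob.

Section ito_maximal.
Context {R : realType} {d : measure_display} {Omega : measurableType d}.
Variables (P : probability Omega R) (N : nat).
Variables (X : R -> Omega -> 'cV[R]_N) (A : R -> 'M[R]_N).
Hypothesis chain : markov_chain P X A.
Local Notation Ft := (completed_natural_filtration P X).
Variables (T : R) (Z : R -> Omega -> 'cV[R]_N) (I : R -> Omega -> R).
Hypothesis ito : ito_integral P X A T Z I.
Variables (a b : R).
Hypotheses (a0 : 0 <= a) (ab : a < b) (bT : b <= T).

Let grid n k : R := a + k%:R * ((b - a) / n.+1%:R).

Let gridE n : grid n n.+1 = b.
Proof. by rewrite /grid; have : n.+1%:R != 0 :> R by []; move=> ?; field. Qed.

Let grid_le n j k : (j <= k)%N -> grid n j <= grid n k.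
Proof.
move=> jk; rewrite lerD2l ler_wpM2r ?ler_nat// divr_ge0// subr_ge0 ltW//.
Qed.

Let grid_ge n k : a <= grid n k.
Proof. by rewrite /grid lerDl mulr_ge0// divr_ge0// subr_ge0 ltW. Qed.

Let grid_leb n k : (k <= n.+1)%N -> grid n k <= b.
Proof. by move=> kn; rewrite -(gridE n); exact: grid_le. Qed.

Let s (e : R) n k w := e * (I (grid n k) w - I a w).

Let s_max e n : e ^+ 2 = 1 ->
  L2_fun P (fun w => running_max (s e n ^~ w) n.+1) /\
  \int[P]_w (running_max (s e n ^~ w) n.+1 ^+ 2) <= 4 * \int[P]_w ((I b w - I a w) ^+ 2).
Proof.
move=> e2.
have aT : a <= T by rewrite (le_trans (ltW ab)).
have L2I t : a <= t -> t <= b -> L2_fun P (fun w => I t w - I a w).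
  move=> at_ tb; apply: L2_funB; apply: (L2_ito chain ito) => //.
    exact: le_trans at_.
  exact: le_trans bT.
have L2s k : (k <= n.+1)%N -> L2_fun P (s e n k).
  move=> kn; apply: (@L2_funM_bounded _ _ _ _ _ (cst e) `|e|) => //.
  by apply: L2I; [exact: grid_ge|exact: grid_leb].
have g0 k : 0 <= grid n k by exact: le_trans (grid_ge n k).
have ad j k : (j <= k)%N -> (k <= n.+1)%N -> measurable_wrt (Ft (grid n k)) setT (s e n j).
  move=> jk kn; have [mI _ _] := ito; apply: measurable_funM => //.
  apply: measurable_funB.
    apply: (measurable_wrt_mono (grid_le n jk)); apply: mI => //.
    by apply: le_trans bT; apply: grid_leb; exact: leq_trans kn.
  by apply: (measurable_wrt_mono (grid_ge n k)); exact: mI.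
have madapt k : (k <= n.+1)%N ->
    measurable_wrt (Ft (grid n k)) setT (fun w => running_max (s e n ^~ w) k).
  move=> kn; suff h j : (j <= k)%N -> measurable_wrt (Ft (grid n k)) setT (fun w => running_max (s e n ^~ w) j).
    exact: h.
  elim: j => [_|j IH jk]; first exact: measurable_cst.
  apply: (@measurable_maxr _ (g_sigma_algebraType (Ft (grid n k))) R setT
    (fun w => running_max (s e n ^~ w) j) (s e n j.+1)).
    by apply: IH; exact: ltnW.
  exact: (ad _ _ jk kn).
have L2max k : (k <= n.+1)%N -> L2_fun P (fun w => running_max (s e n ^~ w) k).
  (* the running maximum up to k only involves finitely many square-integrable
     variables *)
  move=> kn; apply: (@L2_fun_le _ _ _ _ _ (fun w => \sum_(j < k.+1) (s e n j w ^+ 2)%:E)%E).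
  - exact: (measurable_wrt_fun (filtration_measurable chain (t := grid n k)) (madapt k kn)).
  - move=> w; elim: k {kn} => [|k IH].
      by rewrite big_ord_recr big_ord0/= add0e expr0n lee_fin sqr_ge0.
    rewrite big_ord_recr/=.
    have [xy|/ltW xy] := leP (running_max (s e n ^~ w) k) (s e n k.+1 w).
      by rewrite leeDr// sume_ge0// => j _; rewrite lee_fin sqr_ge0.
    by apply: (le_trans IH); rewrite leeDl// lee_fin sqr_ge0.
  rewrite ge0_integral_sum//.
  - apply: lte_sum_pinfty => -[j jk] _ /=.
    by case: (L2s j) => //; exact: leq_trans kn.
  - move=> [j jk]; apply/measurable_EFinP; apply: measurable_funX.
    by case: (L2s j) => //; exact: leq_trans kn.
  - by move=> j w _; rewrite lee_fin sqr_ge0.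
have [] := @doob_L2 _ _ _ P (s e n) n.+1.
- by move=> w; rewrite /s /grid mul0r addr0 subrr mulr0.
- exact: L2s.
- move=> k kn; have kn' := ltnW kn.
  have ge1 : grid n k <= grid n k.+1 by exact: grid_le.
  have alg (m p q r : R) : m * (e * (p - r) - e * (q - r)) = (e * m) * (p - q) by ring.
  transitivity (\int[P]_w ((e * running_max (s e n ^~ w) k) * (I (grid n k.+1) w - I (grid n k) w))).
    by apply: eq_Rintegral => w _; exact: alg.
  apply: (ito_orth chain ito) => //.
  + by apply: le_trans bT; exact: grid_leb.
  + by apply: measurable_funM => //; exact: madapt.
  + apply: (@L2_funM_bounded _ _ _ _ _ (cst e) `|e|) => //.
    exact: L2max.
move=> L2n /le_trans h; split => //; apply: h; rewrite ler_wpM2l//.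
rewrite le_eqVlt; apply/orP; left; apply/eqP; apply: eq_Rintegral => w _.
by rewrite /s gridE exprMn e2 mul1r.
Qed.

(** The running maximum bounds a path from above only, hence the two signs. *)
Let G n w := running_max (s 1 n ^~ w) n.+1 ^+ 2 + running_max (s (-1) n ^~ w) n.+1 ^+ 2.

Let G_ge n k w : (k <= n.+1)%N -> (I (grid n k) w - I a w) ^+ 2 <= G n w.
Proof.
move=> kn; have s0 e : s e n 0%N w = 0 by rewrite /s /grid mul0r addr0 subrr mulr0.
have := running_max_ge (s := s 1 n ^~ w) (s0 1) kn.
have := running_max_ge (s := s (-1) n ^~ w) (s0 (-1)) kn.
have := running_max_ge0 (s 1 n ^~ w) n.+1.
have := running_max_ge0 (s (-1) n ^~ w) n.+1.
rewrite /G; move: (running_max (s 1 n ^~ w) n.+1) (running_max (s (-1) n ^~ w) n.+1) => p q.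
rewrite /s; move: (I (grid n k) w) (I a w) => x y.
by move=> p0 q0 h1 h2; have [xy|xy] := leP x y; nra.
Qed.

(** The maxima over finer and finer grids have bounded second moments; their
    lower limit has the same bound by Fatou's lemma, and it dominates every time
    because the paths are right-continuous. A dominating function L is used
    because measurability of the supremum over all times is unclear. *)
Lemma ito_maximal : exists L : Omega -> \bar R, [/\
  measurable_fun setT L, (forall w, 0 <= L w)%E,
  (forall w t, a <= t -> t <= b -> (((I t w - I a w) ^+ 2)%:E <= L w)%E) &
  (\int[P]_w L w <= 8%:E * \int[P]_w ((I b w - I a w) ^+ 2)%:E)%E].
Proof.
have aT : a <= T by rewrite (le_trans (ltW ab)).
have L2I : L2_fun P (fun w => I b w - I a w).
  by apply: L2_funB; apply: (L2_ito chain ito) => //; rewrite (le_trans a0)// ltW.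
have p n := s_max n (expr1n R 2).
have m1 : (-1) ^+ 2 = 1 :> R by rewrite sqrrN expr1n.
have q n := s_max n m1.
have mG n : measurable_fun setT (fun w => (G n w)%:E).
  apply/measurable_EFinP; apply: measurable_funD; apply: measurable_funX.
    by have [[]] := p n.
  by have [[]] := q n.
have G0 n w : 0 <= G n w by rewrite addr_ge0// sqr_ge0.
have EG n : (\int[P]_w (G n w)%:E <= 8%:E * \int[P]_w ((I b w - I a w) ^+ 2)%:E)%E.
  have [L2p ep] := p n; have [L2q eq] := q n.
  rewrite (L2_fun_sqrE L2I); under eq_integral do rewrite EFinD.
  rewrite ge0_integralD//; last 4 first.
  - by move=> w _; rewrite lee_fin sqr_ge0.
  - by apply/measurable_EFinP; apply: measurable_funX; case: L2p.
  - by move=> w _; rewrite lee_fin sqr_ge0.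
  - by apply/measurable_EFinP; apply: measurable_funX; case: L2q.
  rewrite (L2_fun_sqrE L2p) (L2_fun_sqrE L2q) -EFinD -EFinM lee_fin.
  move: ep eq; move: (Rintegral _ _ _) (Rintegral _ _ _) (Rintegral _ _ _) => x y z; lra.
exists (fun w => limn_einf (fun n => (G n w)%:E)); split.
- under eq_fun do rewrite limn_einf_lim.
  apply: (emeasurable_fun_cvg (fun n w => einfs (fun m => (G m w)%:E) n)).
    by move=> n; exact: measurable_fun_einfs.
  by move=> w _; exact: is_cvg_einfs.
- by move=> w; apply: (@cvg_le_limn_einf _ _ (cst 0%E)); [exact: cvg_cst|move=> n; rewrite lee_fin].
- move=> w t at_; rewrite le_eqVlt => /predU1P[->|tb].
    apply: (@cvg_le_limn_einf _ _ (cst ((I b w - I a w) ^+ 2)%:E)); first exact: cvg_cst.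
    by move=> n; rewrite lee_fin -(gridE n); exact: G_ge.
  (* grid points decreasing to t from the right *)
  have h0 n : 0 < (b - a) / n.+1%:R by rewrite divr_gt0// subr_gt0.
  pose k n := (Num.truncn ((t - a) / ((b - a) / n.+1%:R))).+1.
  have kE n : (k n).-1%:R * ((b - a) / n.+1%:R) <= t - a < (k n)%:R * ((b - a) / n.+1%:R).
    have x0 : 0 <= (t - a) / ((b - a) / n.+1%:R).
      by rewrite divr_ge0 ?subr_ge0// ltW.
    by have := truncn_itv x0; rewrite ler_pdivlMr// ltr_pdivrMr.
  have kn n : (k n <= n.+1)%N.
    have /andP[k1 _] := kE n; rewrite -(ltn_predK (ltn0Sn _ : 0 < k n)%N).
    rewrite -(@ltr_nat R) -(ltr_pM2r (h0 n)) (le_lt_trans k1)//.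
    have nz : n.+1%:R != 0 :> R by [].
    by rewrite mulrC mulfVK// ltrD2r.
  have rI : (fun x => (I x w - I a w) ^+ 2) x @[x --> t^'+] --> (I t w - I a w) ^+ 2.
    have [_ /(_ w)[+ _] _] := ito => /(_ t (le_trans a0 at_)).
    rewrite lte_fin => /(_ (lt_le_trans tb bT)) It.
    have Ita := cvgB It (cvg_cst (I a w)).
    by under eq_fun do rewrite expr2; rewrite expr2; apply: cvgM; exact: Ita.
  move/cvg_at_rightP : rI => rI.
  apply: (@cvg_le_limn_einf _ _ (fun n => ((I (grid n (k n)) w - I a w) ^+ 2)%:E)); last first.
    by move=> n; rewrite lee_fin; exact: G_ge.
  apply: cvg_EFin; first exact: nearW.
  apply: (rI (fun n => grid n (k n))); split.
    by move=> n; have /andP[_ k2] := kE n; rewrite /grid -ltrBlDl.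
  apply: (@squeeze_cvgr _ _ _ _ (cst t) (fun n => t + (b - a) * n.+1%:R^-1)).
  + apply: nearW => n; have /andP[k1 k2] := kE n; rewrite /grid /=.
    rewrite -lerBlDl (ltW k2)/= -lerBrDl -[(k n)%:R]natr1 mulrDl mul1r.
    by rewrite addrAC lerD2r.
  + exact: cvg_cst.
  + rewrite (_ : nbhs t = nbhs (t + (b - a) * 0)); last by rewrite mulr0 addr0.
    by apply: cvgD; [exact: cvg_cst|apply: cvgM; [exact: cvg_cst|exact: cvg_harmonic]].
- apply: le_trans (fatou P measurableT mG _) _ => [n w _|]; first by rewrite lee_fin.
  exact: limn_einf_le.
Qed.

End ito_maximal.

(** * Estimates along a path *)

Section deterministic_estimates.
Context {R : realType}.
Local Notation leb := (@lebesgue_measure R).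

(** One-sided limits bound the path near every point; the interval is compact. *)
Lemma rcll_bounded (T : R) (y : R -> R) : rcll T%:E (y : R -> R) ->
  exists M, forall t, 0 <= t -> t <= T -> `|y t| <= M.
Proof.
move=> [yr yl].
have /compact_near_coveringP := @segment_compact R 0 T.
move=> /(_ R +oo%R (fun M t => 0 <= t -> t <= T -> `|y t| <= M) _) cov.
have : \forall M \near +oo, `[0, T] `<=` (fun t => 0 <= t -> t <= T -> `|y t| <= M).
  apply: cov => x; rewrite /= in_itv/= => /andP[x0 xT].
  have [e1 e10 [C1 right]] : exists2 e, 0 < e & exists C, forall s, x < s ->
      s - x < e -> s <= T -> `|y s| <= C.
    have [xT'|Tx] := ltP x T; last first.
      by exists 1 => //; exists 0 => s xs _ sT; have := le_lt_trans Tx (lt_le_trans xs sT); rewrite ltxx.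
    have /cvgrPdist_lt /(_ 1 ltr01) [e /= e0 near_] := yr x x0 xT'.
    exists e => //; exists (`|y x| + 1) => s xs se _.
    have : `|y x - y s| < 1.
      by apply: near_ => //=; rewrite distrC ger0_norm// subr_ge0 ltW.
    move=> /ltW; rewrite distrC => h.
    by rewrite -[y s](subrK (y x)) addrC (le_trans (ler_normD _ _))// lerD2l.
  have [e2 e20 [C2 left]] : exists2 e, 0 < e & exists C, forall s, s < x ->
      x - s < e -> 0 <= s -> `|y s| <= C.
    have [x0'|xl0] := ltP 0 x; last first.
      by exists 1 => //; exists 0 => s sx _ s0; have := le_lt_trans s0 (lt_le_trans sx xl0); rewrite ltxx.
    have /cvg_ex[l] := yl x x0' xT.
    move=> /cvgrPdist_lt /(_ 1 ltr01) [e /= e0 near_].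
    exists e => //; exists (`|l| + 1) => s sx se _.
    have : `|l - y s| < 1.
      by apply: near_ => //=; rewrite ger0_norm// subr_ge0 ltW.
    move=> /ltW; rewrite distrC => h.
    by rewrite -[y s](subrK l) addrC (le_trans (ler_normD _ _))// lerD2l.
  exists (ball x (Num.min e1 e2), [set M | Num.max `|y x| (Num.max C1 C2) <= M]).
    split => /=; first by apply: nbhsx_ballx; rewrite lt_min e10.
    by apply: nbhs_pinfty_ge; rewrite num_real.
  move=> [s M] [/= xs]; rewrite !ge_max => /andP[M1 /andP[M2 M3]] s0 sT.
  move: xs; rewrite /ball/= lt_min => /andP[se1 se2].
  have [sx|xs|->//] := ltgtP s x.
    by apply: le_trans M3; apply: left => //; rewrite ger0_norm in se2; rewrite // subr_ge0 ltW.
  by apply: le_trans M2; apply: right => //; rewrite distrC ger0_norm in se1; rewrite // subr_ge0 ltW.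
move=> /filter_ex[M h]; exists M => t t0 tT.
by apply: h => //=; rewrite in_itv/= t0.
Qed.

(** Applied to the supremum m of |y|, the hypothesis reads m <= B + m / 2. That m
    is finite is what allows the last term to be absorbed. *)
Lemma absorb_sup (y : R -> R) (a b B k : R) : a <= b -> k <= 2^-1 ->
  (exists M, forall t, a <= t -> t <= b -> `|y t| <= M) ->
  (forall m, (forall t, a <= t -> t <= b -> `|y t| <= m) ->
     forall t, a <= t -> t <= b -> `|y t| <= B + k * m) ->
  forall t, a <= t -> t <= b -> `|y t| <= 2 * B.
Proof.
move=> ab k2 [M yM] self t at_ tb.
pose S := [set `|y u| | u in `[a, b]].
have supS : has_sup S.
  split; first by exists `|y a|; exists a => //=; rewrite in_itv/= lexx.
  by exists M => _ [u /= uab <-]; move: uab; rewrite in_itv/= => /andP[? ?]; exact: yM.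
have leS u : a <= u -> u <= b -> `|y u| <= sup S.
  move=> au ub; apply: sup_upper_bound => //; exists u => //=.
  by rewrite in_itv/= au.
have S0 : 0 <= sup S by exact: le_trans (leS t at_ tb).
have : sup S <= B + k * sup S.
  apply: ge_sup; first by case: supS.
  move=> _ [u /= uab <-]; move: uab; rewrite in_itv/= => /andP[au ub].
  exact: (self _ leS u au ub).
have := leS t at_ tb; move: (sup S) S0 => s s0; nra.
Qed.

Lemma time_cauchy_schwarz (p : R -> R) (a b : R) : a < b ->
  measurable_fun `[a, b] p ->
  leb.-integrable `[a, b] (EFin \o (fun s => p s ^+ 2)) ->
  leb.-integrable `[a, b] (EFin \o p) /\
  (\int[leb]_(s in `[a, b]) p s) ^+ 2 <= (b - a) * \int[leb]_(s in `[a, b]) (p s ^+ 2).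
Proof.
move=> ab mp ip2; have h0 : 0 < b - a by rewrite subr_gt0.
have icst (c : R) : leb.-integrable `[a, b] (EFin \o cst c).
  by apply: (@integrable_itv_bounded _ _ _ _ `|c|).
have icD (c : R) : leb.-integrable `[a, b] (EFin \o (fun s => p s ^+ 2 + c)).
  exact: (integrableD _ ip2 (icst c)).
have ip : leb.-integrable `[a, b] (EFin \o p).
  apply: le_integrable (icD 1) => //; first exact/measurable_EFinP.
  move=> s _; rewrite lee_fin [leRHS]ger0_norm ?addr_ge0 ?sqr_ge0// ler_norml.
  by apply/andP; split; nra.
split => //; set x := \int[leb]_(s in `[a, b]) p s; set q := \int[leb]_(s in `[a, b]) _.
pose c := x / (b - a).
have : 2 * c * x <= q + c ^+ 2 * (b - a).
  rewrite -(RintegralZl _ _ ip)//.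
  have -> : c ^+ 2 * (b - a) = \int[leb]_(s in `[a, b]) (cst (c ^+ 2) s).
    rewrite Rintegral_cst//; congr (_ * _).
    by rewrite -[LHS]/(fine (b - a)%:E); congr fine; exact/esym/lebesgue_itv_cc/ltW.
  rewrite -(RintegralD _ ip2 (icst _))//; apply: le_Rintegral => //.
  - exact: (integrableZl _ (2 * c) ip).
  - exact: (icD (c ^+ 2)).
  - by move=> s _; rewrite /cst; have := sqr_ge0 (p s - c); nra.
have -> : c ^+ 2 * (b - a) = c * x by rewrite /c; field; rewrite gt_eqF.
have cx : c * x * (b - a) = x ^+ 2 by rewrite /c; field; rewrite gt_eqF.
move=> h; have {}h : c * x <= q by lra.
by rewrite -cx mulrC ler_wpM2l// ltW.
Qed.

End deterministic_estimates.

(** * Measurability of the driver *)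

Section predictable.
Context {R : realType} {d : measure_display} {Omega : measurableType d}.
Variables (P : probability Omega R) (N : nat).
Variables (X : R -> Omega -> 'cV[R]_N) (A : R -> 'M[R]_N).
Hypothesis chain : markov_chain P X A.
Local Notation Ft := (completed_natural_filtration P X).
Local Notation pred_space := (g_sigma_algebraType (predictable_gen Ft)).
Variable T : R.
Hypothesis T0 : 0 < T.

Lemma predictable_measurable : <<s predictable_gen Ft>> `<=` @measurable _ (Omega * R)%type.
Proof.
apply: smallest_sub; first exact: sigma_algebra_measurable.
have FM t G : Ft t G -> measurable G.
  by move=> FG; apply: (filtration_measurable chain (t := t)); rewrite filtration_sigma.
move=> E [[G FG ->]|[s [t [G [s0 st FG ->]]]]].
  by apply: measurableX => //; exact: FM FG.
by apply: measurableX => //; exact: FM FG.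
Qed.

Lemma strip_predictable : <<s predictable_gen Ft>> (strip 0 T : set (Omega * R)).
Proof.
have FT t : Ft t setT.
  by rewrite -filtration_sigma; exact: (@measurableT _ (g_sigma_algebraType (Ft t))).
have -> : strip 0 T = (setT `*` [set 0]) `|` (setT `*` `]0, T]) :> set (Omega * R).
  apply/seteqP; split => [[w t] [_ /=]|[w t] [[_ /= ->]|[_ /=]]].
  - rewrite in_itv/= => /andP[+ tT]; rewrite le_eqVlt => /predU1P[<-|t0]; first by left.
    by right; split => //=; rewrite in_itv/= t0.
  - by split => //=; rewrite in_itv/= lexx ltW.
  - by rewrite in_itv/= => /andP[t0 tT]; split => //=; rewrite in_itv/= ltW.
apply: (@measurableU _ pred_space); apply: sub_sigma_algebra.
  by left; exists setT.
by right; exists 0, T, setT; split.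
Qed.

Lemma predictable_strip d' (V : measurableType d') (z : Omega * R -> V) :
  measurable_wrt (predictable_gen Ft) (setT `*` `[0, T]) z ->
  measurable_fun (strip 0 T : set (Omega * R)) z.
Proof.
move=> mz _ B mB; apply: predictable_measurable.
exact: (mz strip_predictable B mB).
Qed.

Lemma measurable_fun_pair_on d0 d1 d2 (S : measurableType d0)
    (S1 : measurableType d1) (S2 : measurableType d2) (D : set S)
    (p : S -> S1) (q : S -> S2) :
  measurable_fun D p -> measurable_fun D q -> measurable_fun D (fun x => (p x, q x)).
Proof.
move=> mp mq mD; apply: (measurability _ (measurable_prod_measurableType S1 S2)) => //.
move=> _ [_ [B1 mB1 [B2 mB2 <-]] <-].
rewrite (_ : _ `&` _ = (D `&` p @^-1` B1) `&` (D `&` q @^-1` B2)); last first.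
  by apply/seteqP; split => [x [Dx [? ?]]|x [[Dx ?] [_ ?]]].
by apply: measurableI; [exact: mp|exact: mq].
Qed.

(** The predictable sigma-algebra is coarser than the product one, so the
    composition with jointly measurable processes is jointly measurable. *)
Lemma driver_strip (f : Omega -> R -> R -> 'cV[R]_N -> R) (y : R -> Omega -> R)
    (z : R -> Omega -> 'cV[R]_N) : driver_measurable P X T f ->
  measurable_fun (strip 0 T) (fun p : Omega * R => y p.2 p.1) ->
  measurable_fun (strip 0 T) (fun p : Omega * R => z p.2 p.1 : borel_vec R N) ->
  measurable_fun (strip 0 T) (fun p : Omega * R => f p.1 p.2 (y p.2 p.1) (z p.2 p.1)).
Proof.
move=> mf my mz.
pose h (p : Omega * R) : pred_space * R * borel_vec R N :=
  ((p : pred_space, y p.2 p.1), z p.2 p.1).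
have mh : measurable_fun (strip 0 T : set (Omega * R)) h.
  apply: measurable_fun_pair_on => //; apply: measurable_fun_pair_on => //.
  move=> _ B mB; apply: measurableI; first exact: measurable_strip.
  exact: predictable_measurable.
pose D3 : set (pred_space * R * borel_vec R N) := [set x | 0 <= x.1.1.2 <= T].
have mD3 : measurable D3.
  rewrite (_ : D3 = setT `&` (fst \o fst) @^-1` (strip 0 T)).
    by apply: (measurableT_comp measurable_fst measurable_fst) => //; exact: strip_predictable.
  apply/seteqP; split => [x /= h0|x [_ [_ /=]]]; last by rewrite in_itv.
  by split => //; split => //=; rewrite in_itv.
have sub : h @` strip 0 T `<=` D3.
  by move=> _ [[w t] [_ /= tT] <-]; move: tT; rewrite /D3/= in_itv.
exact: (measurable_comp mD3 sub mf mh).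
Qed.

End predictable.

(** * The equation over a short interval *)

Section bsde.
Context {R : realType} {d : measure_display} {Omega : measurableType d}.
Variables (P : probability Omega R) (N : nat).
Variables (X : R -> Omega -> 'cV[R]_N) (A : R -> 'M[R]_N).
Hypothesis chain : markov_chain P X A.
Local Notation leb := (@lebesgue_measure R).
Local Notation Ft := (completed_natural_filtration P X).
Variables (T c' c'' : R).
Hypotheses (T0 : 0 < T) (c'0 : 0 < c') (c''0 : 0 < c'').
Variables (xi : Omega -> R) (f : Omega -> R -> R -> 'cV[R]_N -> R)
  (Y : R -> Omega -> R) (Z : R -> Omega -> 'cV[R]_N) (I : R -> Omega -> R).
Hypotheses (mf : driver_measurable P X T f)
  (f_lip : forall w t v1 v2 z1 z2, 0 <= t -> t <= T ->
     `|f w t v1 z1 - f w t v2 z2|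
       <= c' * `|v1 - v2| + c'' * seminorm X A t w (z1 - z2))
  (f_sqr : (\int[P]_w \int[leb]_(t in `[0%R, T])
     (`|f w t 0 0 ^+ 2|)%:E < +oo)%E)
  (Y_proc : L2_proc P X T Y) (Z_proc : P2_proc P X A T Z)
  (ito : ito_integral P X A T Z I)
  (eqn : {ae P, forall w, forall t, 0 <= t -> t <= T ->
     Y t w = xi w + \int[leb]_(s in `[t, T]) f w s (Y s w) (Z s w)
             - (I T w - I t w)}).

Let z s w := seminorm X A s w (Z s w).
Let f0 s w := f w s 0 0.
Let g s w := f w s (Y s w) (Z s w).

Let z_ge0 s w : 0 <= z s w. Proof. exact: sqrtr_ge0. Qed.

Let mZ i : measurable_fun (strip 0 T) (fun p : Omega * R => Z p.2 p.1 i 0).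
Proof.
have [mZ _] := Z_proc.
apply: (@measurable_fun_coord _ _ _ (Omega * R)%type (strip 0 T) (fun p => Z p.2 p.1)).
exact: (predictable_strip chain T0 mZ).
Qed.

Let mz2 : measurable_fun (strip 0 T) (fun p : Omega * R => z p.2 p.1 ^+ 2).
Proof. by apply: (seminorm_strip chain) => //; exact: ltW. Qed.

Let mz : measurable_fun (strip 0 T) (fun p : Omega * R => z p.2 p.1).
Proof.
rewrite (_ : (fun p => _) = fun p : Omega * R => Num.sqrt (z p.2 p.1 ^+ 2)).
  apply: (@measurableT_comp _ _ _ _ _ _ (@Num.sqrt R)) => //.
  by apply: continuous_measurable_fun; exact: sqrt_continuous.
by apply/funext => p; rewrite sqrtr_sqr ger0_norm.
Qed.

Let mY_at t : 0 <= t -> t <= T -> measurable_fun setT (Y t).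
Proof.
case: Y_proc => mY _ _ t0 tT.
exact: (measurable_wrt_fun (filtration_measurable chain (t := t)) (mY t t0 tT)).
Qed.

Let mY : measurable_fun (strip 0 T) (fun p : Omega * R => Y p.2 p.1).
Proof.
apply: measurable_right_process => //; first exact: ltW.
move=> w t t0 tT; have [_ /(_ w)[+ _] _] := Y_proc => /(_ t t0); apply.
by rewrite lte_fin.
Qed.

Let mg : measurable_fun (strip 0 T) (fun p : Omega * R => g p.2 p.1).
Proof.
apply: (driver_strip chain T0 mf mY); have [mZ' _] := Z_proc.
exact: (predictable_strip chain T0 mZ').
Qed.

Let mf0 : measurable_fun (strip 0 T) (fun p : Omega * R => f0 p.2 p.1).
Proof.
apply: (driver_strip chain T0 (y := fun _ _ => 0) (z := fun _ _ => 0) mf).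
  exact: measurable_cst.
exact: measurable_cst.
Qed.

Let g_le s w : 0 <= s -> s <= T -> `|g s w| <= `|f0 s w| + c' * `|Y s w| + c'' * z s w.
Proof.
move=> s0 sT; have := f_lip w (Y s w) 0 (Z s w) 0 s0 sT.
rewrite !subr0 -/(g s w) -/(f0 s w) -/(z s w) => h.
rewrite -[g s w](subrK (f0 s w)) addrC -addrA (le_trans (ler_normD _ _))//.
by rewrite lerD2l.
Qed.

(** The paths along which all the integrals of the equation converge. *)
Definition regular_path w :=
  [/\ forall t, 0 <= t -> t <= T ->
        Y t w = xi w + \int[leb]_(s in `[t, T]) g s w - (I T w - I t w),
      leb.-integrable `[0, T] (EFin \o (fun s => z s w ^+ 2)) &
      leb.-integrable `[0, T] (EFin \o (fun s => f0 s w ^+ 2))].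

Lemma ae_regular_path : {ae P, forall w, regular_path w}.
Proof.
have fin (h : R -> Omega -> R) : measurable_fun (strip 0 T) (fun p : Omega * R => h p.2 p.1) ->
    (\int[P]_w \int[leb]_(s in `[0%R, T]) (h s w ^+ 2)%:E < +oo)%E ->
    {ae P, forall w, leb.-integrable `[0, T] (EFin \o (fun s => h s w ^+ 2))}.
  move=> mh hoo; have h0 s w : (0 <= (h s w ^+ 2)%:E)%E by rewrite lee_fin sqr_ge0.
  have mh2 : measurable_fun (strip 0 T) (fun p : Omega * R => (h p.2 p.1 ^+ 2)%:E).
    by apply/measurable_EFinP; exact: measurable_funX.
  have mi := measurable_time_integral (g := fun s w => (h s w ^+ 2)%:E) mh2 h0.
  have i0 w : (0 <= \int[leb]_(s in `[0%R, T]) (h s w ^+ 2)%:E)%E by exact: integral_ge0.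
  have ii : P.-integrable setT (fun w => \int[leb]_(s in `[0%R, T]) (h s w ^+ 2)%:E)%E.
    apply/integrableP; split => //.
    by under eq_integral do rewrite gee0_abs//.
  have [E [mE E0 sE]] := integrable_ae measurableT ii; exists E; split => // w nw.
  apply: sE => fw; apply: nw; apply/integrableP; split.
    apply/measurable_EFinP; apply: (@measurable_strip_section _ _ _ (fun s w => h s w ^+ 2)).
    exact: measurable_funX.
  under eq_integral do rewrite /= ger0_norm ?sqr_ge0//.
  by rewrite ltey_eq (fw Logic.I).
have [_ Zoo] := Z_proc.
have f0oo : (\int[P]_w \int[leb]_(s in `[0%R, T]) (f0 s w ^+ 2)%:E < +oo)%E.
  apply: le_lt_trans f_sqr; rewrite le_eqVlt; apply/orP; left; apply/eqP.
  apply: eq_integral => w _; apply: eq_integral => s _.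
  by rewrite ger0_norm ?sqr_ge0.
apply: (ae_impl _ (ae_and eqn (ae_and (fin z mz Zoo) (fin f0 mf0 f0oo)))) => w.
by move=> [? [? ?]]; split.
Qed.

Section path.
Variable w : Omega.
Hypothesis reg : regular_path w.

Let sec (h : R -> Omega -> R) s t : 0 <= s -> t <= T ->
  measurable_fun (strip 0 T) (fun p : Omega * R => h p.2 p.1) ->
  measurable_fun `[s, t] (h ^~ w).
Proof.
by move=> s0 tT mh; apply: measurable_strip_section; exact: measurable_stripS mh.
Qed.

Let iS (h : R -> R) s t : 0 <= s -> t <= T -> leb.-integrable `[0, T] (EFin \o h) ->
  leb.-integrable `[s, t] (EFin \o h).
Proof.
move=> s0 tT; apply: integrableS => // u; rewrite /= !in_itv/= => /andP[su ut].
by rewrite (le_trans s0)//= (le_trans ut).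
Qed.

Lemma integrable_z : leb.-integrable `[0, T] (EFin \o (z ^~ w)).
Proof.
by case: reg => _ iz _; case: (time_cauchy_schwarz T0 (sec (lexx 0) (lexx T) mz) iz).
Qed.

Lemma integrable_f0 : leb.-integrable `[0, T] (EFin \o (fun s => `|f0 s w|)).
Proof.
case: reg => _ _ if0; apply: integrable_norm.
by case: (time_cauchy_schwarz T0 (sec (lexx 0) (lexx T) mf0) if0).
Qed.

Let bound m := fun s => `|f0 s w| + c'' * z s w + m.

Let i_bound m s t : 0 <= s -> t <= T -> leb.-integrable `[s, t] (EFin \o bound m).
Proof.
move=> s0 tT; apply: iS => //.
have icst : leb.-integrable `[0, T] (EFin \o cst m).
  by apply: (@integrable_itv_bounded _ _ _ _ `|m|).
have icz : leb.-integrable `[0, T] (EFin \o (fun s => c'' * z s w)).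
  exact: (integrableZl _ c'' integrable_z).
have ifz : leb.-integrable `[0, T] (EFin \o (fun s => `|f0 s w| + c'' * z s w)).
  exact: (integrableD _ integrable_f0 icz).
exact: (integrableD _ ifz icst).
Qed.

Let g_bound m s : 0 <= s -> s <= T -> `|Y s w| <= m -> `|g s w| <= bound (c' * m) s.
Proof.
move=> s0 sT Ym; apply: le_trans (g_le w s0 sT) _; rewrite /bound addrAC.
by rewrite lerD2l ler_wpM2l// ltW.
Qed.

Lemma integrable_g : leb.-integrable `[0, T] (EFin \o (g ^~ w)).
Proof.
have [_ /(_ w) Yrcll _] := Y_proc; have [M YM] := rcll_bounded Yrcll.
apply: le_integrable (i_bound (c' * M) (lexx 0) (lexx T)) => //.
  by apply/measurable_EFinP; exact: sec mg.
move=> s; rewrite /= in_itv/= => /andP[s0 sT]; rewrite lee_fin.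
by apply: le_trans (g_bound s0 sT (YM s s0 sT)) _; exact: ler_norm.
Qed.

(** The equation between the times t and b: the terminal data at T drop out. *)
Lemma Y_increment t b : 0 <= t -> t <= b -> b <= T ->
  Y t w = Y b w + \int[leb]_(s in `[t, b]) g s w - (I b w - I t w).
Proof.
move=> t0 tb bT; case: reg => e _ _.
rewrite (e t t0 (le_trans tb bT)) (e b (le_trans t0 tb) bT).
rewrite (Rintegral_itv_add tb bT (iS t0 (lexx T) integrable_g)); lra.
Qed.

(** The Lipschitz condition compares the driver with its value at 0; the part
    that depends on Y carries the length of the interval as a factor. *)
Lemma driver_integral_le a t b m : 0 <= a -> a <= t -> t <= b -> b <= T ->
  (forall s, a <= s -> s <= b -> `|Y s w| <= m) ->
  `|\int[leb]_(s in `[t, b]) g s w| <=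
  \int[leb]_(s in `[0, T]) `|f0 s w| + c'' * \int[leb]_(s in `[a, b]) z s w
  + c' * (b - a) * m.
Proof.
move=> a0 at_ tb bT Ym; have t0 := le_trans a0 at_; have b0 := le_trans t0 tb.
have m0 : 0 <= m by apply: le_trans (Ym t at_ tb).
have itg := iS t0 bT integrable_g.
apply: (le_trans (le_normr_Rintegral _ itg)) => //.
apply: (@le_trans _ _ (\int[leb]_(s in `[t, b]) bound (c' * m) s)).
  apply: le_Rintegral => //; [exact: integrable_norm|exact: i_bound|].
  move=> s; rewrite /= in_itv/= => /andP[ts sb].
  apply: g_bound; [exact: le_trans ts|exact: le_trans bT|].
  by apply: Ym => //; exact: le_trans ts.
have if0 s u : 0 <= s -> u <= T -> leb.-integrable `[s, u] (EFin \o (fun s => `|f0 s w|)).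
  by move=> s0 uT; apply: iS => //; exact: integrable_f0.
have iz s u : 0 <= s -> u <= T -> leb.-integrable `[s, u] (EFin \o (z ^~ w)).
  by move=> s0 uT; apply: iS => //; exact: integrable_z.
have icz : leb.-integrable `[t, b] (EFin \o (fun s => c'' * z s w)).
  exact: (integrableZl _ c'' (iz t b t0 bT)).
have icst : leb.-integrable `[t, b] (EFin \o cst (c' * m)).
  by apply: (@integrable_itv_bounded _ _ _ _ `|c' * m|).
have ifz : leb.-integrable `[t, b] (EFin \o (fun s => `|f0 s w| + c'' * z s w)).
  exact: (integrableD _ (if0 t b t0 bT) icz).
rewrite /bound (RintegralD _ ifz icst)// (RintegralD _ (if0 t b t0 bT) icz)//.
rewrite (RintegralZl _ _ (iz t b t0 bT))//.
have sub (h : R -> R) s u s' u' : s <= s' -> s' <= u' -> u' <= u ->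
    leb.-integrable `[s, u] (EFin \o h) -> (forall x, 0 <= h x) ->
    \int[leb]_(x in `[s', u']) h x <= \int[leb]_(x in `[s, u]) h x.
  move=> ss su uu ih h0; have su' : s <= u' by exact: le_trans su.
  rewrite (Rintegral_itv_add su' uu ih) (@Rintegral_itv_add _ h s s' u')//; last first.
    apply: integrableS ih => // x; rewrite /= !in_itv/= => /andP[-> xu].
    by rewrite (le_trans xu).
  by rewrite addrAC lerDr addr_ge0// Rintegral_ge0.
apply: lerD; first apply: lerD.
- by apply: sub => //; exact: if0.
- apply: ler_wpM2l; first exact: ltW.
  by apply: (sub (z ^~ w)) => //; exact: iz.
rewrite Rintegral_cst// (_ : fine _ = b - t); last first.
  by rewrite -[RHS]/(fine (b - t)%:E); congr fine; exact: lebesgue_itv_cc.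
rewrite mulrAC; apply: ler_wpM2r => //; apply: ler_wpM2l; first exact: ltW.
by rewrite lerD2l lerN2.
Qed.

End path.

Let F w := (\int[leb]_(s in `[0%R, T]) `|f0 s w|%:E)%E.
Let F0 w := \int[leb]_(s in `[0, T]) `|f0 s w|.

Let mF : measurable_fun setT F.
Proof.
apply: (measurable_time_integral (g := fun s w => `|f0 s w|%:E)) => [|s w]; last by rewrite lee_fin.
by apply/measurable_EFinP; apply: measurableT_comp mf0.
Qed.

Let F_ge0 w : (0 <= F w)%E. Proof. exact: integral_ge0. Qed.

Let F_sqr_ge0 w : (0 <= F w ^+ 2)%E. Proof. by rewrite expe2 mule_ge0. Qed.

Let mF2 : measurable_fun setT (fun w => F w ^+ 2)%E.
Proof. by under eq_fun do rewrite expe2; exact: emeasurable_funM. Qed.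

Let F_fin w : regular_path w -> F w = (F0 w)%:E.
Proof.
move=> reg; rewrite /F0 /Rintegral fineK//.
exact: (integrable_fin_num _ (integrable_f0 reg)).
Qed.

Let sec (h : R -> Omega -> R) s t w : 0 <= s -> t <= T ->
  measurable_fun (strip 0 T) (fun p : Omega * R => h p.2 p.1) ->
  measurable_fun `[s, t] (h ^~ w).
Proof.
by move=> s0 tT mh; apply: measurable_strip_section; exact: measurable_stripS mh.
Qed.

(** The squared time integral is at most T times the integral of the square. *)
Lemma driver_energy_finite : (\int[P]_w (F w ^+ 2) < +oo)%E.
Proof.
pose Q w := (\int[leb]_(s in `[0%R, T]) (f0 s w ^+ 2)%:E)%E.
have mQ : measurable_fun setT Q.
  apply: (measurable_time_integral (g := fun s w => (f0 s w ^+ 2)%:E)) => [|s w]; last by rewrite lee_fin sqr_ge0.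
  by apply/measurable_EFinP; exact: measurable_funX.
have Q0 w : (0 <= Q w)%E by apply: integral_ge0 => s _; rewrite lee_fin sqr_ge0.
have FQ : {ae P, forall w, (F w ^+ 2 <= T%:E * Q w)%E}.
  apply: (ae_impl _ ae_regular_path) => w reg; have [_ _ i2] := reg.
  have i2' : leb.-integrable `[0, T] (EFin \o (fun s => `|f0 s w| ^+ 2)).
    by have := i2; congr (_.-integrable _ _); apply/funext => s /=; rewrite real_normK// num_real.
  rewrite (F_fin reg) /Q.
  have -> : (\int[leb]_(s in `[0%R, T]) (f0 s w ^+ 2)%:E =
      (\int[leb]_(s in `[0, T]) (`|f0 s w| ^+ 2))%:E)%E.
    rewrite /Rintegral fineK; last exact: (integrable_fin_num _ i2').
    by apply: eq_integral => s _; rewrite /= real_normK// num_real.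
  rewrite -EFin_expe -EFinM lee_fin -[X in X * _]subr0.
  apply: (time_cauchy_schwarz (p := fun s => `|f0 s w|) T0 _ _).2.
    exact: (measurableT_comp _ (sec w (lexx 0) (lexx T) mf0)).
  exact: i2'.
apply: (@le_lt_trans _ _ (\int[P]_w (T%:E * Q w))%E).
  apply: ae_ge0_le_integral => //.
  - by move=> w _; rewrite mule_ge0// lee_fin ltW.
  - by apply: emeasurable_funM.
  - by apply: (ae_impl _ FQ) => w ?.
rewrite ge0_integralZl//; last by rewrite lee_fin ltW.
rewrite lte_mul_pinfty// ?lee_fin ?ltW//.
apply: le_lt_trans f_sqr; rewrite le_eqVlt; apply/orP; left; apply/eqP.
apply: eq_integral => w _; apply: eq_integral => s _.
by rewrite ger0_norm ?sqr_ge0.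
Qed.

Section step.
Variables (a b : R).
Hypotheses (a0 : 0 <= a) (ab : a < b) (bT : b <= T)
  (small' : c' * (b - a) <= 128^-1) (small'' : c'' ^+ 2 * (b - a) <= 128^-1).

Let q0 w := \int[leb]_(s in `[a, b]) (z s w ^+ 2).

Let zeta_sqr w : regular_path w ->
  (c'' * \int[leb]_(s in `[a, b]) z s w) ^+ 2 <= c'' ^+ 2 * (b - a) * q0 w.
Proof.
move=> reg; rewrite exprMn -mulrA ler_wpM2l ?sqr_ge0//.
apply: (time_cauchy_schwarz ab (sec w a0 bT mz) _).2.
case: reg => _ iz _; apply: integrableS iz => // s; rewrite /= !in_itv/= => /andP[sa sb].
by rewrite (le_trans a0)//= (le_trans sb).
Qed.

Let sqr4 (x y u v : R) : (x + y + u + v) ^+ 2 <= 4 * (x ^+ 2 + y ^+ 2 + u ^+ 2 + v ^+ 2).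
Proof.
have := sqr_ge0 (x - y); have := sqr_ge0 (x - u); have := sqr_ge0 (x - v).
have := sqr_ge0 (y - u); have := sqr_ge0 (y - v); have := sqr_ge0 (u - v); lra.
Qed.

Let U0 w := Y b w ^+ 2 + F0 w ^+ 2 + c'' ^+ 2 * (b - a) * q0 w.

(** Y_t differs from Y_b by the integral of the driver and by the increment
    I_b - I_t. The driver reproduces at most half of the supremum of |Y|, which
    is absorbed. *)
Lemma Y_path_bound w l : regular_path w ->
  (forall t, a <= t -> t <= b -> (I t w - I a w) ^+ 2 <= l) ->
  forall t, a <= t -> t <= b ->
  Y t w ^+ 2 <= 16 * (U0 w + (2 * (I b w - I a w) ^+ 2 + 2 * l)).
Proof.
move=> reg Il t at_ tb.
have l0 : 0 <= l by apply: le_trans (Il a (lexx a) (ltW ab)); exact: sqr_ge0.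
pose L2 := 2 * (I b w - I a w) ^+ 2 + 2 * l.
have L20 : 0 <= L2 by rewrite addr_ge0// mulr_ge0// sqr_ge0.
pose zeta := c'' * \int[leb]_(s in `[a, b]) z s w.
pose B := `|Y b w| + F0 w + zeta + Num.sqrt L2.
have k2 : c' * (b - a) <= 2^-1 by apply: le_trans small' _; lra.
have Ybd : exists M, forall u, a <= u -> u <= b -> `|Y u w| <= M.
  have [_ /(_ w) Yrcll _] := Y_proc; have [M YM] := rcll_bounded Yrcll.
  by exists M => u au ub; apply: YM; [exact: le_trans au|exact: le_trans bT].
have self m : (forall u, a <= u -> u <= b -> `|Y u w| <= m) ->
    forall u, a <= u -> u <= b -> `|Y u w| <= B + c' * (b - a) * m.
  move=> Ym u au ub; rewrite (Y_increment reg (le_trans a0 au) ub bT).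
  have gi := driver_integral_le reg a0 au ub bT Ym.
  have Ii : `|I b w - I u w| <= Num.sqrt L2.
    rewrite -sqrtr_sqr ler_sqrt// /L2.
    have := Il u au ub; move: (I b w) (I u w) (I a w) => x y v h.
    by have := sqr_ge0 ((x - v) + (y - v)); lra.
  rewrite (le_trans (ler_normB _ _))// (le_trans (lerD (ler_normD _ _) (lexx _)))//.
  move: gi Ii; rewrite /B /F0 /zeta.
  move: `|Y b w| `|I b w - I u w| (Num.sqrt L2) `|_| (Rintegral _ _ _) (c'' * _) (c' * _ * _).
  by move=> *; lra.
have := absorb_sup (ltW ab) k2 Ybd self at_ tb => YB.
have B0 : 0 <= 2 * B by exact: le_trans YB.
have : `|Y t w| ^+ 2 <= (2 * B) ^+ 2 by rewrite lerXn2r ?nnegrE.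
rewrite real_normK ?num_real// => /le_trans; apply.
have := sqr4 `|Y b w| (F0 w) zeta (Num.sqrt L2).
rewrite -/B real_normK ?num_real// sqr_sqrtr//.
have := zeta_sqr reg; rewrite -/zeta /U0 -/L2.
move: (zeta ^+ 2) (c'' ^+ 2 * _ * _) (Y b w ^+ 2) (F0 w ^+ 2) => *.
by rewrite exprMn; lra.
Qed.

(** The sum on the left equals Y_b plus the integral of the driver: the stochastic
    integral cancels. This is what makes its variance accessible, since Y_a is
    orthogonal to I_b - I_a. *)
Lemma terminal_path_bound w m : regular_path w ->
  (forall t, a <= t -> t <= b -> `|Y t w| <= m) ->
  (I b w - I a w + Y a w) ^+ 2 <= 4 * (U0 w + (c' * (b - a)) ^+ 2 * m ^+ 2).
Proof.
move=> reg Ym.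
have -> : I b w - I a w + Y a w = Y b w + \int[leb]_(s in `[a, b]) g s w.
  by rewrite (Y_increment reg a0 (ltW ab) bT); ring.
have gi := driver_integral_le reg a0 (lexx a) (ltW ab) bT Ym.
pose zeta := c'' * \int[leb]_(s in `[a, b]) z s w.
have m0 : 0 <= m by exact: le_trans (Ym a (lexx a) (ltW ab)).
have F00 : 0 <= F0 w by apply: Rintegral_ge0.
have z0 : 0 <= zeta.
  by rewrite mulr_ge0 ?(ltW c''0)//; apply: Rintegral_ge0.
have k0 : 0 <= c' * (b - a) * m by rewrite !mulr_ge0 ?(ltW c'0)// subr_ge0 ltW.
have le1 : `|Y b w + \int[leb]_(s in `[a, b]) g s w| <=
    `|Y b w| + F0 w + zeta + c' * (b - a) * m.
  by rewrite (le_trans (ler_normD _ _))// -!addrA lerD2l !addrA.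
have : `|Y b w + \int[leb]_(s in `[a, b]) g s w| ^+ 2 <=
    (`|Y b w| + F0 w + zeta + c' * (b - a) * m) ^+ 2.
  by rewrite lerXn2r ?nnegrE// !addr_ge0.
rewrite real_normK ?num_real// => /le_trans; apply.
have := sqr4 `|Y b w| (F0 w) zeta (c' * (b - a) * m).
rewrite real_normK ?num_real// => /le_trans; apply.
have := zeta_sqr reg; rewrite -/zeta /U0 [(c' * (b - a) * m) ^+ 2]exprMn.
move: (zeta ^+ 2) (c'' ^+ 2 * _ * _) (Y b w ^+ 2) (F0 w ^+ 2) (_ ^+ 2 * m ^+ 2) => *.
lra.
Qed.

Let q w := (\int[leb]_(s in `[a, b]) (z s w ^+ 2)%:E)%E.
Let U w := ((Y b w ^+ 2)%:E + F w ^+ 2 + (c'' ^+ 2 * (b - a))%:E * q w)%E.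

Let mq : measurable_fun setT q.
Proof.
apply: (measurable_time_integral (g := fun s w => (z s w ^+ 2)%:E)) => [|s w]; last by rewrite lee_fin sqr_ge0.
by apply/measurable_EFinP; exact: measurable_stripS mz2.
Qed.

Let q_ge0 w : (0 <= q w)%E.
Proof. by apply: integral_ge0 => s _; rewrite lee_fin sqr_ge0. Qed.

Let h_ge0 : 0 <= c'' ^+ 2 * (b - a).
Proof. by rewrite mulr_ge0 ?sqr_ge0// subr_ge0 ltW. Qed.

Let q_fin w : regular_path w -> q w = (q0 w)%:E.
Proof.
move=> [_ iz _]; rewrite /q0 /Rintegral fineK//.
apply: (@integrable_fin_num _ _ _ leb `[a, b] _ (EFin \o (fun s => z s w ^+ 2))) => //.
apply: integrableS iz => // s; rewrite /= !in_itv/= => /andP[sa sb].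
by rewrite (le_trans a0)//= (le_trans sb).
Qed.

Let U_fin w : regular_path w -> U w = (U0 w)%:E.
Proof.
by move=> reg; rewrite /U (q_fin reg) (F_fin reg) -EFin_expe -EFinM -!EFinD.
Qed.

Let Yb2_ge0 w : (0 <= (Y b w ^+ 2)%:E)%E. Proof. by rewrite lee_fin sqr_ge0. Qed.

Let hq_ge0 w : (0 <= (c'' ^+ 2 * (b - a))%:E * q w)%E.
Proof. by rewrite mule_ge0// lee_fin. Qed.

Let YF_ge0 w : (0 <= (Y b w ^+ 2)%:E + F w ^+ 2)%E. Proof. exact: adde_ge0. Qed.

Let U_ge0 w : (0 <= U w)%E. Proof. exact: adde_ge0. Qed.

Let mYb2 : measurable_fun setT (fun w => (Y b w ^+ 2)%:E).
Proof.
apply/measurable_EFinP; apply: measurable_funX; apply: mY_at => //.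
by rewrite (le_trans a0)// ltW.
Qed.

Let mhq : measurable_fun setT (fun w => (c'' ^+ 2 * (b - a))%:E * q w)%E.
Proof. exact: emeasurable_funM. Qed.

Let mYF : measurable_fun setT (fun w => (Y b w ^+ 2)%:E + F w ^+ 2)%E.
Proof. exact: emeasurable_funD. Qed.

Let mU : measurable_fun setT U. Proof. exact: emeasurable_funD. Qed.

Definition terminal_energy : R :=
  \int[P]_w (Y b w ^+ 2) + fine (\int[P]_w (F w ^+ 2))%E.

(** Let v be the variance of I_b - I_a and e the terminal energy. Then:
    - the energy of Z is at most 4 v, so the Z-part of the driver contributes at
      most v / 32 and E[U] <= e + v / 32;
    - Y is dominated by Th with E[Th] <= 16 (e + v / 32 + 18 v);
    - Y_a is orthogonal to I_b - I_a, so v is at most the second moment of their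
      sum W, which involves only the terminal data and the driver, whence
      v <= 4 (e + v / 32 + E[Th] / 128^2).
    The last two lines give v <= 8 e, and all the bounds become multiples of e;
    3000 is a round number above the constants that result. *)
Lemma bsde_step : L2_fun P (Y b) -> exists Th : Omega -> \bar R, [/\
  measurable_fun setT Th, (forall w, 0 <= Th w)%E,
  {ae P, forall w, forall t, a <= t -> t <= b -> ((Y t w ^+ 2)%:E <= Th w)%E},
  (\int[P]_w Th w <= (3000 * terminal_energy)%:E)%E &
  (\int[P]_w q w <= (3000 * terminal_energy)%:E)%E].
Proof.
move=> L2b; have b0 := le_trans a0 (ltW ab); have aT := le_trans (ltW ab) bT.
have L2I : L2_fun P (fun w => I b w - I a w).
  by apply: L2_funB; exact: (L2_ito chain ito).
have [L [mL L0 IL EL]] := ito_maximal chain ito a0 ab bT.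
set v := \int[P]_w ((I b w - I a w) ^+ 2).
set e := terminal_energy.
have Ev : (\int[P]_w ((I b w - I a w) ^+ 2)%:E)%E = v%:E := L2_fun_sqrE L2I.
have v0 : 0 <= v by apply: Rintegral_ge0 => w _; exact: sqr_ge0.
have Eq : (\int[P]_w q w <= (4 * v)%:E)%E.
  by rewrite EFinM -Ev; exact: (ito_energy chain mZ ito a0 (ltW ab) bT).
have EL' : (\int[P]_w L w <= (8 * v)%:E)%E by rewrite EFinM -Ev.
have EU : (\int[P]_w U w <= (e + v / 32)%:E)%E.
  rewrite (ge0_integralD P measurableT (fun w _ => YF_ge0 w) mYF (fun w _ => hq_ge0 w) mhq).
  rewrite (ge0_integralD P measurableT (fun w _ => Yb2_ge0 w) mYb2 (fun w _ => F_sqr_ge0 w) mF2).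
  rewrite EFinD; apply: leeD.
    rewrite (L2_fun_sqrE L2b) /e /terminal_energy EFinD leeD2l// fineK//.
    by rewrite ge0_fin_numE ?driver_energy_finite//; apply: integral_ge0.
  rewrite (ge0_integralZl_EFin P measurableT (fun w _ => q_ge0 w) mq h_ge0).
  apply: (@le_trans _ _ ((128^-1)%:E * (4 * v)%:E)%E).
    apply: lee_pmul => //; rewrite ?lee_fin//; first exact: integral_ge0.
  by rewrite -EFinM lee_fin; lra.
have D0 w : (0 <= (2 * (I b w - I a w) ^+ 2)%:E)%E.
  by rewrite lee_fin mulr_ge0// sqr_ge0.
have mD : measurable_fun setT (fun w => (2 * (I b w - I a w) ^+ 2)%:E).
  apply/measurable_EFinP; apply: measurable_funM => //; apply: measurable_funX.
  by case: L2I.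
have L2_0 w : (0 <= 2%:E * L w)%E by rewrite mule_ge0.
have mL2 : measurable_fun setT (fun w => 2%:E * L w)%E by exact: emeasurable_funM.
have DL0 w : (0 <= (2 * (I b w - I a w) ^+ 2)%:E + 2%:E * L w)%E by exact: adde_ge0.
have mDL : measurable_fun setT (fun w => (2 * (I b w - I a w) ^+ 2)%:E + 2%:E * L w)%E.
  exact: emeasurable_funD.
have EDL : (\int[P]_w ((2 * (I b w - I a w) ^+ 2)%:E + 2%:E * L w) <= (18 * v)%:E)%E.
  rewrite (ge0_integralD P measurableT (fun w _ => D0 w) mD (fun w _ => L2_0 w) mL2).
  rewrite (ge0_integralZl_EFin P measurableT (fun w _ => L0 w) mL)//.
  have -> : (\int[P]_w (2 * (I b w - I a w) ^+ 2)%:E = (2 * v)%:E)%E.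
    under eq_integral do rewrite EFinM.
    rewrite ge0_integralZl_EFin//.
    - by rewrite Ev EFinM.
    - by move=> w _; rewrite lee_fin sqr_ge0.
    - by apply/measurable_EFinP; apply: measurable_funX; case: L2I.
  apply: (@le_trans _ _ ((2 * v)%:E + 2%:E * (8 * v)%:E)%E).
    by apply: leeD => //; apply: lee_wpmul2l.
  by rewrite -EFinM -EFinD lee_fin; lra.
pose Th w := (16%:E * (U w + ((2 * (I b w - I a w) ^+ 2)%:E + 2%:E * L w)))%E.
have UDL0 w : (0 <= U w + ((2 * (I b w - I a w) ^+ 2)%:E + 2%:E * L w))%E by exact: adde_ge0.
have mUDL : measurable_fun setT (fun w => U w + ((2 * (I b w - I a w) ^+ 2)%:E + 2%:E * L w))%E.
  exact: emeasurable_funD.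
have Th0 w : (0 <= Th w)%E by rewrite mule_ge0.
have mTh : measurable_fun setT Th by exact: emeasurable_funM.
have ETh : (\int[P]_w Th w <= (16 * (e + v / 32 + 18 * v))%:E)%E.
  rewrite (ge0_integralZl_EFin P measurableT (fun w _ => UDL0 w) mUDL)//.
  rewrite (ge0_integralD P measurableT (fun w _ => U_ge0 w) mU (fun w _ => DL0 w) mDL).
  rewrite EFinM (EFinD (e + v / 32)); apply: lee_wpmul2l => //; exact: (leeD EU EDL).
have L_fin : {ae P, forall w, L w \is a fin_num}.
  have iL : P.-integrable setT L.
    apply/integrableP; split => //; under eq_integral do rewrite gee0_abs//.
    by apply: le_lt_trans EL' _; rewrite ltry.
  exact: (ae_impl (fun w h => h Logic.I) (integrable_ae measurableT iL)).
have good := ae_and ae_regular_path L_fin.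
have ThE w : regular_path w -> L w \is a fin_num ->
    Th w = (16 * (U0 w + (2 * (I b w - I a w) ^+ 2 + 2 * fine (L w))))%:E.
  by move=> reg Lf; rewrite /Th (U_fin reg) -[in LHS](fineK Lf).
have YTh : forall w, regular_path w /\ L w \is a fin_num ->
    forall t, a <= t -> t <= b -> ((Y t w ^+ 2)%:E <= Th w)%E.
  move=> w [reg Lf] t at_ tb.
  have Il s : a <= s -> s <= b -> (I s w - I a w) ^+ 2 <= fine (L w).
    by move=> as_ sb; rewrite -lee_fin fineK//; exact: IL.
  rewrite (ThE w reg Lf) lee_fin.
  exact: Y_path_bound.
pose k := (c' * (b - a)) ^+ 2.
have k0 : 0 <= k by exact: sqr_ge0.
have k1 : k <= 128^-1 ^+ 2.
  by rewrite lerXn2r ?nnegrE// mulr_ge0 ?subr_ge0 ?ltW.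
pose W w := I b w - I a w + Y a w.
have WTh : forall w, regular_path w /\ L w \is a fin_num ->
    ((W w ^+ 2)%:E <= 4%:E * (U w + k%:E * Th w))%E.
  move=> w rL; have [reg Lf] := rL.
  have Tf : Th w \is a fin_num.
    by rewrite (ThE w reg Lf).
  pose m := Num.sqrt (fine (Th w)).
  have Ym t : a <= t -> t <= b -> `|Y t w| <= m.
    move=> at_ tb; rewrite -sqrtr_sqr ler_sqrt ?fine_ge0//.
    by rewrite -lee_fin fineK//; exact: YTh.
  have := terminal_path_bound reg Ym.
  rewrite sqr_sqrtr ?fine_ge0// -/k => h.
  rewrite (U_fin reg) -(fineK Tf).
  by rewrite -[leRHS]/((4 * (U0 w + k * fine (Th w)))%:E) lee_fin.
have L2a : L2_fun P (Y a).
  split; first exact: mY_at.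
  apply: (@le_lt_trans _ _ (\int[P]_w Th w)%E); last by apply: le_lt_trans ETh _; rewrite ltry.
  apply: ae_ge0_le_integral => //.
  - by move=> w _; rewrite lee_fin sqr_ge0.
  - by apply/measurable_EFinP; apply: measurable_funX; exact: mY_at.
  - by apply: (ae_impl _ good) => w rL _; apply: YTh => //; exact: ltW.
have L2W : L2_fun P W by exact: L2_funD.
have orth : \int[P]_w (Y a w * (I b w - I a w)) = 0.
  by apply: (ito_orth chain ito) => //; [exact: ltW|case: Y_proc => mYw _ _; exact: mYw].
have vW : v <= \int[P]_w (W w ^+ 2).
  have i1 := L2_fun_integrable_sqr L2I.
  have i2 := integrable_EFinZ 2 (L2_fun_mul L2a L2I).
  have -> : v = \int[P]_w ((I b w - I a w) ^+ 2 + 2 * (Y a w * (I b w - I a w))).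
    rewrite (RintegralD measurableT i1 i2) (RintegralZl _ measurableT (L2_fun_mul L2a L2I)).
    by rewrite orth mulr0 addr0.
  apply: le_Rintegral => //.
  - exact: integrable_EFinD.
  - exact: L2_fun_integrable_sqr.
  - move=> w _; rewrite /W; move: (I b w - I a w) (Y a w) => x y.
    by have := sqr_ge0 y; lra.
have kTh0 w : (0 <= k%:E * Th w)%E by rewrite mule_ge0.
have mkTh : measurable_fun setT (fun w => k%:E * Th w)%E by exact: emeasurable_funM.
have UkTh0 w : (0 <= U w + k%:E * Th w)%E by exact: adde_ge0.
have mUkTh : measurable_fun setT (fun w => U w + k%:E * Th w)%E by exact: emeasurable_funD.
have EW : (\int[P]_w (W w ^+ 2)%:E <=
    (4 * (e + v / 32 + 128^-1 ^+ 2 * (16 * (e + v / 32 + 18 * v))))%:E)%E.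
  apply: (@le_trans _ _ (\int[P]_w (4%:E * (U w + k%:E * Th w)))%E).
    apply: ae_ge0_le_integral => //.
    - by move=> w _; rewrite lee_fin sqr_ge0.
    - by apply/measurable_EFinP; apply: measurable_funX; case: L2W.
    - by move=> w _; rewrite mule_ge0.
    - exact: emeasurable_funM.
    - by apply: (ae_impl _ good) => w rL _; exact: WTh.
  rewrite (ge0_integralZl_EFin P measurableT (fun w _ => UkTh0 w) mUkTh)//.
  rewrite (ge0_integralD P measurableT (fun w _ => U_ge0 w) mU (fun w _ => kTh0 w) mkTh).
  rewrite (ge0_integralZl_EFin P measurableT (fun w _ => Th0 w) mTh)//.
  rewrite [leRHS]EFinM (EFinD (e + v / 32)); apply: lee_wpmul2l => //; apply: (leeD EU).
  rewrite [leRHS]EFinM; apply: lee_pmul => //.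
  exact: integral_ge0.
rewrite (L2_fun_sqrE L2W) lee_fin in EW.
have e0 : 0 <= e.
  rewrite addr_ge0//; first by apply: Rintegral_ge0 => w _; exact: sqr_ge0.
  by apply: fine_ge0; exact: integral_ge0.
have v8 : v <= 8 * e by lra.
exists Th; split => //.
- exact: (ae_impl YTh good).
- by apply: le_trans ETh _; rewrite lee_fin; lra.
- by apply: le_trans Eq _; rewrite lee_fin; lra.
Qed.

End step.

End bsde.

(** * Iteration over a grid *)

Section iteration.
Context {R : realType} {d : measure_display} {Omega : measurableType d}.
Variables (P : probability Omega R) (N : nat).
Variables (X : R -> Omega -> 'cV[R]_N) (A : R -> 'M[R]_N).
Hypothesis chain : markov_chain P X A.
Local Notation leb := (@lebesgue_measure R).
Variables (T c' c'' : R).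
Hypotheses (T0 : 0 < T) (c'0 : 0 < c') (c''0 : 0 < c'').
Variables (xi : Omega -> R) (f : Omega -> R -> R -> 'cV[R]_N -> R)
  (Y : R -> Omega -> R) (Z : R -> Omega -> 'cV[R]_N) (I : R -> Omega -> R).
Hypotheses (xi_var : L2_var P X T xi) (mf : driver_measurable P X T f)
  (f_lip : forall w t v1 v2 z1 z2, 0 <= t -> t <= T ->
     `|f w t v1 z1 - f w t v2 z2|
       <= c' * `|v1 - v2| + c'' * seminorm X A t w (z1 - z2))
  (f_sqr : (\int[P]_w \int[leb]_(t in `[0%R, T])
     (`|f w t 0 0 ^+ 2|)%:E < +oo)%E)
  (Y_proc : L2_proc P X T Y) (Z_proc : P2_proc P X A T Z)
  (ito : ito_integral P X A T Z I)
  (eqn : {ae P, forall w, forall t, 0 <= t -> t <= T ->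
     Y t w = xi w + \int[leb]_(s in `[t, T]) f w s (Y s w) (Z s w)
             - (I T w - I t w)}).

Let mxi : measurable_fun setT xi.
Proof.
exact: (measurable_wrt_fun (filtration_measurable chain (t := T)) xi_var.1).
Qed.

Let xi_L2 : L2_fun P xi.
Proof.
split => //; apply: le_lt_trans xi_var.2; rewrite le_eqVlt; apply/orP; left; apply/eqP.
by apply: eq_integral => w _; rewrite real_normK ?num_real.
Qed.

Let mY_at t : 0 <= t -> t <= T -> measurable_fun setT (Y t).
Proof.
case: Y_proc => mY _ _ t0 tT.
exact: (measurable_wrt_fun (filtration_measurable chain (t := t)) (mY t t0 tT)).
Qed.

Let z2 s w := seminorm X A s w (Z s w) ^+ 2.

Let z2_ge0 s w : (0 <= (z2 s w)%:E)%E. Proof. by rewrite lee_fin sqr_ge0. Qed.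

Let mz2 : measurable_fun (strip 0 T) (fun p : Omega * R => z2 p.2 p.1).
Proof.
apply: (seminorm_strip chain) => //; first exact: ltW.
move=> i; have [mZ _] := Z_proc.
apply: (@measurable_fun_coord _ _ _ (Omega * R)%type (strip 0 T) (fun p => Z p.2 p.1)).
exact: (predictable_strip chain T0 mZ).
Qed.

Let Q s t w := (\int[leb]_(u in `[s, t]) (z2 u w)%:E)%E.

Let Q_ge0 s t w : (0 <= Q s t w)%E. Proof. by apply: integral_ge0 => u _; exact: z2_ge0. Qed.

Let mQ s t : 0 <= s -> t <= T -> measurable_fun setT (Q s t).
Proof.
move=> s0 tT; apply: (measurable_time_integral (g := fun u w => (z2 u w)%:E)) => //.
by apply/measurable_EFinP; exact: measurable_stripS mz2.
Qed.

Let Q_split r s t w : 0 <= r -> r <= s -> s <= t -> t <= T ->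
  (Q r t w <= Q r s w + Q s t w)%E.
Proof.
move=> r0 rs st tT.
have mz u v : 0 <= u -> v <= T -> measurable_fun `[u, v] (fun x => (z2 x w)%:E).
  move=> u0 vT; apply/measurable_EFinP; apply: measurable_strip_section.
  exact: measurable_stripS mz2.
have e : `[r, t]%classic = `[r, s[%classic `|` `[s, t]%classic :> set R.
  by rewrite -itv_bndbnd_setU// bnd_simp.
have sub : (`[r, s[%classic : set R) `<=` `[r, s]%classic.
  by move=> u; rewrite /= !in_itv/= => /andP[-> /ltW].
rewrite /Q [in leLHS]e ge0_integral_setU//.
- apply: leeD => //; apply: ge0_subset_integral => //.
  by apply: mz => //; exact: le_trans tT.
- by rewrite -e; exact: mz.
- rewrite disj_set2E; apply/eqP; rewrite -subset0 => u [] /=.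
  by rewrite !in_itv/= => /andP[_ us] /andP[su _]; move: (lt_le_trans us su); rewrite ltxx.
Qed.

Let F w := (\int[leb]_(s in `[0%R, T]) `|f w s 0 0|%:E)%E.

Definition data_energy : R :=
  \int[P]_w (xi w ^+ 2) + fine (\int[P]_w (F w ^+ 2))%E.

Lemma data_energy_ge0 : 0 <= data_energy.
Proof.
apply: addr_ge0; first by apply: Rintegral_ge0 => w _; exact: sqr_ge0.
by apply: fine_ge0; apply: integral_ge0 => w _; rewrite expe2 mule_ge0 ?integral_ge0.
Qed.

(** The two conclusions of the estimate on [t, T], with constant C and with the
    supremum of Y replaced by a measurable upper bound. *)
Definition controls t C := exists Th : Omega -> \bar R, [/\
  measurable_fun setT Th, (forall w, 0 <= Th w)%E,
  {ae P, forall w, forall s, t <= s -> s <= T -> ((Y s w ^+ 2)%:E <= Th w)%E},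
  (\int[P]_w Th w <= (C * data_energy)%:E)%E &
  (\int[P]_w Q t T w <= (C * data_energy)%:E)%E].

Lemma controls_terminal : controls T 1.
Proof.
exists (fun w => (xi w ^+ 2)%:E); split.
- by apply/measurable_EFinP; exact: measurable_funX.
- by move=> w; rewrite lee_fin sqr_ge0.
- apply: (ae_impl _ eqn) => w /(_ T (ltW T0) (lexx T)) e s Ts sT.
  have -> : s = T by apply/le_anti; rewrite sT Ts.
  by rewrite e subrr subr0 set_itv1 Rintegral_set1 addr0.
- rewrite (L2_fun_sqrE xi_L2) lee_fin mul1r lerDl; apply: fine_ge0.
  by apply: integral_ge0 => w _; rewrite expe2 mule_ge0 ?integral_ge0.
- rewrite integral0_eq ?lee_fin ?mul1r ?data_energy_ge0// => w _.
  by rewrite /Q set_itv1 integral_set1.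
Qed.

(** The bound at time b controls the second moment of Y_b, so the step over
    [a, b] starts from at most C + 1 times the energy of the data. *)
Lemma controls_step a b C : 0 <= a -> a < b -> b <= T -> 1 <= C ->
  c' * (b - a) <= 128^-1 -> c'' ^+ 2 * (b - a) <= 128^-1 ->
  controls b C -> controls a (C + 3000 * (C + 1)).
Proof.
move=> a0 ab bT C1 s' s'' [Th [mTh Th0 YTh ETh EQ]].
have b0 := le_trans a0 (ltW ab); have aT := le_trans (ltW ab) bT.
have e0 := data_energy_ge0.
have Yb : (\int[P]_w (Y b w ^+ 2)%:E <= (C * data_energy)%:E)%E.
  apply: le_trans ETh; apply: ae_ge0_le_integral => //.
  - by move=> w _; rewrite lee_fin sqr_ge0.
  - by apply/measurable_EFinP; apply: measurable_funX; exact: mY_at.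
  - by apply: (ae_impl _ YTh) => w h _; exact: h.
have L2b : L2_fun P (Y b).
  by split; [exact: mY_at|apply: le_lt_trans Yb _; rewrite ltry].
have te : terminal_energy P T f Y b <= (C + 1) * data_energy.
  rewrite mulrDl mul1r; apply: lerD.
    by move: Yb; rewrite (L2_fun_sqrE L2b) lee_fin.
  by rewrite lerDr; apply: Rintegral_ge0 => w _; exact: sqr_ge0.
have [Th' [mTh' Th'0 YTh' ETh' EQ']] :=
  bsde_step chain T0 c'0 c''0 mf f_lip f_sqr Y_proc Z_proc ito eqn a0 ab bT s' s'' L2b.
have te' : ((3000 * terminal_energy P T f Y b)%:E <=
    (3000 * (C + 1) * data_energy)%:E)%E.
  by rewrite lee_fin -mulrA; exact: (ler_wpM2l (ler0n _ _) te).
exists (fun w => Th w + Th' w)%E; split.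
- exact: emeasurable_funD.
- by move=> w; exact: adde_ge0.
- apply: (ae_impl _ (ae_and YTh YTh')) => w [h h'] s as_ sT.
  have [bs|sb] := leP b s.
    by apply: le_trans (h s bs sT) _; rewrite leeDl.
  by apply: le_trans (h' s as_ (ltW sb)) _; rewrite leeDr.
- rewrite (ge0_integralD P measurableT (fun w _ => Th0 w) mTh (fun w _ => Th'0 w) mTh').
  by rewrite mulrDl EFinD; apply: leeD => //; exact: le_trans te'.
- apply: (@le_trans _ _ (\int[P]_w (Q a b w + Q b T w))%E).
    apply: ge0_le_lower_integral => w _ //.
    by apply: Q_split => //; exact: ltW.
  rewrite (ge0_integralD P measurableT (fun w _ => Q_ge0 a b w) (mQ a0 bT)
    (fun w _ => Q_ge0 b T w) (mQ b0 (lexx T))).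
  by rewrite mulrDl EFinD addeC; apply: leeD => //; exact: le_trans te'.
Qed.

(** The constant C_k that the recursion C -> C + 3000 (C + 1) of the backward step
    reaches from 1 after k steps; it involves neither the chain nor the data. *)
Fixpoint growth k : R := if k is k'.+1 then growth k' + 3000 * (growth k' + 1) else 1.

Lemma growth_ge1 k : 1 <= growth k.
Proof. by elim: k => //= k ih; lra. Qed.

Lemma controls_grid n h : 0 < h -> h *+ n = T -> c' * h <= 128^-1 ->
  c'' ^+ 2 * h <= 128^-1 -> forall k, (k <= n)%N -> controls (T - h *+ k) (growth k).
Proof.
move=> h0 hn s' s''; elim=> [|k ih] kn; first by rewrite mulr0n subr0; exact: controls_terminal.
have e : T - h *+ k - (T - h *+ k.+1) = h by rewrite mulrSr; ring.
apply: (@controls_step (T - h *+ k.+1) (T - h *+ k)) => //.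
- by rewrite -hn subr_ge0 (ler_wpMn2l (ltW h0)).
- by rewrite -subr_gt0 e.
- by rewrite gerBl mulrn_wge0// ltW.
- exact: growth_ge1.
- by rewrite e.
- by rewrite e.
- by apply: ih; exact: ltnW.
Qed.

End iteration.

Theorem proposition3p2 (R : realType) (T c' c'' : R)
    (T_gt0 : 0 < T) (c'_gt0 : 0 < c') (c''_gt0 : 0 < c'') :
  exists2 C' : R, 0 < C' &
    forall (d : measure_display) (Omega : measurableType d)
      (P : probability Omega R) (N : nat)
      (X : R -> Omega -> 'cV[R]_N) (A : R -> 'M[R]_N)
      (xi : Omega -> R) (f : Omega -> R -> R -> 'cV[R]_N -> R)
      (Y : R -> Omega -> R) (Z : R -> Omega -> 'cV[R]_N),
    markov_chain P X A ->
    L2_var P X T xi ->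
    driver_measurable P X T f ->
    (forall w t v1 v2 z1 z2, 0 <= t -> t <= T ->
       `|f w t v1 z1 - f w t v2 z2|
         <= c' * `|v1 - v2| + c'' * seminorm X A t w (z1 - z2)) ->
    (\int[P]_w \int[lebesgue_measure]_(t in `[0%R, T])
       (`|f w t 0 0 ^+ 2|)%:E < +oo)%E ->
    bsde_solution P X A T xi f Y Z ->
    (\int[P]_w ereal_sup [set (`|Y t w| ^+ 2)%:E | t in `[0%R, T]]
     + \int[P]_w \int[lebesgue_measure]_(t in `[0%R, T])
         (seminorm X A t w (Z t w) ^+ 2)%:E
     <= C'%:E * \int[P]_w
          ((`|xi w| ^+ 2)%:E
           + (\int[lebesgue_measure]_(s in `[0%R, T]) `|f w s 0 0|%:E) ^+ 2))%E.
Proof.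
(* the number n of steps makes h = T / n satisfy both smallness conditions of
   the backward step *)
pose n := (Num.truncn (T * (128 * (c' + c'' ^+ 2)))).+1.
pose h := T / n%:R.
have n0 : 0 < n%:R :> R by rewrite ltr0n.
have h0 : 0 < h by exact: divr_gt0.
have hn : h *+ n = T by rewrite -mulr_natr divfK// gt_eqF.
have c2 : 0 < c'' ^+ 2 by exact: exprn_gt0.
have hc : (c' + c'' ^+ 2) * h <= 128^-1.
  have := truncnS_gt (T * (128 * (c' + c'' ^+ 2))); rewrite -/n -{1}hn -mulr_natr.
  rewrite -[X in _ < X]mul1r mulrAC ltr_pM2r// => lt1.
  by move: (c'' ^+ 2) lt1 => c lt1; lra.
have s' : c' * h <= 128^-1.
  by apply: le_trans hc; rewrite ler_pM2r// lerDl ltW.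
have s'' : c'' ^+ 2 * h <= 128^-1.
  by apply: le_trans hc; rewrite ler_pM2r// lerDr ltW.
have G1 : 1 <= growth n :> R by exact: growth_ge1.
exists (2 * growth n); first by rewrite mulr_gt0// (lt_le_trans ltr01 G1).
move=> d Omega P N X A xi f Y Z chain xi_var mf f_lip f_sqr [Y_proc Z_proc [I ito eqn]].
have [Th [mTh Th0 YTh ETh EQ]] := controls_grid chain T_gt0 c'_gt0 c''_gt0
  xi_var mf f_lip f_sqr Y_proc Z_proc ito eqn h0 hn s' s'' (leqnn n).
rewrite hn subrr in YTh EQ.
have mxi : measurable_fun setT xi.
  exact: (measurable_wrt_fun (filtration_measurable chain (t := T)) xi_var.1).
have xi_sqr w : `|xi w| ^+ 2 = xi w ^+ 2 by rewrite real_normK ?num_real.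
have xi_L2 : L2_fun P xi.
  split => //; apply: le_lt_trans xi_var.2; rewrite le_eqVlt; apply/orP; left; apply/eqP.
  by apply: eq_integral => w _; rewrite xi_sqr.
have data : (\int[P]_w ((`|xi w| ^+ 2)%:E
     + (\int[lebesgue_measure]_(s in `[0%R, T]) `|f w s 0 0|%:E) ^+ 2))%E
    = (data_energy P T xi f)%:E.
  have F0 w : (0 <= \int[lebesgue_measure]_(s in `[0%R, T]) `|f w s 0 0|%:E)%E.
    exact: integral_ge0.
  have F20 w : (0 <= (\int[lebesgue_measure]_(s in `[0%R, T]) `|f w s 0 0|%:E) ^+ 2)%E.
    by rewrite expe2 mule_ge0.
  have mF2 : measurable_fun setT
      (fun w => (\int[lebesgue_measure]_(s in `[0%R, T]) `|f w s 0 0|%:E) ^+ 2)%E.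
    have mF : measurable_fun setT
        (fun w => \int[lebesgue_measure]_(s in `[0%R, T]) `|f w s 0 0|%:E)%E.
      apply: (measurable_time_integral (g := fun s w => `|f w s 0 0|%:E)) => [|s w]; last by rewrite lee_fin.
      apply/measurable_EFinP; apply: measurableT_comp => //.
      apply: (driver_strip chain T_gt0 (y := fun _ _ => 0) (z := fun _ _ => 0) mf).
        exact: measurable_cst.
      exact: measurable_cst.
    by under eq_fun do rewrite expe2; exact: emeasurable_funM.
  under eq_integral do rewrite xi_sqr.
  rewrite ge0_integralD//.
  - rewrite (L2_fun_sqrE xi_L2) EFinD; congr (_ + _)%E; rewrite fineK//.
    rewrite ge0_fin_numE; last exact: integral_ge0.
    exact: (driver_energy_finite chain T_gt0 mf f_sqr Z_proc eqn).
  - by move=> w _; rewrite lee_fin sqr_ge0.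
  - by apply/measurable_EFinP; exact: measurable_funX.
rewrite data -EFinM -mulrA mulr_natl mulr2n EFinD.
apply: leeD => //; apply: le_trans ETh; apply: ae_le_lower_integral => //.
- move=> w; apply: (@le_trans _ _ (`|Y 0 w| ^+ 2)%:E); first by rewrite lee_fin sqr_ge0.
  by apply: ereal_sup_ubound; exists 0 => //=; rewrite in_itv/= lexx ltW.
- apply: (ae_impl _ YTh) => w Yw; apply: ge_ereal_sup => _ [t + <-].
  by rewrite /= in_itv/= => /andP[t0 tT]; rewrite real_normK ?num_real//; exact: Yw.
Qed.
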